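(* Let $N\ge1$ and let $B_1(0)\subset\mathbb{R}^N$ be the unit ball. Let $f:[0,\infty[\to[0,\infty[$ be an increasing $C^1$ function with $f(0)>0$ and $\lim_{s\to\infty}f(s)/s^{p-1}=\infty$ for all $p>1$ close enough to $1$. For $p>1$ small enough (close to $1$), denote by $\{w_{\lambda(p)}\}_{\lambda\in[0,\lambda_p^*]}$ the increasing branch of positive minimal solutions to the problem $$-\Delta_pu=\lambda f(u)\ \text{ in }B_1(0),\qquad u=0\ \text{ on }\partial B_1(0),$$ where $\lambda_p^*$ is the critical value such that there are no bounded solutions for $\lambda>\lambda_p^*$. Then: (1) $\lambda_p^*\to\frac{N}{f(0)}$ as $p\to1$. (2) $\|w_{\tilde\lambda(p)}\|_\infty\to0$ as $p\to1$, for every $\tilde\lambda\in\left[0,\frac{N}{f(0)}\right[$.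
   Context: $\Delta_pu=\operatorname{div}(|\nabla u|^{p-2}\nabla u)$. A (weak) solution for $p>1$ is $u\in W_0^{1,p}(B_1(0))$ with $\int|\nabla u|^{p-2}\nabla u\cdot\nabla\varphi=\int\lambda f(u)\varphi$ for all $\varphi\in C_c^\infty(B_1(0))$. A solution is regular if $f(u)\in L^\infty$. It is known that there is $\lambda_p^*>0$ such that for each $\lambda<\lambda_p^*$ there is a minimal regular solution $w_{\lambda(p)}$ (minimal: less than or equal to any other nonnegative solution), increasing in $\lambda$, and for $\lambda>\lambda_p^*$ there is no regular solution. For $\lambda=\lambda_p^*$, $w_{\lambda_p^*(p)}=\lim_{\lambda\to\lambda_p^*}w_{\lambda(p)}$ is the extremal solution, which is known to be bounded if $N<\frac{p^2+3p}{p-1}$ (hence for $p$ close to $1$). For $\lambda=0$ the solution is $0$. *)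

(* Defs.v *)
From HB Require Import structures.
From mathcomp Require Import all_boot all_order all_algebra.
From mathcomp Require Import all_classical all_reals all_analysis.

Set Implicit Arguments.
Unset Strict Implicit.
Unset Printing Implicit Defensive.

Import Order.TTheory GRing.Theory Num.Theory.
Import numFieldNormedType.Exports.

Local Open Scope classical_set_scope.
Local Open Scope ring_scope.

(* The sigma-algebra on row vectors generated by the coordinates; on 'rV[R]_n
   this is the Borel sigma-algebra. *)
Definition measure_rV_display : measure_display -> measure_display.
Proof. exact. Qed.

Section measurable_rV.
Context {d} {T : measurableType d}.
Variable n : nat.

Let coors : 'I_n -> 'rV[T]_n -> T := fun i x => x ord0 i.

Let rV_set0 : g_sigma_preimage coors set0.
Proof. exact: sigma_algebra0. Qed.

Let rV_setC A : g_sigma_preimage coors A -> g_sigma_preimage coors (~` A).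
Proof. exact: sigma_algebraC. Qed.

Let rV_bigcup (F : _^nat) : (forall i, g_sigma_preimage coors (F i)) ->
  g_sigma_preimage coors (\bigcup_i (F i)).
Proof. exact: sigma_algebra_bigcup. Qed.

HB.instance Definition _ := @isMeasurable.Build (measure_rV_display d)
  'rV[T]_n (g_sigma_preimage coors) rV_set0 rV_setC rV_bigcup.

End measurable_rV.


Lemma measurable_coord d (T : measurableType d) n (i : 'I_n) :
  measurable_fun [set: 'rV[T]_n] (fun x => x ord0 i).
Proof.
move=> _ Y mY; rewrite setTI; apply: sub_sigma_algebra => /=.
rewrite -bigcup_seq/=; exists i => /=; first by rewrite mem_index_enum.
by exists Y => //; rewrite setTI.
Qed.

Lemma measurable_fun_rVP d1 d2 (T1 : measurableType d1) (T2 : measurableType d2)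
    n (f : T1 -> 'rV[T2]_n) :
  (forall i, measurable_fun [set: T1] (fun x => f x ord0 i)) ->
  measurable_fun [set: T1] f.
Proof.
move=> mf.
suff h : g_sigma_preimage (fun i => (fun x : 'rV[T2]_n => x ord0 i) \o f)
    `<=` measurable.
  by move=> _ A mA; apply: h; rewrite g_sigma_preimage_comp; exists A.
apply: smallest_sub; first exact: sigma_algebra_measurable.
case: n => [|n] in f mf *; first by rewrite big_ord0.
rewrite -bigcup_mkord_ord; apply: bigcup_sub => i Ii.
by move=> A [B mB <-]; exact: mf.
Qed.

(* One induction step R^n -> R^(n+1): the image of lebesgue_measure \x mu under
   the identification of R * R^n with R^(n+1). *)
Section lebesgue_step.
Context {R : realType} (n : nat).
Variable mu : {sigma_finite_measure set 'rV[R]_n -> \bar R}.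

Definition consrV (z : measurableTypeR R * 'rV[R]_n) : 'rV[R]_n.+1 :=
  @row_mx R 1 1 n (const_mx z.1) z.2.

Definition unconsrV (x : 'rV[R]_n.+1) : measurableTypeR R * 'rV[R]_n :=
  (x ord0 ord0, @rsubmx R 1 1 n x).

Lemma unconsrVK : cancel consrV unconsrV.
Proof.
move=> [a v]; rewrite /unconsrV /consrV row_mxKr; congr pair.
rewrite (_ : ord0 = lshift n (ord0 : 'I_1)); last exact/val_inj.
by rewrite (@row_mxEl _ 1 1 n) mxE.
Qed.

Lemma measurable_consrV : measurable_fun [set: _] consrV.
Proof.
apply: measurable_fun_rVP => i.
case: (splitP (i : 'I_(1 + n))) => j ij.
  rewrite (_ : (fun _ => _) = fst); first exact: measurable_fst.
  apply/funext => z; rewrite /consrV (_ : i = lshift n j); last exact/val_inj.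
  by rewrite (@row_mxEl _ 1 1 n) mxE.
rewrite (_ : (fun _ => _) = (fun x : 'rV[R]_n => x ord0 j) \o snd).
  by apply: measurableT_comp; [exact: measurable_coord|exact: measurable_snd].
apply/funext => z; rewrite /consrV (_ : i = rshift 1 j); last exact/val_inj.
by rewrite (@row_mxEr _ 1 1 n).
Qed.

Lemma measurable_unconsrV : measurable_fun [set: _] unconsrV.
Proof.
rewrite /unconsrV.
apply: (@measurable_fun_pair _ _ _ _ (measurableTypeR R) 'rV[R]_n).
  exact: (@measurable_coord _ R n.+1).
apply: measurable_fun_rVP => i.
rewrite (_ : (fun _ => _) = fun x : 'rV[R]_n.+1 => x ord0 (rshift 1 i)).
  exact: measurable_coord.
by apply/funext => x; rewrite /= mxE.
Qed.

Definition lebesgue_step : set 'rV[R]_n.+1 -> \bar R :=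
  pushforward (lebesgue_measure \x mu)%E consrV.

Let lebesgue_step0 : lebesgue_step set0 = 0%E.
Proof. by rewrite /lebesgue_step /pushforward preimage_set0 measure0. Qed.

Let lebesgue_step_ge0 A : (0 <= lebesgue_step A)%E.
Proof. by rewrite /lebesgue_step /pushforward; exact: measure_ge0. Qed.

Let lebesgue_step_sigma_additive : semi_sigma_additive lebesgue_step.
Proof.
by apply: measure_semi_sigma_additive; exact: measurable_consrV.
Qed.

HB.instance Definition _ := isMeasure.Build _ _ _ lebesgue_step
  lebesgue_step0 lebesgue_step_ge0 lebesgue_step_sigma_additive.

Let lebesgue_step_sigma_finite : sigma_finite [set: _] lebesgue_step.
Proof.
have /sigma_finiteP[F [TF ndF Foo]] :=
  @sigma_finiteT _ (measurableTypeR R) R (@lebesgue_measure R).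
have /sigma_finiteP[G [TG ndG Goo]] := sigma_finiteT mu.
exists (fun i => unconsrV @^-1` (F i `*` G i)).
  rewrite -preimage_bigcup (_ : \bigcup_i _ = setT) ?preimage_setT//.
  rewrite -subTset => -[x y] _.
  have : [set: measurableTypeR R] x by [].
  rewrite TF => -[i _ Fix].
  have : [set: 'rV[R]_n] y by [].
  rewrite TG => -[k _ Gky].
  exists (maxn i k) => //; split => /=.
    by move: (x) Fix; exact/subsetPset/ndF/leq_maxl.
  by move: (y) Gky; exact/subsetPset/ndG/leq_maxr.
move=> i; have [mFi Fioo] := Foo i; have [mGi Gioo] := Goo i.
have mFG : measurable (F i `*` G i) by exact: measurableX.
split; first by rewrite -[X in measurable X]setTI; exact: measurable_unconsrV.
rewrite /lebesgue_step /pushforward -comp_preimage.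
rewrite (_ : unconsrV \o consrV = id); last first.
  by apply/funext => z /=; rewrite unconsrVK.
by rewrite preimage_id product_measure1E// lte_mul_pinfty// ge0_fin_numE.
Qed.

HB.instance Definition _ := Measure_isSigmaFinite.Build _ _ _ lebesgue_step
  lebesgue_step_sigma_finite.

End lebesgue_step.

(* Lebesgue measure on R^n (see lebesgue_rV_box). *)
Fixpoint lebesgue_rV {R : realType} (n : nat) :
    {sigma_finite_measure set 'rV[R]_n -> \bar R} :=
  match n with
  | 0 => \d_(0 : 'rV[R]_0)
  | m.+1 => lebesgue_step (lebesgue_rV m)
  end.

Lemma lebesgue_rV_box (R : realType) (n : nat) (A : 'I_n -> set R) :
  (forall i, measurable (A i)) ->
  lebesgue_rV n [set x : 'rV[R]_n | forall i, A i (x ord0 i)]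
  = (\prod_(i < n) (lebesgue_measure (A i : set (measurableTypeR R))))%E.
Proof.
elim: n A => [|n IH] A mA.
  rewrite big_ord0 /= diracE mem_set//.
  by case.
rewrite big_ord_recl -IH; last by move=> i; exact: mA.
rewrite /= /lebesgue_step /pushforward.
set B := [set y : 'rV[R]_n | _].
have mB : measurable B.
  rewrite (_ : B = \bigcap_(i in [set: 'I_n])
      ((fun y : 'rV[R]_n => y ord0 i) @^-1` (A (lift ord0 i)))).
    apply: fin_bigcap_measurable => // i _.
    by rewrite -[X in measurable X]setTI; exact: measurable_coord.
  by apply/seteqP; split => [y By i _|y By i]; exact: By.
rewrite [RHS](_ : _ = (lebesgue_measure \x lebesgue_rV n)%E (A ord0 `*` B)).
  congr ((lebesgue_measure \x lebesgue_rV n)%E _).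
  have consr0 (z : measurableTypeR R * 'rV[R]_n) : consrV z ord0 ord0 = z.1.
    rewrite /consrV (_ : ord0 = lshift n (ord0 : 'I_1)); last exact/val_inj.
    by rewrite (@row_mxEl _ 1 1 n) mxE.
  have consrS (z : measurableTypeR R * 'rV[R]_n) i :
      consrV z ord0 (lift ord0 i) = z.2 ord0 i.
    rewrite /consrV (_ : lift ord0 i = rshift 1 i); last exact/val_inj.
    by rewrite (@row_mxEr _ 1 1 n).
  apply/seteqP; split => z /=.
    move=> Az; split; first by rewrite -consr0; exact: Az.
    by move=> i; rewrite -consrS; exact: Az.
  move=> [Az0 Bz] i; case: (unliftP ord0 i) => [j ->|->].
    by rewrite consrS; exact: Bz.
  by rewrite consr0.
have E := @product_measure1E _ _ (measurableTypeR R) _ R lebesgue_measure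
  (lebesgue_rV n) _ _ (mA ord0) mB.
exact (esym E).
Qed.

Section euclidean.
Context {R : realType} {n : nat}.

Definition dot (x y : 'rV[R]_n) : R := \sum_i x ord0 i * y ord0 i.

(* The library's norm `|x| on 'rV[R]_n is the sup norm. *)
Definition eucl_norm (x : 'rV[R]_n) : R := Num.sqrt (dot x x).

Definition unit_ball : set 'rV[R]_n := [set x | eucl_norm x < 1].

Definition partial (i : 'I_n) (u : 'rV[R]_n -> R) : 'rV[R]_n -> R :=
  'D_(delta_mx ord0 i) u.

Definition gradient (u : 'rV[R]_n -> R) (x : 'rV[R]_n) : 'rV[R]_n :=
  \row_i partial i u x.

Fixpoint Cn (k : nat) (u : 'rV[R]_n -> R) : Prop :=
  match k with
  | 0 => continuous u
  | m.+1 => continuous u /\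
      forall i, (forall x, derivable u x (delta_mx ord0 i)) /\ Cn m (partial i u)
  end.

(* C_c^oo(B_1(0)) *)
Definition test_function (phi : 'rV[R]_n -> R) : Prop :=
  [/\ forall k, Cn k phi,
      compact (closure [set x | phi x != 0]) &
      closure [set x | phi x != 0] `<=` unit_ball].

(* The norm of L^q(B_1(0)), for 1 <= q <= +oo. *)
Definition ball_norm (q : \bar R) (u : 'rV[R]_n -> R) : \bar R :=
  'N[lebesgue_rV n]_q[EFin \o (u \_ unit_ball)].

Definition Lball (q : \bar R) (u : 'rV[R]_n -> R) : Prop :=
  measurable_fun unit_ball u /\ (ball_norm q u < +oo)%E.

Definition weak_gradient (u : 'rV[R]_n -> R) (G : 'rV[R]_n -> 'rV[R]_n) : Prop :=
  forall phi, test_function phi -> forall i,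
    \int[lebesgue_rV n]_(x in unit_ball) (u x * partial i phi x)
    = - \int[lebesgue_rV n]_(x in unit_ball) (G x ord0 i * phi x).

(* u is in W^{1,p}(B_1(0)), with weak gradient G. *)
Definition W1p (p : R) (u : 'rV[R]_n -> R) (G : 'rV[R]_n -> 'rV[R]_n) : Prop :=
  [/\ Lball p%:E u, forall i, Lball p%:E (fun x => G x ord0 i) &
      weak_gradient u G].

(* W_0^{1,p}(B_1(0)) is the closure of C_c^oo(B_1(0)) in W^{1,p}(B_1(0)). *)
Definition W01p (p : R) (u : 'rV[R]_n -> R) (G : 'rV[R]_n -> 'rV[R]_n) : Prop :=
  W1p p u G /\
  exists phi : nat -> 'rV[R]_n -> R,
    [/\ forall k, test_function (phi k),
        ball_norm p%:E (fun x => phi k x - u x) @[k --> \oo] --> 0%E &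
        forall i, ball_norm p%:E (fun x => partial i (phi k) x - G x ord0 i)
                    @[k --> \oo] --> 0%E].

End euclidean.

Section plaplace_problem.
Context {R : realType} {n : nat}.
Variables (f : R -> R) (p : R).
Implicit Types (l : R) (u : 'rV[R]_n -> R).

(* Solutions are nonnegative because f is only considered on [0, +oo[. The
   integrability clause keeps \int from taking its default value. *)
Definition weak_solution l u : Prop :=
  {ae lebesgue_rV n, forall x, unit_ball x -> 0 <= u x} /\
  exists2 G : 'rV[R]_n -> 'rV[R]_n, W01p p u G &
    forall phi, test_function phi ->
      (lebesgue_rV n).-integrable unit_ball
        (fun x => (l * f (u x) * phi x)%:E) /\
      \int[lebesgue_rV n]_(x in unit_ball)
        (eucl_norm (G x) `^ (p - 2) * dot (G x) (gradient phi x))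
      = \int[lebesgue_rV n]_(x in unit_ball) (l * f (u x) * phi x).

Definition regular_solution l u : Prop :=
  weak_solution l u /\ Lball +oo (f \o u).

Definition minimal_regular_solution l u : Prop :=
  regular_solution l u /\
  forall v, weak_solution l v ->
    {ae lebesgue_rV n, forall x, unit_ball x -> u x <= v x}.

(* ls is the critical value and w the branch of minimal solutions on [0, ls].
   The limit at ls is taken along sequences, as each w l is only determined up
   to a null set depending on l. *)
Record minimal_branch (ls : R) (w : R -> 'rV[R]_n -> R) : Prop := {
  branch_critical_gt0 : 0 < ls ;
  branch_minimal : forall l, 0 <= l < ls -> minimal_regular_solution l (w l) ;
  branch_nonexistence : forall l, ls < l -> forall u, ~ regular_solution l u ;
  branch_extremal : forall l_ : nat -> R,
    (forall k, 0 <= l_ k < ls) -> l_ k @[k --> \oo] --> ls ->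
    {ae lebesgue_rV n, forall x, unit_ball x ->
      w (l_ k) x @[k --> \oo] --> w ls x} ;
  branch_increasing : forall l m, 0 <= l -> l <= m -> m <= ls ->
    {ae lebesgue_rV n, forall x, unit_ball x -> w l x <= w m x} ;
  branch_positive : forall l, 0 < l <= ls ->
    {ae lebesgue_rV n, forall x, unit_ball x -> 0 < w l x}
}.

End plaplace_problem.

(* f is C^1 on [0, +oo[, with a one-sided derivative at 0. *)
Definition C1_halfline {R : realType} (f : R -> R) : Prop :=
  exists f' : R -> R, {within `[0, +oo[, continuous f'} /\
    forall x, 0 <= x ->
      (fun y => (f y - f x) / (y - x)) @ within `[0, +oo[%classic x^' --> f' x.

(* Main.v *)
(* Lower bound for the critical value. If l f(0) < N, choose a small M with
   l f(M) < N. The radial problem is a fixed point equation whose monotone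
   operator maps the constant M to a function bounded by
   (l f(M) / N)^(1/(p-1)), which is at most M for p close to 1. Hence M is a
   supersolution and Tarski's theorem gives a radial solution with values in
   [0, M]: it is regular, so that l <= lambda_p^*, and it dominates the minimal
   solution, which therefore tends to 0 uniformly.

   Upper bound. If l f(0) > N, superlinearity gives, for p close to 1,
   l f(s) >= K (1 + 2 s)^(p-1) for all s >= 0, with K > N. Testing the equation
   of a solution w with zeta^2 (1 + w)^(1-p), Picone's inequality bounds
   K * int zeta^2 by a quantity which tends, as p -> 1, to the integral of
   |grad (zeta^2)|. For a radial cut-off zeta equal to 1 on a large part of the
   ball, the divergence theorem for the field x bounds this integral by K' times
   the integral of zeta^2, for any given K' > N. With K' < K this excludes
   solutions. *)

Require Import Defs.
From mathcomp Require Import all_boot all_order all_algebra.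
From mathcomp Require Import all_classical all_reals all_analysis.
From mathcomp Require Import measurable_realfun ess_sup_inf ring lra.

Set Implicit Arguments.
Unset Strict Implicit.
Unset Printing Implicit Defensive.

Import Order.TTheory GRing.Theory Num.Theory.
Import numFieldNormedType.Exports.

Local Open Scope classical_set_scope.
Local Open Scope ring_scope.

(** * Continuous functions and Lebesgue measure on row vectors *)

Section measure_space.
Context {R : realType}.

(** The two bounds meet different obstacles. For existence, the fixed point is at first only known
    to be monotone. Its flux, however, is the explicit field [- H(|x|^2) x], with [H] a multiple of
    the average of the source over a ball. This field has classical partial derivatives even where
    [|grad u|^(p-2)] is singular, so that the weak equation reduces to a classical integration by
    parts. Profiles are functions of [s = |x|^2], which unlike [|x|] is smooth at the origin. It is
    therefore replaced inside the test function by its smooth approximations; boundedness of [f(w)]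
    and Hoelder's inequality make the errors vanish. The cut-off is chosen before [p], so its
    gradient bound [L] enters only through [(2 L)^(p-1)], which tends to 1. The constant [N] has the
    same origin in both bounds: it is the divergence of the field [x]. *)

Lemma open_measurable_rV n (A : set 'rV[R]_n) : open A -> measurable A.
Proof.
move=> oA.
(* Boxes with rational centre and radius [1/(k+1)] are countably many, and an open set is the union
   of those that it contains. *)
pose box (q : 'rV[rat]_n * nat) : set 'rV[R]_n :=
  [set y | forall i, `|y ord0 i - ratr (q.1 ord0 i)| < q.2.+1%:R^-1].
have mbox q : measurable (box q).
  rewrite (_ : box q = \bigcap_(i in [set: 'I_n])
      ((fun y : 'rV[R]_n => y ord0 i) @^-1`
        [set t | `|t - ratr (q.1 ord0 i)| < q.2.+1%:R^-1])).
    apply: fin_bigcap_measurable => // i _.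
    rewrite -[X in measurable X]setTI; apply: measurable_coord => //.
    rewrite (_ : [set _ | _] = `]ratr (q.1 ord0 i) - q.2.+1%:R^-1,
        ratr (q.1 ord0 i) + q.2.+1%:R^-1[%classic).
      exact: measurable_itv.
    by apply/seteqP; split => t /=; rewrite in_itv/= ltr_distl.
  by apply/seteqP; split => [y By i _|y By i]; exact: By.
pose B (m : nat) : set 'rV[R]_n :=
  if unpickle m is Some q then (if `[< box q `<=` A >] then box q else set0)
  else set0.
suff -> : A = \bigcup_m B m.
  apply: bigcupT_measurable => m; rewrite /B; case: unpickle => [q|] //.
  by case: ifP.
apply/seteqP; split => [x Ax|x [m _]]; last first.
  rewrite /B; case: unpickle => // q; case: ifPn => // /asboolP; exact.
have /nbhs_ballP[e/= e0 xeA] : nbhs x A by exact: open_nbhs_nbhs.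
have [k ke] : exists k : nat, k.+1%:R^-1 < e / 2.
  have e2 : 0 < e / 2 by rewrite divr_gt0.
  have := near_infty_natSinv_lt (PosNum e2) => -[k _ kP].
  by exists k; exact: (kP k (leqnn k)).
have k0 : 0 < k.+1%:R^-1 :> R by rewrite invr_gt0.
have /choice[q qP] (i : 'I_n) :
    exists q : rat, `|x ord0 i - ratr q| < k.+1%:R^-1.
  have : x ord0 i - k.+1%:R^-1 < x ord0 i + k.+1%:R^-1 by rewrite ltrBlDr -addrA ltrDl addr_gt0.
  move=> /rat_in_itvoo[q]; rewrite in_itv/= => qx.
  by exists q; rewrite distrC ltr_distl.
exists (pickle (\row_i q i, k)) => //; rewrite /B pickleK.
have bA : box (\row_i q i, k) `<=` A.
  move=> y By; apply: xeA; split => // i j; rewrite ord1 /ball/=.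
  rewrite -[x _ _](subrK (ratr (q j))) -addrA.
  rewrite (le_lt_trans (ler_normD _ _))// [e]splitr ltrD//.
    exact: lt_trans (qP j) ke.
  by rewrite distrC; apply: lt_trans ke; have := By j; rewrite /= mxE.
rewrite asboolT// => i /=; rewrite mxE; exact: qP.
Qed.

Lemma continuous_measurable_rV n (F : 'rV[R]_n -> R) : continuous F ->
  measurable_fun [set: 'rV[R]_n] F.
Proof.
move=> /continuousP cF; apply: (measurability _ (RGenOpens.measurableE R)).
move=> _ [_ [a [b ->] <-]]; rewrite setTI; apply: open_measurable_rV.
exact/cF/interval_open.
Qed.

End measure_space.

(** * Smooth functions *)

Section smooth_line.
Context {R : realType}.
Implicit Types g h : R -> R.

Fixpoint Ck (k : nat) (g : R -> R) : Prop :=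
  match k with
  | 0 => continuous g
  | m.+1 => (forall x, derivable g x 1) /\ Ck m (g^`())%classic
  end.

Lemma derivable_continuous g : (forall x, derivable g x 1) -> continuous g.
Proof.
move=> dg x; apply: differentiable_continuous.
exact/derivable1_diffP.
Qed.

Lemma is_derive_Ck k g dg :
  (forall x, is_derive x (1 : R) g (dg x)) -> Ck k dg -> Ck k.+1 g.
Proof.
move=> gdg Cdg; split; first by move=> x; have [] := gdg x.
suff -> : (g^`())%classic = dg by [].
by apply/funext => x; rewrite derive1E; have [_ ->] := gdg x.
Qed.

Lemma CkS k g : Ck k.+1 g -> Ck k g.
Proof.
elim: k g => [g [dg _]|k IH g [dg Cg]]; first exact: derivable_continuous.
by split => //; exact: IH.
Qed.

Lemma Ck_is_derive k g x : Ck k.+1 g -> is_derive x (1 : R) g ((g^`())%classic x).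
Proof. by case=> dg _; rewrite derive1E; exact/derivableP. Qed.

Lemma Ck_continuous k g : Ck k g -> continuous g.
Proof. by case: k => // k [dg _]; exact: derivable_continuous. Qed.

Lemma Ck_cst k c : Ck k (fun _ : R => c).
Proof.
elim: k c => [|k IH] c; first exact: cst_continuous.
by apply: (is_derive_Ck _ (IH 0)) => x; exact: is_derive_cst.
Qed.

Lemma Ck_id k : Ck k (fun x : R => x).
Proof.
case: k => [|k]; first by move=> x; exact: cvg_id.
by apply: (is_derive_Ck _ (Ck_cst k 1)) => x; exact: is_derive_id.
Qed.

Lemma CkD k g h : Ck k g -> Ck k h -> Ck k (fun x => g x + h x).
Proof.
elim: k g h => [|k IH] g h; first by move=> cg ch x; apply: cvgD; [exact: cg|exact: ch].
move=> Cg Ch; apply: (is_derive_Ck (dg := fun x => (g^`())%classic x + (h^`())%classic x)).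
  move=> x; have ? := Ck_is_derive x Cg; have ? := Ck_is_derive x Ch.
  exact: is_deriveD.
by apply: IH; [case: Cg|case: Ch].
Qed.

Lemma CkM k g h : Ck k g -> Ck k h -> Ck k (fun x => g x * h x).
Proof.
elim: k g h => [|k IH] g h; first by move=> cg ch x; apply: cvgM; [exact: cg|exact: ch].
move=> Cg Ch.
apply: (is_derive_Ck (dg := fun x => g x * (h^`())%classic x + h x * (g^`())%classic x)).
  move=> x; have ? := Ck_is_derive x Cg; have ? := Ck_is_derive x Ch.
  exact: is_deriveM.
by apply: CkD; apply: IH; [exact: CkS|case: Ch|exact: CkS|case: Cg].
Qed.

Lemma CkZ k c g : Ck k g -> Ck k (fun x => c * g x).
Proof. by move=> Cg; apply: CkM => //; exact: Ck_cst. Qed.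

Lemma CkN k g : Ck k g -> Ck k (fun x => - g x).
Proof.
move=> /(CkZ (-1)); rewrite (_ : (fun x => -1 * g x) = fun x => - g x)//.
by apply/funext => x; rewrite mulN1r.
Qed.

Lemma is_derive_pow (m : nat) (x : R) :
  is_derive x (1 : R) (fun y : R => y ^+ m) (m%:R * x ^+ m.-1).
Proof.
apply: DeriveDef; first exact: exprn_derivable.
by rewrite exp_derive [_%:A]mulr1 -mulr_natl.
Qed.

Lemma Ck_comp k g h : Ck k g -> Ck k h -> Ck k (fun x => g (h x)).
Proof.
elim: k g h => [|k IH] g h.
  by move=> cg ch x; apply: continuous_comp; [exact: ch|exact: cg].
move=> Cg Ch.
apply: (is_derive_Ck (dg := fun x => (g^`())%classic (h x) * (h^`())%classic x)).
  move=> x; have ? := Ck_is_derive (h x) Cg; have ? := Ck_is_derive x Ch.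
  exact: is_derive1_comp.
apply: CkM; last by case: Ch.
by apply: IH; [case: Cg|exact: CkS].
Qed.

Lemma Ck_sum k (I : Type) (r : seq I) (G : I -> R -> R) :
  (forall i, Ck k (G i)) -> Ck k (fun x => \sum_(i <- r) G i x).
Proof.
move=> CG; elim: r => [|i r IH].
  by under eq_fun do rewrite big_nil; exact: Ck_cst.
by under eq_fun do rewrite big_cons; exact: CkD.
Qed.

Lemma Ck_powR k (a : R) g : (forall x, 0 < g x) -> Ck k g ->
  Ck k (fun x => g x `^ a).
Proof.
elim: k a g => [|k IH] a g g0 Cg.
  move=> x; apply: (@continuous_comp _ _ _ g (fun y => y `^ a)); first exact: Cg.
  apply: differentiable_continuous; apply/derivable1_diffP.
  by apply: derivable_powR; rewrite in_itv/= g0.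
apply: (is_derive_Ck (dg := fun x => a * g x `^ (a - 1) * (g^`())%classic x)).
  move=> x; have ? := Ck_is_derive x Cg; have ? := is_derive1_powR a (g0 x).
  exact: (@is_derive1_comp _ (fun y => y `^ a) g).
by apply: CkM; [apply: CkZ; apply: IH => //; exact: CkS|case: Cg].
Qed.

End smooth_line.

Section smooth_space.
Context {R : realType} {n : nat}.
Implicit Types (u v : 'rV[R]_n -> R) (i : 'I_n).

Lemma is_derive_line u x (v : 'rV[R]_n) (l : R) :
  is_derive (0 : R) (1 : R) (fun t => u (t *: v + x)) l -> is_derive x v u l.
Proof.
move=> [d dE]; apply: DeriveDef; first exact/derivable1P.
rewrite -dE /derive; congr (lim (_ @ 0^')).
by apply/funext => h /=; rewrite addr0 scale0r add0r [_%:A]mulr1.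
Qed.

Lemma line_is_derive u x (v : 'rV[R]_n) (l : R) :
  is_derive x v u l -> is_derive (0 : R) (1 : R) (fun t => u (t *: v + x)) l.
Proof.
move=> [d dE]; apply: DeriveDef; first exact: (iffLR (derivable1P u x v)).
rewrite -dE /derive; congr (lim (_ @ 0^')).
by apply/funext => h /=; rewrite addr0 scale0r add0r [_%:A]mulr1.
Qed.

(** [Cn] speaks of directional derivatives only, so the chain rule is obtained on the line through
    [x] along [v] instead of from Fréchet differentiability. *)
Lemma is_derive_comp_line (g : R -> R) u x (v : 'rV[R]_n) (a b : R) :
  is_derive (u x) (1 : R) g a -> is_derive x v u b ->
  is_derive x v (fun y => g (u y)) (a * b).
Proof.
move=> dg /line_is_derive du; apply: is_derive_line.
apply: (@is_derive1_comp _ g (fun t => u (t *: v + x))) => //.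
by rewrite scale0r add0r.
Qed.

Lemma partialE i u x (l : R) :
  is_derive x (delta_mx ord0 i) u l -> partial i u x = l.
Proof. by case. Qed.

Lemma is_derive_Cn k u (du : 'I_n -> 'rV[R]_n -> R) : continuous u ->
  (forall i x, is_derive x (delta_mx ord0 i) u (du i x)) ->
  (forall i, Cn k (du i)) -> Cn k.+1 u.
Proof.
move=> cu dE Cdu; split => // i; split; first by move=> x; have [] := dE i x.
suff -> : partial i u = du i by [].
by apply/funext => x; exact: partialE.
Qed.

Lemma Cn_continuous k u : Cn k u -> continuous u.
Proof. by case: k => // k []. Qed.

Lemma CnS k u : Cn k.+1 u -> Cn k u.
Proof.
elim: k u => [u []//|k IH u [cu du]]; split => // i.
by have [? ?] := du i; split => //; exact: IH.
Qed.

Lemma Cn_is_derive k u i x : Cn k.+1 u ->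
  is_derive x (delta_mx ord0 i) u (partial i u x).
Proof. by case=> _ /(_ i)[/(_ x) /derivableP]. Qed.

Lemma Cn_partial k u i : Cn k.+1 u -> Cn k (partial i u).
Proof. by case=> _ /(_ i)[]. Qed.

Lemma Cn_cst k c : Cn k (fun _ : 'rV[R]_n => c).
Proof.
elim: k c => [|k IH] c; first exact: cst_continuous.
apply: (is_derive_Cn (du := fun _ _ => 0)) => //; first exact: cst_continuous.
Qed.

Lemma CnD k u v : Cn k u -> Cn k v -> Cn k (fun x => u x + v x).
Proof.
have cD u' v' : continuous u' -> continuous v' ->
    continuous (fun x : 'rV[R]_n => u' x + v' x).
  by move=> cu cv x; have := cvgD (cu x) (cv x); exact.
elim: k u v => [|k IH] u v Cu Cv; first exact: cD.
apply: (is_derive_Cn (du := fun i x => partial i u x + partial i v x)).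
- by apply: cD; [exact: Cn_continuous Cu|exact: Cn_continuous Cv].
- move=> i x; have ? := Cn_is_derive i x Cu; have ? := Cn_is_derive i x Cv.
  exact: is_deriveD.
- by move=> i; apply: IH; exact: Cn_partial.
Qed.

Lemma CnM k u v : Cn k u -> Cn k v -> Cn k (fun x => u x * v x).
Proof.
have cM u' v' : continuous u' -> continuous v' ->
    continuous (fun x : 'rV[R]_n => u' x * v' x).
  by move=> cu cv x; have := cvgM (cu x) (cv x); exact.
elim: k u v => [|k IH] u v Cu Cv; first exact: cM.
apply: (is_derive_Cn (du := fun i x => u x * partial i v x + v x * partial i u x)).
- by apply: cM; [exact: Cn_continuous Cu|exact: Cn_continuous Cv].
- move=> i x; have ? := Cn_is_derive i x Cu; have ? := Cn_is_derive i x Cv.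
  exact: is_deriveM.
- move=> i; apply: CnD; apply: IH; do ?[exact: CnS|exact: Cn_partial].
Qed.

Lemma Cn_comp k (g : R -> R) u : Ck k g -> Cn k u -> Cn k (fun x => g (u x)).
Proof.
elim: k g u => [|k IH] g u Cg Cu.
  by move=> x; apply: continuous_comp; [exact: Cu|exact: Cg].
apply: (is_derive_Cn (du := fun i x => (g^`())%classic (u x) * partial i u x)).
- move=> x; apply: continuous_comp; first by case: Cu => + _; exact.
  exact: (Ck_continuous Cg).
- move=> i x; have ? := Cn_is_derive i x Cu; have ? := Ck_is_derive (u x) Cg.
  exact: is_derive_comp_line.
- move=> i; apply: CnM; last exact: Cn_partial.
  by apply: IH; [case: Cg|exact: CnS].
Qed.

Lemma is_derive_coord (j : 'I_n) i x :
  is_derive x (delta_mx ord0 i) (fun y : 'rV[R]_n => y ord0 j) ((i == j)%:R : R).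
Proof.
apply: is_derive_line.
rewrite (_ : (fun _ => _) =
    (i == j)%:R \*: (id : R -> R) + cst (x ord0 j)); last first.
  by apply/funext => t; rewrite !mxE/= [RHS]/(_ * t + _) mulrC eq_sym.
by apply: is_derive_eq; rewrite addr0 [_%:A]mulr1.
Qed.

Lemma Cn_coord k (j : 'I_n) : Cn k (fun y : 'rV[R]_n => y ord0 j).
Proof.
case: k => [|k]; first exact: coord_continuous.
apply: (is_derive_Cn (du := fun i _ => (i == j)%:R)).
- exact: coord_continuous.
- by move=> i x; exact: is_derive_coord.
- by move=> i; exact: Cn_cst.
Qed.

Lemma is_derive_dot i x :
  is_derive x (delta_mx ord0 i) (fun y : 'rV[R]_n => dot y y) (2 * x ord0 i).
Proof.
rewrite (_ : (fun _ => _) = \sum_(j < n) (fun y : 'rV[R]_n => y ord0 j * y ord0 j)); last first.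
  by apply/funext => y; rewrite /dot fct_sumE.
apply: is_derive_eq.
  apply: is_derive_sum => j.
  by apply: is_deriveM; exact: is_derive_coord.
rewrite (bigD1 i)//= eqxx big1 => [|j ji]; first by rewrite addr0 [_%:A]mulr1 mulr2n mulrDl !mul1r.
by rewrite eq_sym (negbTE ji) scaler0 addr0.
Qed.

Lemma continuous_dot : continuous (fun y : 'rV[R]_n => dot y y).
Proof.
rewrite /dot; elim: (index_enum _) => [|j r IH].
  by under eq_fun do rewrite big_nil; exact: cst_continuous.
under eq_fun do rewrite big_cons.
move=> x; have cj := @coord_continuous R 1 n ord0 j x.
by have := cvgD (cvgM cj cj) (IH x); exact.
Qed.

Lemma Cn_dot k : Cn k (fun y : 'rV[R]_n => dot y y).
Proof.
case: k => [|k]; first exact: continuous_dot.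
apply: (is_derive_Cn (du := fun i x => 2 * x ord0 i)).
- exact: continuous_dot.
- exact: is_derive_dot.
- by move=> i; apply: CnM; [exact: Cn_cst|exact: Cn_coord].
Qed.

Lemma partial_radial (g : R -> R) (a : R) i x :
  is_derive (dot x x) (1 : R) g a ->
  is_derive x (delta_mx ord0 i) (fun y : 'rV[R]_n => g (dot y y)) (a * (2 * x ord0 i)).
Proof. by move=> dg; apply: is_derive_comp_line => //; exact: is_derive_dot. Qed.

End smooth_space.

(** * Integration by parts *)

Section integration_by_parts.
Context {R : realType}.

Lemma consrV0 n (z : measurableTypeR R * 'rV[R]_n) : consrV z ord0 ord0 = z.1.
Proof.
rewrite /consrV (_ : ord0 = lshift n (ord0 : 'I_1)); last exact/val_inj.
by rewrite (@row_mxEl _ 1 1 n) mxE.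
Qed.

Lemma consrVS n (z : measurableTypeR R * 'rV[R]_n) i :
  consrV z ord0 (lift ord0 i) = z.2 ord0 i.
Proof.
rewrite /consrV (_ : lift ord0 i = rshift 1 i); last exact/val_inj.
by rewrite (@row_mxEr _ 1 1 n).
Qed.

Lemma consrV_head n (a : R) (v : 'rV[R]_n) :
  consrV (a, v) = a *: delta_mx ord0 ord0 + consrV (0, v).
Proof.
apply/rowP => j; rewrite [RHS]mxE [X in _ = X + _]mxE [X in _ = _ * X + _]mxE.
case: (unliftP ord0 j) => [k ->|->].
  by rewrite [LHS]consrVS [X in _ + X]consrVS/= mulr0 add0r.
by rewrite [LHS]consrV0 [X in _ + X]consrV0/= mulr1 addr0.
Qed.

Lemma consrV_tail n (a h : R) (v w : 'rV[R]_n) i :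
  h *: delta_mx ord0 (lift ord0 i) + consrV (a, v) =
  consrV (a, h *: delta_mx ord0 i + v).
Proof.
apply/rowP => j; rewrite mxE; case: (unliftP ord0 j) => [k ->|->].
  rewrite [RHS]consrVS [X in _ + X]consrVS/= !mxE/=.
  by rewrite (inj_eq (@lift_inj _ ord0)).
by rewrite [RHS]consrV0 [X in _ + X]consrV0/= !mxE/= mulr0 add0r.
Qed.

Lemma continuous_consrV_tail n (a : R) :
  continuous (fun v : 'rV[R]_n => consrV (a, v)).
Proof.
move=> v; have FF := nbhs_filter v; apply/cvg_ballP => e e0; near=> w; split => // i j.
rewrite ord1; case: (unliftP ord0 j) => [k ->|->].
  rewrite !consrVS/=; move: (k); near: w.
  by apply: filterS (nbhsx_ballx v e e0) => w [_ + k]; exact.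
by rewrite !consrV0/=; exact: ballxx.
Unshelve. all: by end_near. Qed.

Lemma continuous_consrV_head n (v : 'rV[R]_n) :
  continuous (fun a : R => consrV (a, v)).
Proof.
move=> a; apply/cvg_ballP => e e0; near=> b; split => // i j.
rewrite ord1; case: (unliftP ord0 j) => [k ->|->].
  by rewrite !consrVS/=; exact: ballxx.
by rewrite !consrV0/=; near: b; exact: (nbhsx_ballx (a : R) e e0).
Unshelve. all: by end_near. Qed.

Lemma is_derive_line_at n (u : 'rV[R]_n -> R) (x v : 'rV[R]_n) (a l : R) :
  is_derive (a *: v + x) v u l -> is_derive a (1 : R) (fun t => u (t *: v + x)) l.
Proof.
have E : (fun h : R => h^-1 *: ((u \o shift (a *: v + x)) (h *: v) - u (a *: v + x))) =
  (fun h => h^-1 *: (((fun t => u (t *: v + x)) \o shift a) (h *: 1) - u (a *: v + x))).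
  by apply/funext => h /=; rewrite [_%:A]mulr1 scalerDl addrA.
move=> [d dE]; apply: DeriveDef; first by rewrite /derivable -E; exact: d.
by rewrite -dE /derive -E.
Qed.

Lemma partial_consrV n (u : 'rV[R]_n.+1 -> R) (a : R) (v : 'rV[R]_n) i l :
  is_derive (consrV (a, v)) (delta_mx ord0 (lift ord0 i)) u l ->
  is_derive v (delta_mx ord0 i) (fun w => u (consrV (a, w))) l.
Proof.
have E : (fun h : R => h^-1 *: ((u \o shift (consrV (a, v)))
      (h *: delta_mx ord0 (lift ord0 i)) - u (consrV (a, v)))) =
  (fun h => h^-1 *: (((fun w => u (consrV (a, w))) \o shift v)
      (h *: delta_mx ord0 i) - u (consrV (a, v)))).
  by apply/funext => h /=; rewrite consrV_tail.
move=> [d dE]; apply: DeriveDef; first by rewrite /derivable -E; exact: d.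
by rewrite -dE /derive -E.
Qed.

Lemma vanish_partial n (u : 'rV[R]_n -> R) (i : 'I_n) (M : R) :
  (forall (x : 'rV[R]_n) j, M < `|x ord0 j| -> u x = 0) ->
  forall (x : 'rV[R]_n) j, M < `|x ord0 j| -> partial i u x = 0.
Proof.
move=> u0 x j Mx; rewrite /partial -(@derive_cst _ _ _ 0 x (delta_mx ord0 i)).
apply: near_eq_derive; near=> y; apply: (u0 _ j); near: y.
have : open [set y : 'rV[R]_n | M < `|y ord0 j|].
  have := open_comp (f := fun y : 'rV[R]_n => `|y ord0 j|) (D := [set t | M < t]).
  apply; last exact: open_gt.
  move=> y _; apply: continuous_comp; first exact: coord_continuous.
  exact: norm_continuous.
by move=> oM; apply: open_nbhs_nbhs.
Unshelve. all: by end_near. Qed.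

Lemma cube_finite n (M : R) :
  measurable [set x : 'rV[R]_n | forall i, `|x ord0 i| <= M] /\
  (lebesgue_rV n [set x : 'rV[R]_n | forall i, (`|x ord0 i| <= M)%R] < +oo)%E.
Proof.
have mI : measurable (`[- M, M]%classic : set R) by exact: measurable_itv.
rewrite (_ : [set x | _] = [set x : 'rV[R]_n | forall i, `[- M, M]%classic (x ord0 i)]); last first.
  by apply/seteqP; split => x xM i; have := xM i; rewrite /= in_itv/= ler_norml.
split.
  rewrite (_ : [set x | _] = \bigcap_(i in [set: 'I_n])
      ((fun y : 'rV[R]_n => y ord0 i) @^-1` `[- M, M]%classic)).
    apply: fin_bigcap_measurable => // i _.
    by rewrite -[X in measurable X]setTI; exact: measurable_coord.
  by apply/seteqP; split => [y By i _|y By i]; exact: By.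
rewrite (@lebesgue_rV_box R n (fun=> `[- M, M]%classic))// big_const.
elim: #|_| => /= [|k IH]; first by rewrite ltry.
rewrite lte_mul_pinfty//.
- by rewrite /= lebesgue_measure_itv; case: ifPn => //= _; rewrite -EFinB.
Qed.

Lemma integrable_cube n (u : 'rV[R]_n -> R) (M C : R) :
  measurable_fun [set: _] u -> (forall x, `|u x| <= C) ->
  (forall (x : 'rV[R]_n) j, M < `|x ord0 j| -> u x = 0) ->
  (lebesgue_rV n).-integrable [set: _] (EFin \o u).
Proof.
move=> mu uC u0; have [mI Ifin] := cube_finite n M.
rewrite (_ : EFin \o u = (EFin \o u) \_ [set x : 'rV[R]_n | forall i, `|x ord0 i| <= M]).
  apply/(integrable_mkcond _ mI).
  apply: measurable_bounded_integrable => //; first exact: measurable_funTS.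
  exists C; split; rewrite ?num_real// => y Cy x _ /=.
  by rewrite (le_trans (uC x))// ltW.
apply/funext => x; rewrite patchE; case: ifPn => //=.
rewrite notin_setE/= => /existsNP[j /negP]; rewrite -ltNge => xj.
by rewrite (u0 _ _ xj).
Qed.

Lemma integral_derive_compact (g dg : R -> R) (M : R) :
  (forall x, is_derive x (1 : R) g (dg x)) -> continuous dg ->
  (forall x, M < `|x| -> g x = 0) -> (forall x, M < `|x| -> dg x = 0) ->
  (\int[lebesgue_measure]_(x in [set: measurableTypeR R]) (dg x)%:E = 0)%E.
Proof.
move=> gdg cdg g0 dg0.
(* Strictly larger than [M], so that [g] already vanishes at both endpoints of [[- L, L]]. *)
pose L := `|M| + 1.
have ML : M < L by rewrite /L (le_lt_trans (ler_norm _))// ltrDl.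
have L0 : 0 < L by rewrite /L ltr_pwDr.
have cg : continuous g by apply: derivable_continuous => x; have [] := gdg x.
rewrite (_ : (fun x => _) = (fun x => (dg x)%:E) \_ `[- L, L]).
  rewrite -integral_mkcond (@continuous_FTC2 _ _ g).
  - by rewrite !g0 ?subee// ?normrN ger0_norm// ltW.
  - lra.
  - exact: continuous_subspaceT.
  - split.
    + by move=> x _; have [] := gdg x.
    + by apply: cvg_at_right_filter; exact: cg.
    + by apply: cvg_at_left_filter; exact: cg.
  - by move=> x _; rewrite derive1E; have [_ ->] := gdg x.
apply/funext => x; rewrite patchE; case: ifPn => //.
rewrite notin_setE/= in_itv/= => /negP; rewrite -ler_norml -ltNge => Lx.
by rewrite dg0// (lt_trans ML).
Qed.

(** By Fubini, since the measure in dimension [n.+1] is the image of a product. If [i] is not the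
    first coordinate, the inner integral over the tail vanishes by induction; otherwise the inner
    integral over the head vanishes by the fundamental theorem of calculus. *)
Lemma integral_partial_eq0 n (i : 'I_n) (u du : 'rV[R]_n -> R) (M C : R) :
  (forall x, is_derive x (delta_mx ord0 i) u (du x)) ->
  continuous du -> (forall x, `|du x| <= C) ->
  (forall (x : 'rV[R]_n) j, M < `|x ord0 j| -> u x = 0) ->
  (\int[lebesgue_rV n]_x (du x)%:E = 0)%E.
Proof.
elim: n i u du => [[]//|n IH] i u du dE cdu duC u0.
have du0 (x : 'rV[R]_n.+1) j : M < `|x ord0 j| -> du x = 0.
  by move=> Mx; rewrite -(partialE (dE x)); exact: vanish_partial Mx.
have mdu := continuous_measurable_rV cdu.
have idu : (lebesgue_rV n.+1).-integrable [set: _] (EFin \o du).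
  exact: integrable_cube duC du0.
have /integrableP[mE _] := idu.
have mc := @measurable_consrV R n.
have idu' : ((lebesgue_measure \x lebesgue_rV n)%E).-integrable [set: _]
    ((EFin \o du) \o @consrV R n).
  apply/integrableP; split; first exact: (measurableT_comp mE mc).
  have /integrableP[_] := idu; apply: le_lt_trans.
  rewrite /= /lebesgue_step ge0_integral_pushforward//.
  exact: (measurableT_comp (@abse_measurable R setT) mE).
rewrite [LHS](_ : _ = \int[(lebesgue_measure \x lebesgue_rV n)%E]_z
    ((EFin \o du) \o @consrV R n) z)%E; last first.
  have := @integral_pushforward _ _ _ _ R _ mc (lebesgue_measure \x lebesgue_rV n)%E setT _ mE.
  by rewrite preimage_setT => /(_ idu' measurableT).
case: (unliftP ord0 i) => [j ij|i0].
  rewrite -integral12_prod_meas1//; rewrite integral0_eq// => a _.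
  rewrite /fubini_F.
  apply: (IH j (fun v => u (consrV (a, v)))).
  - by move=> v; apply: partial_consrV; rewrite -ij; exact: dE.
  - by move=> v; apply: continuous_comp; [exact: continuous_consrV_tail|exact: cdu].
  - by move=> v; exact: duC.
  - move=> v k Mv; apply: (u0 _ (lift ord0 k)).
    by rewrite consrVS.
rewrite -integral21_prod_meas1//; rewrite integral0_eq// => v _.
rewrite /fubini_G.
apply: (@integral_derive_compact (fun a => u (consrV (a, v))) _ M).
- move=> a; rewrite [X in is_derive _ _ X](_ : _ = fun t => u (t *: delta_mx ord0 ord0 + consrV (0, v))).
    apply: is_derive_line_at; rewrite -consrV_head -i0; exact: dE.
  by apply/funext => t; rewrite consrV_head.
- by move=> a; apply: continuous_comp; [exact: continuous_consrV_head|exact: cdu].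
- by move=> a Ma; apply: (u0 _ ord0); rewrite consrV0.
- by move=> a Ma; apply: (du0 _ ord0); rewrite consrV0.
Qed.

End integration_by_parts.

(** * The unit ball and its test functions *)

Section unit_ball_theory.
Context {R : realType} {n : nat}.
Implicit Types (x y z : 'rV[R]_n) (u v F phi : 'rV[R]_n -> R).
Local Notation mu := (@lebesgue_rV R n).
Local Notation B := (@unit_ball R n).

Lemma dot_ge0 x : 0 <= dot x x.
Proof. by apply: sumr_ge0 => i _; rewrite -expr2 sqr_ge0. Qed.

Lemma eucl_norm_sqr x : eucl_norm x ^+ 2 = dot x x.
Proof. by rewrite sqr_sqrtr// dot_ge0. Qed.

Lemma eucl_norm_ge0 x : 0 <= eucl_norm x.
Proof. exact: sqrtr_ge0. Qed.

Lemma coord_le_eucl_norm x i : `|x ord0 i| <= eucl_norm x.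
Proof.
rewrite -sqrtr_sqr ler_wsqrtr// /dot (bigD1 i)//= expr2 lerDl.
by apply: sumr_ge0 => j _; rewrite -expr2 sqr_ge0.
Qed.

Lemma unit_ballE x : B x <-> dot x x < 1.
Proof. by rewrite /unit_ball/= /eucl_norm -[X in _ < X]sqrtr1 ltr_sqrt. Qed.

Lemma dot_eq0 x : dot x x = 0 -> x = 0.
Proof.
move=> x0; apply/rowP => i; rewrite mxE; apply/eqP; rewrite -normr_le0.
by rewrite (le_trans (coord_le_eucl_norm x i))// /eucl_norm x0 sqrtr0.
Qed.

Lemma dotC x y : dot x y = dot y x.
Proof. by apply: eq_bigr => i _; rewrite mulrC. Qed.

Lemma dotDr x y z : dot x (y + z) = dot x y + dot x z.
Proof. by rewrite /dot -big_split; apply: eq_bigr => i _; rewrite mxE mulrDr. Qed.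

Lemma dotZr (c : R) x y : dot x (c *: y) = c * dot x y.
Proof. by rewrite /dot mulr_sumr; apply: eq_bigr => i _; rewrite mxE mulrCA. Qed.

Lemma dot_cauchy_schwarz (u v : 'rV[R]_n) : `|dot u v| <= eucl_norm u * eucl_norm v.
Proof.
rewrite -(@ler_pXn2r _ 2)// ?nnegrE ?mulr_ge0 ?eucl_norm_ge0//.
rewrite real_normK ?num_real// exprMn !eucl_norm_sqr.
have [v0|v0] := eqVneq (dot v v) 0.
  have -> : dot u v = 0 by rewrite (dot_eq0 v0) /dot big1// => i _; rewrite mxE mulr0.
  by rewrite expr0n v0 mulr0.
have vp : 0 < dot v v by rewrite lt_neqAle eq_sym v0 dot_ge0.
(* The minimiser of [|u + t v|^2]. *)
pose t := - (dot u v / dot v v).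
have := dot_ge0 (u + t *: v).
have -> : dot (u + t *: v) (u + t *: v) = dot u u - dot u v ^+ 2 / dot v v.
  rewrite dotDr dotZr dotC (dotC (u + t *: v) v) !dotDr !dotZr (dotC v u) /t.
  by field.
by rewrite subr_ge0 ler_pdivrMr.
Qed.

Lemma continuous_eucl_norm : continuous (@eucl_norm R n).
Proof.
move=> x; apply: continuous_comp; first exact: continuous_dot.
exact: sqrt_continuous.
Qed.

Lemma unit_ball_cube x i : B x -> `|x ord0 i| <= 1.
Proof. by move=> /ltW; apply: le_trans; exact: coord_le_eucl_norm. Qed.

Lemma measurable_unit_ball : measurable B.
Proof.
rewrite (_ : unit_ball = @eucl_norm R n @^-1` `]-oo, 1[); last first.
  by apply/seteqP; split => x; rewrite /unit_ball/= in_itv.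
rewrite -[X in measurable X]setTI.
exact: (continuous_measurable_rV continuous_eucl_norm).
Qed.

Lemma unit_ball_finite : (mu B < +oo)%E.
Proof.
have [mc] := @cube_finite R n 1; apply: le_lt_trans.
apply: le_measure; rewrite ?inE//; first exact: measurable_unit_ball.
by move=> x Bx i; exact: unit_ball_cube.
Qed.

Lemma compact_cube (M : R) : compact [set x : 'rV[R]_n | forall i, `|x ord0 i| <= M].
Proof.
have := @rV_compact _ n (fun=> `[- M, M]%classic : set R).
rewrite (_ : [set v : 'rV[R]_n | _] = [set x : 'rV[R]_n | forall i, `|x ord0 i| <= M]).
  by apply => i; exact: segment_compact.
by apply/seteqP; split => x xM i; have := xM i; rewrite /= in_itv/= ler_norml.
Qed.

Lemma continuous_cube_bounded (M : R) F : continuous F ->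
  exists C, 0 <= C /\ forall x, (forall i, `|x ord0 i| <= M) -> `|F x| <= C.
Proof.
move=> cF; have cc := @compact_cube M.
have /compact_bounded[C [_ /(_ (`|C| + 1)) CF]] :=
  continuous_compact (continuous_subspaceT cF) cc.
exists (`|C| + 1); split; first by rewrite addr_ge0.
move=> x xM; apply: CF; first by rewrite (le_lt_trans (ler_norm _))// ltrDl.
by exists x.
Qed.

Lemma continuous_ball_bounded F : continuous F ->
  exists C, 0 <= C /\ forall x, B x -> `|F x| <= C.
Proof.
move=> /(continuous_cube_bounded 1)[C [C0 CF]]; exists C; split => // x Bx.
by apply: CF => i; exact: unit_ball_cube.
Qed.

Lemma bounded_ball_integrable (C : R) F : measurable_fun B F ->
  (forall x, B x -> `|F x| <= C) -> mu.-integrable B (EFin \o F).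
Proof.
move=> mF FC; apply: measurable_bounded_integrable => //.
- exact: measurable_unit_ball.
- exact: unit_ball_finite.
exists C; split; rewrite ?num_real// => y Cy x Bx /=.
by rewrite (le_trans (FC x Bx))// ltW.
Qed.

Lemma continuous_ball_integrable F : continuous F ->
  mu.-integrable B (EFin \o F).
Proof.
move=> cF; have [C [_ CF]] := continuous_ball_bounded cF.
apply: bounded_ball_integrable CF.
by apply: measurable_funTS; exact: continuous_measurable_rV.
Qed.

Lemma test_function_Cn phi k : test_function phi -> Cn k phi.
Proof. by case. Qed.

Lemma test_function_continuous phi : test_function phi -> continuous phi.
Proof. by move=> /(@test_function_Cn _ 0) /Cn_continuous; exact. Qed.

Lemma test_function_partial_continuous phi i : test_function phi ->
  continuous (partial i phi).
Proof. by move=> /(@test_function_Cn _ 1) /(@Cn_partial _ _ _ _ i) /Cn_continuous; exact. Qed.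

Lemma test_function_is_derive phi i x : test_function phi ->
  is_derive x (delta_mx ord0 i) phi (partial i phi x).
Proof. by move=> /(@test_function_Cn _ 1) /Cn_is_derive; exact. Qed.

Lemma test_function_supp phi x : test_function phi -> ~ B x -> phi x = 0.
Proof.
move=> [_ _ sB] Bx; apply: contrapT => /eqP px; apply: Bx; apply: sB.
exact: subset_closure.
Qed.

Lemma test_function_partial_supp phi i x : test_function phi -> ~ B x ->
  partial i phi x = 0.
Proof.
move=> [_ _ sB] Bx; rewrite /partial -(@derive_cst _ _ _ 0 x (delta_mx ord0 i)).
apply: near_eq_derive.
have : nbhs x (~` closure [set y | phi y != 0]).
  apply: open_nbhs_nbhs; split; first exact/closed_openC/closed_closure.
  by move=> /sB.
apply: filterS => y py; apply: contrapT => /eqP py0; apply: py.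
exact: subset_closure.
Qed.

Lemma out_cube_out_ball x i : 1 < `|x ord0 i| -> ~ B x.
Proof. by move=> + /(@unit_ball_cube _ i); rewrite ltNge => /negP. Qed.

(** The product [v * phi] vanishes outside the ball, so the whole-space identity applies to it and
    there is no boundary term. The statement concerns one component with a continuous derivative,
    because the flux fields to which it is applied are not smooth. *)
Lemma Rintegral_by_parts v dv phi (i : 'I_n) : continuous v -> continuous dv ->
  (forall x, is_derive x (delta_mx ord0 i) v (dv x)) -> test_function phi ->
  \int[mu]_(x in B) (v x * partial i phi x)
    = - \int[mu]_(x in B) (dv x * phi x).
Proof.
move=> cv cdv vdv tphi.
have cphi := test_function_continuous tphi.
have cdphi := test_function_partial_continuous (i := i) tphi.
pose dw x := v x * partial i phi x + phi x * dv x.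
have cM F G : continuous F -> continuous G ->
    continuous (fun x : 'rV[R]_n => F x * G x).
  by move=> cF cG x; have := cvgM (cF x) (cG x); exact.
have cdw : continuous dw.
  by move=> x; have := cvgD (cM _ _ cv cdphi x) (cM _ _ cphi cdv x); exact.
have dw0 x : ~ B x -> dw x = 0.
  move=> Bx; rewrite /dw (test_function_partial_supp i tphi)// (test_function_supp tphi)//.
  by rewrite mulr0 mul0r addr0.
have [C [C0 CF]] := continuous_ball_bounded cdw.
have : (\int[mu]_x (dw x)%:E = 0)%E.
  apply: (@integral_partial_eq0 _ n i (fun x => v x * phi x) dw 1 C) => //.
  - move=> x; have ? := vdv x; have ? := test_function_is_derive i x tphi.
    exact: is_deriveM.
  - by move=> x; have [/CF//|/dw0 ->] := pselect (B x); rewrite normr0.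
  - move=> x j xj; rewrite (test_function_supp tphi) ?mulr0//.
    exact: out_cube_out_ball xj.
rewrite (_ : (fun x => _) = (fun x => (dw x)%:E) \_ B); last first.
  apply/funext => x; rewrite patchE; case: ifPn => //.
  by rewrite notin_setE => /dw0 ->.
rewrite -integral_mkcond => dwE.
apply/eqP; rewrite -subr_eq0 opprK.
have -> : \int[mu]_(x in B) (dv x * phi x) = \int[mu]_(x in B) (phi x * dv x).
  by apply: eq_Rintegral => x _; rewrite mulrC.
rewrite -RintegralD//; last 3 first.
- exact: measurable_unit_ball.
- exact/continuous_ball_integrable/cM.
- exact/continuous_ball_integrable/cM.
by rewrite /Rintegral dwE.
Qed.

End unit_ball_theory.

(** * Smooth steps and approximation on the line *)

Section smooth_step.
Context {R : realType}.
Implicit Types (x : R) (k m : nat).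

Lemma is_derive_quadratic (g : R -> R) (C : R) :
  (forall h, `|g h| <= C * h ^+ 2) -> is_derive (0 : R) (1 : R) g 0.
Proof.
move=> gC.
have g0 : g 0 = 0.
  by apply/eqP; rewrite -normr_le0 (le_trans (gC 0))// expr2 mul0r mulr0.
have C0 : 0 <= C by have := gC 1; rewrite expr1n mulr1; apply: le_trans.
have cv : (fun h : R => h^-1 *: ((g \o shift 0) (h *: 1) - g 0)) @ 0^' --> (0 : R).
  apply/cvgrPdist_le => /= e e0; near=> h.
  rewrite sub0r normrN [_%:A]mulr1 addr0 g0 subr0.
  have h0 : h != 0 by near: h; exact: nbhs_dnbhs_neq.
  rewrite [_ *: _](_ : _ = h^-1 * g h)// normrM normfV mulrC ler_pdivrMr ?normr_gt0//.
  rewrite (le_trans (gC h))// -normr_id -real_normK ?num_real// expr2 normr_id mulrA.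
  rewrite ler_wpM2r//.
  have : `|h| <= e / (C + 1).
    by near: h; apply: dnbhs0_le; rewrite divr_gt0// ltr_wpDl.
  rewrite ler_pdivlMr ?ltr_wpDl//; apply: le_trans.
  by rewrite mulrC ler_wpM2l// lerDl.
by apply: DeriveDef; [apply/cvg_ex; exists 0|exact: cvg_lim].
Unshelve. all: by end_near. Qed.

(** The flat function [exp(-1/x)] with an extra factor [x^(-m)]. Derivatives of members of this
    family are linear combinations of members, which gives smoothness by induction. *)
Definition expinv m x : R := if 0 < x then x^-1 ^+ m * expR (- x^-1) else 0.

Lemma expinv_ge0 m x : 0 <= expinv m x.
Proof.
rewrite /expinv; case: ifPn => // x0.
by rewrite mulr_ge0 ?expR_ge0// exprn_ge0// invr_ge0 ltW.
Qed.

(** Keep only the term of degree [m + 2] of the exponential series at [1/x]. The two extra powers of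
    [x] make the derivative at 0 vanish, by [is_derive_quadratic]. *)
Lemma expinv_le m x : 0 < x -> expinv m x <= m.+2`!%:R * x ^+ 2.
Proof.
move=> x0; rewrite /expinv x0 expRN ler_pdivrMr ?expR_gt0//.
have f0 : 0 < m.+2`!%:R :> R by rewrite ltr0n fact_gt0.
have ex : x^-1 ^+ m.+2 <= m.+2`!%:R * expR x^-1.
  have := @expR_ge1Dxn _ x^-1 m.+1; rewrite invr_ge0 (ltW x0) => /(_ isT) h.
  by rewrite mulrC -ler_pdivrMr//; apply: le_trans h; rewrite lerDr.
have -> : x^-1 ^+ m = x^-1 ^+ m.+2 * x ^+ 2.
  rewrite -addn2 exprD -mulrA -exprMn mulVf ?gt_eqF// expr1n mulr1//.
by rewrite [leRHS]mulrAC ler_wpM2r// sqr_ge0.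
Qed.

Lemma expinv_le0 m x : x <= 0 -> expinv m x = 0.
Proof. by rewrite /expinv leNgt => /negbTE ->. Qed.

Lemma is_derive_expinv m x :
  is_derive x (1 : R) (expinv m) (expinv m.+2 x - m%:R * expinv m.+1 x).
Proof.
have [x0|x0|->] := ltgtP x 0.
- rewrite !expinv_le0 ?ltW// mulr0 subr0.
  apply: (near_eq_is_derive (f := cst 0)).
  near=> y; rewrite expinv_le0//; near: y; exact: lt_le_nbhsl.
- apply: (near_eq_is_derive (f := fun y : R => (y^-1 ^+ m * expR (- y^-1) : R))).
    near=> y; rewrite /expinv ifT//; near: y; exact: open_nbhs_nbhs (conj (@open_gt R 0) x0).
  have x0' : x != 0 by rewrite gt_eqF.
  have dV : is_derive x (1 : R) (fun y => y^-1) (- x ^- 2).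
    apply: DeriveDef; first by apply: derivableV => //; exact: derivable_id.
    by rewrite (@deriveV _ _ id)// derive_id [_%:A]mulr1.
  have dg : is_derive x^-1 (1 : R) (fun y : R => y ^+ m * expR (- y))
      (m%:R * x^-1 ^+ m.-1 * expR (- x^-1) - x^-1 ^+ m * expR (- x^-1)).
    have d1 := is_derive_pow m x^-1.
    have d2 : is_derive x^-1 (1 : R) (fun y : R => expR (- y)) (- expR (- x^-1)).
      have dN : is_derive x^-1 (1 : R) (-%R : R -> R) (-1) by exact: is_deriveNid.
      have := is_derive1_comp (is_derive_expR (- x^-1)) dN.
      by rewrite mulrN1; exact.
    apply: (is_derive_eq (is_deriveM d1 d2)).
    rewrite -[X in X + _]/(x^-1 ^+ m * - expR (- x^-1)).
    rewrite -[X in _ + X]/(expR (- x^-1) * (m%:R * x^-1 ^+ m.-1)).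
    by ring.
  apply: (is_derive_eq (is_derive1_comp dg dV)).
  rewrite /expinv x0 -[x ^- 2]exprVn; case: (m) => [|j] /=; first by ring.
  by rewrite !exprS; ring.
- rewrite !expinv_le0// mulr0 subr0.
  apply: (is_derive_quadratic (C := m.+2`!%:R)) => h.
  have [h0|h0] := leP h 0; first by rewrite expinv_le0// normr0 mulr_ge0// sqr_ge0.
  by rewrite ger0_norm ?expinv_ge0// expinv_le.
Unshelve. all: by end_near. Qed.

Lemma Ck_expinv k m : Ck k (expinv m).
Proof.
elim: k m => [|k IH] m.
  by apply: derivable_continuous => x; have [] := is_derive_expinv m x.
apply: (is_derive_Ck (is_derive_expinv m)).
under eq_fun do rewrite -mulNr.
by apply: CkD => //; exact: CkZ.
Qed.

Lemma expinv0_nondecreasing : {homo expinv 0 : x y / x <= y}.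
Proof.
move=> x y xy; rewrite /expinv; case: ifPn => x0; last by case: ifPn; rewrite ?mul1r ?expR_ge0.
rewrite (lt_le_trans x0 xy) !expr0 !mul1r ler_expR lerN2 lef_pV2 ?posrE//.
exact: lt_le_trans xy.
Qed.

Lemma expinv0_gt0 x : 0 < x -> 0 < expinv 0 x.
Proof. by move=> x0; rewrite /expinv x0 expr0 mul1r expR_gt0. Qed.

Definition step x : R := expinv 0 x / (expinv 0 x + expinv 0 (1 - x)).

Lemma step_den_gt0 x : 0 < expinv 0 x + expinv 0 (1 - x).
Proof.
have [x0|x0] := ltP 0 x; first by rewrite ltr_pwDl ?expinv0_gt0 ?expinv_ge0.
by rewrite ltr_wpDl ?expinv_ge0// expinv0_gt0// subr_gt0 (le_lt_trans x0).
Qed.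

Lemma Ck_step k : Ck k step.
Proof.
rewrite (_ : step = fun x => expinv 0 x * (expinv 0 x + expinv 0 (1 - x)) `^ (-1)).
  apply: CkM; first exact: Ck_expinv.
  apply: Ck_powR => [x|]; first exact: step_den_gt0.
  apply: CkD; first exact: Ck_expinv.
  apply: (@Ck_comp _ _ (expinv 0) (fun x => 1 - x)); first exact: Ck_expinv.
  by apply: CkD; [exact: Ck_cst|apply: CkN; exact: Ck_id].
by apply/funext => x; rewrite powR_inv1// ltW// step_den_gt0.
Qed.

Lemma step0 x : x <= 0 -> step x = 0.
Proof. by move=> x0; rewrite /step expinv_le0// mul0r. Qed.

Lemma step1 x : 1 <= x -> step x = 1.
Proof.
move=> x1; rewrite /step [expinv 0 (1 - x)]expinv_le0 ?subr_le0// addr0 divff//.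
by rewrite gt_eqF// expinv0_gt0// (lt_le_trans ltr01).
Qed.

Lemma step_itv x : 0 <= step x <= 1.
Proof.
rewrite /step divr_ge0 ?expinv_ge0 ?(ltW (step_den_gt0 _))//=.
by rewrite ler_pdivrMr ?step_den_gt0// mul1r lerDl expinv_ge0.
Qed.

Lemma step_nondecreasing : {homo step : x y / x <= y}.
Proof.
move=> x y xy; rewrite /step ler_pdivrMr ?step_den_gt0// mulrAC.
rewrite ler_pdivlMr ?step_den_gt0// !mulrDr lerD//; first by rewrite mulrC.
apply: ler_pM; rewrite ?expinv_ge0//; first exact: expinv0_nondecreasing.
by apply: expinv0_nondecreasing; rewrite lerB.
Qed.

End smooth_step.

Section approximation_line.
Context {R : realType}.
Local Notation lam := (@lebesgue_measure R).
Implicit Types (g q : R -> R).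

Lemma continuous_segment_integrable g (a b : R) : continuous g ->
  lam.-integrable `[a, b] (EFin \o g).
Proof.
move=> cg; apply: continuous_compact_integrable; first exact: segment_compact.
exact: continuous_subspaceT.
Qed.

Lemma primitive_exists g : continuous g ->
  exists G : R -> R, forall x, is_derive x (1 : R) G (g x).
Proof.
move=> cg.
pose F (L x : R) := \int[lam]_(t in `[- L, x]) g t.
have FB (L M x y : R) : L <= M -> - L <= x -> - L <= y -> F M x - F L x = F M y - F L y.
  move=> LM.
  suff Fc z : - L <= z -> F M z - F L z = \int[lam]_(t in `[- M, - L]) g t.
    by move=> Lx Ly; rewrite !Fc.
  move=> Lz.
  have := @Rintegral_itvB R g (BLeft (- M)) (BRight z) (- L).
  rewrite !bnd_simp => /(_ (continuous_segment_integrable _ _ cg)).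
  rewrite lerN2 => /(_ LM Lz).
  rewrite Rintegral_itv_obnd_cbnd.
    by rewrite /F => <-; rewrite opprB addrCA subrr addr0.
  apply: integrableS (continuous_segment_integrable (- L) z cg) => //.
  by apply: subset_itvr; rewrite bnd_simp.
(* The base point [- L] has to move with [x]; subtracting the value at 0 makes the result
   independent of [L], which is [GE]. *)
pose G x := F (`|x| + 1) x - F (`|x| + 1) 0.
have GE (L x : R) : `|x| <= L -> G x = F L x - F L 0.
  move=> xL; rewrite /G; set M := `|x| + 1.
  have xM : `|x| <= M by rewrite /M lerDl.
  have L0 : 0 <= L by exact: le_trans xL.
  have M0 : 0 <= M by exact: le_trans xM.
  have Lx : - L <= x by move: xL; rewrite ler_norml => /andP[].
  have Mx : - M <= x by move: xM; rewrite ler_norml => /andP[].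
  have [LM|/ltW ML] := leP L M.
    have := FB L M x 0 LM Lx; rewrite oppr_le0 => /(_ L0); lra.
  have := FB M L x 0 ML Mx; rewrite oppr_le0 => /(_ M0); lra.
exists G => x; pose L := `|x| + 1.
have xL : `|x| < L by rewrite /L ltrDl.
apply: (near_eq_is_derive (f := fun y : R => (F L y - F L 0 : R))).
  near=> y; rewrite (GE L)//; apply: ltW; near: y.
  apply: (@open_nbhs_nbhs _ _ [set y : R | `|y| < L]); split => //.
  have := open_comp (f := fun y : R => `|y|) (D := [set t | t < L]).
  by apply; [move=> y _; exact: norm_continuous|exact: open_lt].
have [dF FE] := @continuous_FTC1_closed R g (- L) x L
  (le_lt_trans (ler_norm _) xL)
  (continuous_segment_integrable _ _ cg)
  (ltac:(by rewrite ltrNl -normrN in xL *; exact: le_lt_trans (ler_norm _) xL))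
  (cg x).
have dF' : is_derive x (1 : R) (F L) (g x).
  by apply: DeriveDef; [exact: dF|rewrite -derive1E FE].
by apply: (is_derive_eq (is_deriveB dF' (is_derive_cst (F L 0) x 1))); rewrite subr0.
Unshelve. all: by end_near. Qed.

(* The last two nodes are set to 0, which makes [stepsum] vanish near 1. *)
Definition node q (k j : nat) : R := if (j.+1 < k)%N then q (j%:R / k%:R) else 0.

(** A smooth analogue of piecewise linear interpolation at the nodes [i / k]: on each cell a single
    step is active and the earlier increments telescope. Primitives of such sums will be the
    profiles of test functions that approximate a radial C^1 function. *)
Definition stepsum q (k : nat) (s : R) : R :=
  node q k 0 + \sum_(0 <= i < k)
    (node q k i.+1 - node q k i) * step (k%:R * s - i%:R).

Lemma Ck_stepsum m q k : Ck m (stepsum q k).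
Proof.
apply: CkD; first exact: Ck_cst.
apply: Ck_sum => i; apply: CkZ.
apply: (@Ck_comp _ _ (@step R) (fun s => k%:R * s - i%:R)); first exact: Ck_step.
apply: CkD; last exact: Ck_cst.
by apply: CkZ; exact: Ck_id.
Qed.

Lemma stepsum_itv q k j (s : R) : (j < k)%N -> j%:R <= k%:R * s <= j.+1%:R ->
  stepsum q k s =
  node q k j + (node q k j.+1 - node q k j) * step (k%:R * s - j%:R).
Proof.
move=> jk /andP[js sj]; rewrite /stepsum (big_cat_nat (n := j)) ?(ltnW jk)//=.
rewrite [X in _ + (X + _)](_ : _ = \sum_(0 <= i < j) (node q k i.+1 - node q k i)).
  rewrite telescope_sumr// [X in _ + (_ + X)]big_ltn// [X in _ + (_ + (_ + X))]big1_seq.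
    by rewrite addr0 addrA [_ + (_ - _)]addrCA subrr addr0.
  move=> i; rewrite mem_index_iota => /andP[_ /andP[ji _]].
  by rewrite step0 ?mulr0// subr_le0 (le_trans sj)// ler_nat.
apply: eq_big_nat => i /andP[_ ij].
rewrite step1 ?mulr1// lerBrDr; apply: le_trans js.
by rewrite addrC natr1 ler_nat.
Qed.

Lemma stepsum_right q k (s : R) : (0 < k)%N -> k.-1%:R <= k%:R * s ->
  stepsum q k s = 0.
Proof.
case: k => // k _ /= ks.
have nk : node q k.+1 k = 0 by rewrite /node ltnn.
have nk1 : node q k.+1 k.+1 = 0 by rewrite /node ltnNge leqnSn.
have [sk|sk] := leP (k.+1%:R * s) k.+1%:R.
  by rewrite (@stepsum_itv _ _ k)// ?ks// nk nk1 subrr mul0r addr0.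
rewrite /stepsum [X in _ + X](_ : _ = \sum_(0 <= i < k.+1) (node q k.+1 i.+1 - node q k.+1 i)).
  by rewrite telescope_sumr// nk1 sub0r subrr.
apply: eq_big_nat => i /andP[_ ik].
by rewrite step1 ?mulr1// lerBrDr (le_trans _ (ltW sk))// addrC natr1 ler_nat.
Qed.

Lemma convex_le (a b t c e : R) : 0 <= t <= 1 -> `|c - a| <= e -> `|c - b| <= e ->
  `|c - (a + (b - a) * t)| <= e.
Proof.
move=> /andP[t0 t1] ca cb.
have -> : c - (a + (b - a) * t) = (1 - t) * (c - a) + t * (c - b) by ring.
rewrite (le_trans (ler_normD _ _))// !normrM (ger0_norm t0) ger0_norm ?subr_ge0//.
have -> : e = (1 - t) * e + t * e by ring.
by rewrite lerD// ler_wpM2l// subr_ge0.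
Qed.

Lemma truncn_itv_ex (s : R) (k : nat) : 0 <= s < 1 -> (0 < k)%N ->
  exists j, (j < k)%N /\ j%:R <= k%:R * s < j.+1%:R.
Proof.
move=> /andP[s0 s1] k0.
have ks : 0 <= k%:R * s by rewrite mulr_ge0.
exists (Num.truncn (k%:R * s)); have jks := truncn_itv ks; split => //.
rewrite -(ltr_nat R); move/andP: jks => [jks _]; rewrite (le_lt_trans jks)//.
by rewrite gtr_pMr// ltr0n.
Qed.

Lemma stepsum_bounded q (C : R) k (s : R) :
  (forall t, 0 <= t <= 1 -> `|q t| <= C) -> (0 < k)%N -> 0 <= s <= 1 ->
  `|stepsum q k s| <= C.
Proof.
move=> qC k0 /andP[s0 s1].
have C0 : 0 <= C by apply: le_trans (qC 0 _); rewrite ?lexx ?ler01.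
have nC j : `|node q k j| <= C.
  rewrite /node; case: ifPn => jk; last by rewrite normr0.
  apply: qC; rewrite divr_ge0//= ler_pdivrMr ?ltr0n// mul1r ler_nat.
  by rewrite ltnW// ltnW.
have [s1'|s1'] := ltP s 1; last first.
  rewrite stepsum_right ?normr0// (le_trans _ (_ : k%:R <= _))//.
    by rewrite ler_nat leq_pred.
  by rewrite ler_peMr.
have s01 : 0 <= s < 1 by rewrite s0.
have [j [jk /andP[js sj]]] := truncn_itv_ex s01 k0.
rewrite (stepsum_itv _ jk) ?js ?(ltW sj)// -normrN -sub0r.
by apply: convex_le; rewrite ?step_itv// sub0r normrN.
Qed.

Lemma stepsum_cvg q (s : R) : continuous q -> 0 <= s < 1 ->
  stepsum q k.+1 s @[k --> \oo] --> q s.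
Proof.
move=> cq s01; apply/cvgrPdist_le => e e0.
have /cvgrPdist_le/(_ e e0)/nbhs_ballP[d /= d0 dP] := cq s.
(* The bound [2/(k+1) < d] puts both nodes of the cell of [s] within [d] of [s]; the bound
   [2/(k+1) < 1 - s] keeps them away from the last two nodes, where the value of [q] is replaced by
   0. *)
have m0 : 0 < Num.min d (1 - s) / 2.
  by rewrite divr_gt0// lt_min d0 subr_gt0; case/andP: s01.
apply: filterS (near_infty_natSinv_lt (PosNum m0)) => k /= kd.
have [j [jk /andP[js sj]]] := truncn_itv_ex s01 (ltn0Sn k).
rewrite (stepsum_itv _ jk) ?js ?(ltW sj)//.
have K0 : 0 < k.+1%:R :> R by rewrite ltr0n.
have [kd1 ks1] : 2 / k.+1%:R < d /\ 2 / k.+1%:R < 1 - s.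
  move: kd; rewrite ltr_pdivlMr// mulrC => kd; split; apply: lt_le_trans kd _.
    by rewrite ge_min lexx.
  by rewrite ge_min lexx orbT.
have jk2 : (j.+2 < k.+1)%N.
  rewrite -(ltr_nat R) -natr1 -natr1 -addrA.
  move: ks1; rewrite ltr_pdivrMr//; move: js; set K := k.+1%:R; lra.
rewrite /node jk2 (ltnW jk2).
apply: convex_le; first exact: step_itv.
- apply: dP; rewrite /ball/= (le_lt_trans _ kd1)// ler_pdivlMr//.
  rewrite -[X in _ * X]ger0_norm ?(ltW K0)// -normrM mulrBl divfK ?gt_eqF//.
  rewrite ler_norml; move: js sj; rewrite -[j.+1%:R]natr1; set K := k.+1%:R; lra.
- apply: dP; rewrite /ball/= (le_lt_trans _ kd1)// ler_pdivlMr//.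
  rewrite -[X in _ * X]ger0_norm ?(ltW K0)// -normrM mulrBl divfK ?gt_eqF//.
  rewrite ler_norml; move: js sj; rewrite -[j.+1%:R]natr1; set K := k.+1%:R; lra.
Qed.

End approximation_line.

(** * Sobolev functions and integrals on the ball *)

Section ball_norm_theory.
Context {R : realType} {n : nat}.
Implicit Types (F phi : 'rV[R]_n -> R).
Local Notation mu := (@lebesgue_rV R n).
Local Notation B := (@unit_ball R n).

Lemma test_function_closed phi (K : set 'rV[R]_n) : (forall k, Cn k phi) ->
  closed K -> K `<=` B -> (forall x, phi x != 0 -> K x) -> test_function phi.
Proof.
move=> Cphi cK KB phiK.
have sK : closure [set x | phi x != 0] `<=` K.
  rewrite [X in _ `<=` X](closure_id K).1//; exact: closure_subset.
split => //; last exact: subset_trans KB.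
apply: subclosed_compact (@compact_cube R n 1) _; first exact: closed_closure.
by move=> x /sK/KB Bx i; exact: unit_ball_cube.
Qed.

Lemma closed_dot_le (c : R) : closed [set x : 'rV[R]_n | dot x x <= c].
Proof.
have := closed_comp (f := fun x : 'rV[R]_n => dot x x) (D := [set t | t <= c]).
by apply; [move=> x _; exact: continuous_dot|exact: closed_le].
Qed.

Lemma test_function_radial (psi : R -> R) (d : R) : (forall k, Ck k psi) ->
  0 < d -> (forall s, 1 - d <= s -> psi s = 0) ->
  test_function (fun x : 'rV[R]_n => psi (dot x x)).
Proof.
move=> Cpsi d0 psi0.
apply: (test_function_closed (K := [set x | dot x x <= 1 - d])).
- by move=> k; apply: Cn_comp => //; exact: Cn_dot.
- exact: closed_dot_le.
- by move=> x /= xd; apply/unit_ballE; rewrite (le_lt_trans xd)// gtrBl.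
- move=> x /=; apply: contraNT; rewrite -ltNge => /ltW/psi0 ->; exact: eqxx.
Qed.

Lemma measurable_normr_powR (p : R) (D : set 'rV[R]_n) F :
  measurable_fun D F -> measurable_fun D (fun x => `|F x| `^ p).
Proof.
move=> mF; apply: (measurableT_comp (measurable_powR p)).
exact: (measurableT_comp (@normr_measurable R setT) mF).
Qed.

Lemma ball_normE (p : R) F : p != 0 ->
  ball_norm p%:E F = ((\int[mu]_(x in B) (`|F x| `^ p)%:E) `^ p^-1)%E.
Proof.
move=> p0; rewrite /ball_norm unlock; congr (_ `^ _)%E.
rewrite [RHS]integral_mkcond; apply: eq_integral => x _.
rewrite /= !patchE; case: ifPn => // _.
by rewrite normr0 powR0.
Qed.

Lemma Lball_bounded (p C : R) F : 1 <= p -> measurable_fun B F ->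
  (forall x, B x -> `|F x| <= C) -> Lball p%:E F.
Proof.
move=> p1 mF FC; split => //.
rewrite ball_normE ?gt_eqF ?(lt_le_trans ltr01)//; apply: poweR_lty.
have iF : mu.-integrable B (EFin \o (fun x => `|F x| `^ p)).
  apply: (bounded_ball_integrable (C := C `^ p)).
    exact: measurable_normr_powR.
  move=> x Bx; rewrite ger0_norm ?powR_ge0//.
  apply: ge0_ler_powR; rewrite ?nnegrE//; first exact: le_trans p1.
    by apply: le_trans (FC x Bx).
  exact: FC.
have := integrable_fin_num measurable_unit_ball iF.
by rewrite ge0_fin_numE// integral_ge0// => x _; rewrite lee_fin powR_ge0.
Qed.

Lemma poweR_cvg0 (p : R) (u : nat -> \bar R) : 0 < p ->
  (forall k, 0 <= u k)%E -> u k @[k --> \oo] --> 0%E ->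
  ((u k) `^ p)%E @[k --> \oo] --> 0%E.
Proof.
move=> p0 u0 /fine_cvgP[ufin /cvgrPdist_lt ucv].
apply/fine_cvgP; split; first by apply: filterS ufin => k; exact: fin_num_poweR.
apply/cvgrPdist_lt => /= e e0.
have ep : 0 < e `^ p^-1 by exact: powR_gt0.
have := ucv _ ep; apply: filterS => k /=.
rewrite !sub0r !normrN fine_poweR ger0_norm ?fine_ge0// => uk.
rewrite ger0_norm ?powR_ge0//.
have -> : e = (e `^ p^-1) `^ p by rewrite -powRrM mulVf ?gt_eqF// powRr1// ltW.
by apply: gt0_ltr_powR; rewrite ?nnegrE// ?fine_ge0// ltW.
Qed.

Lemma ball_norm_cvg0 (p C : R) (F : nat -> 'rV[R]_n -> R) : 1 <= p ->
  (forall k, measurable_fun B (F k)) ->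
  (forall k x, B x -> `|F k x| <= C) ->
  (forall x, B x -> F k x @[k --> \oo] --> (0 : R)) ->
  ball_norm p%:E (F k) @[k --> \oo] --> 0%E.
Proof.
move=> p1 mF FC F0.
have p0 : 0 < p by exact: lt_le_trans p1.
under eq_fun do rewrite ball_normE ?gt_eqF//.
apply: poweR_cvg0; first by rewrite invr_gt0.
  by move=> k; apply: integral_ge0 => x _; rewrite lee_fin powR_ge0.
have mB := @measurable_unit_ball R n.
have [] := @dominated_convergence _ _ _ mu B mB
  (fun k x => (`|F k x| `^ p)%:E) (cst 0%E) (cst (C `^ p)%:E).
- move=> k; apply/measurable_EFinP.
  exact: measurable_normr_powR.
- exact: measurable_cst.
- apply: aeW => x Bx; apply: cvg_EFin; first exact: nearW.
  have /cvgrPdist_lt Fx := F0 x Bx.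
  apply/cvgrPdist_lt => e e0.
  have ep : 0 < e `^ p^-1 by exact: powR_gt0.
  have := Fx _ ep; apply: filterS => k /=; rewrite !sub0r !normrN => Fk.
  rewrite ger0_norm ?powR_ge0//.
  have -> : e = (e `^ p^-1) `^ p by rewrite -powRrM mulVf ?gt_eqF// powRr1// ltW.
  by apply: gt0_ltr_powR; rewrite ?nnegrE// ltW.
- apply: (bounded_ball_integrable (F := cst (C `^ p)) (C := C `^ p)) => //.
  by move=> x _; rewrite ger0_norm// powR_ge0.
- apply: aeW => x k Bx; rewrite /= lee_fin ger0_norm ?powR_ge0//.
  by apply: ge0_ler_powR; rewrite ?nnegrE ?(ltW p0)// ?(le_trans _ (FC k x Bx))// FC.
move=> _ _; rewrite integral0; exact.
Qed.

End ball_norm_theory.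

Section radial_sobolev.
Context {R : realType} {n : nat}.
Local Notation lam := (@lebesgue_measure R).
Local Notation B := (@unit_ball R n).

Lemma derive_bounded_le (D dD : R -> R) (C s t : R) : s <= t ->
  (forall x, is_derive x (1 : R) D (dD x)) ->
  (forall x, s <= x <= t -> `|dD x| <= C) -> `|D t - D s| <= C * (t - s).
Proof.
move=> st dE dC.
have cD : continuous D by apply: derivable_continuous => x; have [] := dE x.
have [c cst ->] := MVT_segment st (fun x _ => dE x) (continuous_subspaceT cD).
rewrite normrM [X in _ * X]ger0_norm ?subr_ge0// ler_wpM2r ?subr_ge0//.
by apply: dC; move: cst; rewrite in_itv.
Qed.

(** Since [D k 1 = 0], [- D k s] is the integral of [dD k] up to 1, and dominated convergence
    applies. The endpoint 1 is left out because step sums vanish there whatever the value of [q]. *)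
Lemma primitive_cvg (D dD : nat -> R -> R) (C s : R) :
  (forall k x, is_derive x (1 : R) (D k) (dD k x)) ->
  (forall k, continuous (dD k)) -> (forall k, D k 1 = 0) ->
  (forall k x, 0 <= x <= 1 -> `|dD k x| <= C) ->
  (forall x, 0 <= x < 1 -> dD k x @[k --> \oo] --> (0 : R)) ->
  0 <= s < 1 -> D k s @[k --> \oo] --> (0 : R).
Proof.
move=> dE cdD D1 dC d0 /andP[s0 s1].
have mD k : measurable_fun (`[s, 1[%classic : set R) (dD k).
  by apply: measurable_funTS; exact: continuous_measurable_fun.
have DE k : (\int[lam]_(x in `[s, 1%R[) (dD k x)%:E = (- D k s)%:E)%E.
  rewrite integral_itv_bndo_bndc; last by apply/measurable_EFinP; exact: mD.
  have cD : continuous (D k) by apply: derivable_continuous => x; have [] := dE k x.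
  rewrite (@continuous_FTC2 _ _ (D k))//.
  - by rewrite D1 -EFinB sub0r.
  - exact: continuous_subspaceT.
  - split.
    + by move=> x _; have [] := dE k x.
    + by apply: cvg_at_right_filter; exact: cD.
    + by apply: cvg_at_left_filter; exact: cD.
  - by move=> x _; rewrite derive1E; have [_ ->] := dE k x.
have [] := @dominated_convergence _ _ _ lam (`[s, 1[%classic : set R) (measurable_itv _)
  (fun k x => (dD k x)%:E) (cst 0%E) (cst C%:E).
- by move=> k; apply/measurable_EFinP; exact: mD.
- exact: measurable_cst.
- apply: aeW => x /=; rewrite in_itv/= => /andP[sx x1].
  by apply: cvg_EFin; [exact: nearW|apply: d0; rewrite x1 (le_trans s0)].
- apply: measurable_bounded_integrable => //.
  + by rewrite /= lebesgue_measure_itv/=; case: ifPn => //= _; rewrite -EFinB ltry.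
  + exact: bounded_cst.
- apply: aeW => x k /=; rewrite in_itv/= => /andP[sx x1].
  by rewrite lee_fin dC// (ltW x1) (le_trans s0).
move=> _ _; rewrite integral0; under eq_fun do rewrite DE.
move=> /fine_cvgP[_ /=] /cvgN; rewrite oppr0.
rewrite (_ : - _ = fun k => D k s) //.
by apply/funext => k /=; rewrite fctE /= opprK.
Qed.

(** The profile is only C^1. Primitives of the step sums of [q], normalised to vanish at 1, are
    smooth and vanish near 1, hence give test functions. Their derivatives are uniformly bounded and
    converge on [[0, 1[], so dominated convergence gives convergence of both the functions and the
    gradients in [L^p]. *)
Lemma W01p_radial (p : R) (U q : R -> R) : 1 <= p -> continuous q ->
  (forall s, is_derive s (1 : R) U (q s)) -> U 1 = 0 ->
  W01p p (fun x : 'rV[R]_n => U (dot x x)) (fun x => (2 * q (dot x x)) *: x).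
Proof.
move=> p1 cq dU U1.
have cU : continuous U by apply: derivable_continuous => x; have [] := dU x.
have crad (g : R -> R) : continuous g -> continuous (fun x : 'rV[R]_n => g (dot x x)).
  by move=> cg x; apply: continuous_comp; [exact: continuous_dot|exact: cg].
have cG (g : R -> R) i : continuous g ->
    continuous (fun x : 'rV[R]_n => g (dot x x) * (2 * x ord0 i)).
  move=> cg x; have c2 : continuous (fun y : 'rV[R]_n => 2 * y ord0 i).
    by apply: (@Cn_continuous _ _ 0); apply: CnM; [exact: Cn_cst|exact: Cn_coord].
  by have := cvgM (crad _ cg x) (c2 x); exact.
have GE (i : 'I_n) (x : 'rV[R]_n) : ((2 * q (dot x x)) *: x) ord0 i = q (dot x x) * (2 * x ord0 i).
  by rewrite mxE mulrCA mulrA.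
have mcont (F : 'rV[R]_n -> R) : continuous F -> measurable_fun B F.
  by move=> cF; apply: measurable_funTS; exact: continuous_measurable_rV.
split.
  split.
  - have [C [_ CF]] := continuous_ball_bounded (crad _ cU).
    by apply: Lball_bounded CF => //; exact: (mcont _ (crad _ cU)).
  - move=> i; under eq_fun do rewrite GE.
    have [C [_ CF]] := continuous_ball_bounded (cG _ i cq).
    by apply: Lball_bounded CF => //; exact: (mcont _ (cG _ i cq)).
  - move=> phi tphi i.
    have dUi x := @partial_radial _ n U _ i x (dU (dot x x)).
    rewrite (@Rintegral_by_parts _ _ _ _ _ i (crad _ cU) (cG _ i cq) dUi tphi).
    by congr (- _); apply: eq_Rintegral => x _; rewrite GE.
pose qk k := stepsum q k.+1.
have cqk k : continuous (qk k) by exact: (Ck_continuous (@Ck_stepsum R 0 q k.+1)).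
have /choice[Q QE] k := primitive_exists (cqk k).
pose psi k s := Q k s - Q k 1.
have psiE k s : is_derive s (1 : R) (psi k) (qk k s).
  by apply: (is_derive_eq (is_deriveB (QE k s) (is_derive_cst (Q k 1) s 1))); rewrite subr0.
have Cpsi k m : Ck m (psi k).
  by apply: CkS; apply: (is_derive_Ck (psiE k)); exact: Ck_stepsum.
have psi1 k : psi k 1 = 0 by rewrite /psi subrr.
have psi0 k s : 1 - k.+1%:R^-1 <= s -> psi k s = 0.
  have K0 : 0 < k.+1%:R :> R by rewrite ltr0n.
  move=> ks.
  have q0 x : 1 - k.+1%:R^-1 <= x -> `|qk k x| <= 0.
    move=> kx; rewrite /qk stepsum_right ?normr0//=.
    have kE : k%:R = k.+1%:R - 1 :> R by rewrite -natr1 addrK.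
    by rewrite kE -ler_pdivrMl// mulrBr mulr1 mulVf ?gt_eqF.
  have cpsi : continuous (psi k) by exact: (Ck_continuous (Cpsi k 0)).
  apply/eqP; rewrite -normr_le0; have [s1|/ltW s1] := leP s 1.
    have := derive_bounded_le s1 (psiE k) (C := 0); rewrite psi1 sub0r normrN mul0r.
    by apply => x /andP[sx _]; apply: q0; exact: le_trans sx.
  have := derive_bounded_le s1 (psiE k) (C := 0); rewrite psi1 subr0 mul0r.
  by apply => x /andP[sx _]; apply: q0; apply: le_trans sx; rewrite gerBl invr_ge0 ltW.
have [C [C0 qC]] : exists C, 0 <= C /\ forall t, 0 <= t <= 1 -> `|q t| <= C.
  have /compact_bounded[C [_ /(_ (`|C| + 1)) CF]] :=
    continuous_compact (continuous_subspaceT cq) (@segment_compact R 0 1).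
  exists (`|C| + 1); split; first by rewrite addr_ge0.
  move=> t t01; apply: CF; first by rewrite (le_lt_trans (ler_norm _))// ltrDl.
  by exists t => //=; rewrite in_itv.
have qkC k s : 0 <= s <= 1 -> `|qk k s| <= C by exact: stepsum_bounded.
have dqC k s : 0 <= s <= 1 -> `|qk k s - q s| <= C + C.
  by move=> s01; rewrite (le_trans (ler_normB _ _))// lerD ?qkC ?qC.
have dq0 s : 0 <= s < 1 -> qk k s - q s @[k --> \oo] --> (0 : R).
  move=> s01; have := cvgB (stepsum_cvg cq s01) (cvg_cst (q s)).
  by rewrite subrr; exact.
have DE k s : is_derive s (1 : R) (fun s => psi k s - U s) (qk k s - q s).
  exact: is_deriveB (psiE k s) (dU s).
have Bdot (x : 'rV[R]_n) : B x -> 0 <= dot x x < 1.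
  by move=> /unit_ballE ->; rewrite dot_ge0.
have Bdotw (x : 'rV[R]_n) : B x -> 0 <= dot x x <= 1.
  by move=> /Bdot/andP[-> /ltW].
exists (fun k x => psi k (dot x x)); split.
- move=> k; apply: (test_function_radial (d := k.+1%:R^-1)).
  + by move=> m; exact: Cpsi.
  + by rewrite invr_gt0.
  + exact: psi0.
- apply: (ball_norm_cvg0 (C := C + C)) => //.
  + move=> k; apply: mcont; apply: (crad (fun s => psi k s - U s)).
    by apply: derivable_continuous => s; have [] := DE k s.
  + move=> k x /Bdotw/andP[x0 x1].
    have := derive_bounded_le x1 (DE k) (C := C + C).
    rewrite psi1 U1 subrr sub0r normrN => h; apply: (le_trans (h _)).
      by move=> y /andP[xy y1]; apply: dqC; rewrite y1 (le_trans x0).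
    by rewrite ler_piMr ?addr_ge0// gerBl.
  + move=> x /Bdot x01.
    apply: (primitive_cvg (dD := fun k s => qk k s - q s) (D := fun k s => psi k s - U s) (C := C + C)) => //.
    * by move=> k s; have := cvgB (cqk k s) (cq s); exact.
    * by move=> k; rewrite psi1 U1 subrr.
- move=> i.
  have EE k (x : 'rV[R]_n) : partial i (fun y => psi k (dot y y)) x -
      ((2 * q (dot x x)) *: x) ord0 i = (qk k (dot x x) - q (dot x x)) * (2 * x ord0 i).
    by rewrite GE (partialE (partial_radial i (psiE k _))) mulrBl.
  apply: (ball_norm_cvg0 (C := (C + C) * 2)) => //.
  + move=> k; under eq_fun do rewrite EE.
    apply: mcont; apply: (cG (fun s => qk k s - q s)).
    by move=> s; have := cvgB (cqk k s) (cq s); exact.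
  + move=> k x Bx; rewrite EE normrM ler_pM// ?dqC ?Bdotw//.
    by rewrite normrM ger0_norm// ler_piMr// unit_ball_cube.
  + move=> x Bx; under eq_fun do rewrite EE.
    have := cvgM (dq0 _ (Bdot _ Bx)) (cvg_cst (2 * x ord0 i)).
    by rewrite mul0r; exact.
Qed.

End radial_sobolev.

(** * Integrability and Hoelder's inequality on the ball *)

Section ball_integrals.
Context {R : realType} {n : nat}.
Implicit Types (a F G : 'rV[R]_n -> R).
Local Notation mu := (@lebesgue_rV R n).
Local Notation B := (@unit_ball R n).
Let mB := @measurable_unit_ball R n.

Lemma ball_dominated_integrable F G : measurable_fun B F ->
  mu.-integrable B (EFin \o G) -> (forall x, B x -> `|F x| <= G x) ->
  mu.-integrable B (EFin \o F).
Proof.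
move=> mF iG FG; apply: le_integrable iG => //; first exact/measurable_EFinP.
move=> x Bx; rewrite /= lee_fin (le_trans (FG x Bx))//; exact: ler_norm.
Qed.

Lemma integrable_sum_ball (I : Type) (r : seq I) (E : I -> 'rV[R]_n -> R) :
  (forall i, mu.-integrable B (EFin \o E i)) ->
  mu.-integrable B (EFin \o (fun x => \sum_(i <- r) E i x)).
Proof.
move=> iE; elim: r => [|i r IH].
  under eq_fun do rewrite big_nil.
  exact: (continuous_ball_integrable (@cst_continuous _ _ (0 : R))).
under eq_fun do rewrite big_cons.
by have := integrableD mB (iE i) IH; exact.
Qed.

Lemma Rintegral_sum_ball (I : Type) (r : seq I) (E : I -> 'rV[R]_n -> R) :
  (forall i, mu.-integrable B (EFin \o E i)) ->
  \int[mu]_(x in B) (\sum_(i <- r) E i x) = \sum_(i <- r) \int[mu]_(x in B) E i x.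
Proof.
move=> iE; elim: r => [|i r IH].
  rewrite big_nil; under eq_Rintegral do rewrite big_nil.
  by rewrite Rintegral_cst ?mul0r.
rewrite big_cons -IH -RintegralD//; last exact: integrable_sum_ball.
by apply: eq_Rintegral => x _; rewrite big_cons.
Qed.

Lemma integrable_normr_ball (F : 'rV[R]_n -> R) : mu.-integrable B (EFin \o F) ->
  mu.-integrable B (EFin \o (fun x => `|F x|)).
Proof. by move=> iF; have := integrable_abse iF; exact. Qed.

Lemma integrableZl_ball (c : R) (F : 'rV[R]_n -> R) : mu.-integrable B (EFin \o F) ->
  mu.-integrable B (EFin \o (fun x => c * F x)).
Proof. by move=> iF; have := integrableZl mB c iF; exact. Qed.

Lemma integrableD_ball (F G : 'rV[R]_n -> R) : mu.-integrable B (EFin \o F) ->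
  mu.-integrable B (EFin \o G) -> mu.-integrable B (EFin \o (fun x => F x + G x)).
Proof. by move=> iF iG; have := integrableD mB iF iG; exact. Qed.

Lemma integrableB_ball (F G : 'rV[R]_n -> R) : mu.-integrable B (EFin \o F) ->
  mu.-integrable B (EFin \o G) -> mu.-integrable B (EFin \o (fun x => F x - G x)).
Proof. by move=> iF iG; have := integrableB mB iF iG; exact. Qed.

Lemma Lball_powR_integrable (p : R) F : 0 < p -> Lball p%:E F ->
  mu.-integrable B (EFin \o (fun x => `|F x| `^ p)).
Proof.
move=> p0 [mF]; rewrite ball_normE ?gt_eqF// => h0.
have pV : p^-1 != 0 by rewrite invr_eq0 gt_eqF.
have h := lty_poweRy pV h0.
apply/integrableP; split.
  by apply/measurable_EFinP; exact: measurable_normr_powR.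
under eq_integral do rewrite /= ger0_norm ?powR_ge0//.
exact: h.
Qed.

Lemma normr_le_powR (p t : R) : 1 <= p -> `|t| <= 1 + `|t| `^ p.
Proof.
move=> p1; have [t1|t1] := leP `|t| 1.
  by rewrite (le_trans t1)// lerDl powR_ge0.
by rewrite (le_trans (le1r_powR (ltW t1) p1))// lerDr.
Qed.

Lemma Lball_integrable (p : R) F : 1 <= p -> Lball p%:E F ->
  mu.-integrable B (EFin \o F).
Proof.
move=> p1 LF; have [mF _] := LF.
apply: (ball_dominated_integrable (G := fun x => 1 + `|F x| `^ p)) => //; last first.
  by move=> x _; exact: normr_le_powR.
have := integrableD mB (continuous_ball_integrable (@cst_continuous _ _ (1 : R)))
  (Lball_powR_integrable (lt_le_trans ltr01 p1) LF).
exact.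
Qed.

Lemma ball_holder_cvg0 (p q : R) a (F : nat -> 'rV[R]_n -> R) : 0 < p -> 0 < q ->
  p^-1 + q^-1 = 1 -> Lball p%:E a -> (forall k, measurable_fun B (F k)) ->
  ball_norm q%:E (F k) @[k --> \oo] --> 0%E ->
  \int[mu]_(x in B) `|a x * F k x| @[k --> \oo] --> (0 : R).
Proof.
move=> p0 q0 pq [ma aoo] mF F0.
have ha k : (\int[mu]_(x in B) (`|a x * F k x|)%:E <=
    ball_norm p%:E a * ball_norm q%:E (F k))%E.
  have := @hoelder _ _ _ mu (a \_ B) (F k \_ B) p q
    ((measurable_restrictT a mB).1 ma) ((measurable_restrictT _ mB).1 (mF k)) p0 q0 pq.
  apply: le_trans; rewrite Lnorm1 [leLHS]integral_mkcond.
  rewrite le_eqVlt; apply/orP; left; apply/eqP; apply: eq_integral => x _.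
  by rewrite /= !patchE; case: ifPn => //; rewrite mulr0 normr0.
have afin : ball_norm p%:E a \is a fin_num by rewrite ge0_fin_numE// Lnorm_ge0.
have c0 : (ball_norm p%:E a * ball_norm q%:E (F k))%E @[k --> \oo] --> 0%E.
  have := cvgeZl afin F0; rewrite mule0; exact.
have : (\int[mu]_(x in B) (`|a x * F k x|)%:E)%E @[k --> \oo] --> 0%E.
  apply: (squeeze_cvge _ (cvg_cst 0%E) c0); apply: nearW => k.
  by rewrite ha andbT integral_ge0// => x _; rewrite lee_fin.
by move=> /fine_cvgP[].
Qed.

(** Hoelder's inequality against the constant 1, which lies in every [L^q] because the ball has
    finite measure. *)
Lemma ball_norm_cvg0_L1 (p : R) (F : nat -> 'rV[R]_n -> R) : 1 < p ->
  (forall k, measurable_fun B (F k)) ->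
  ball_norm p%:E (F k) @[k --> \oo] --> 0%E ->
  \int[mu]_(x in B) `|F k x| @[k --> \oo] --> (0 : R).
Proof.
move=> p1 mF F0; have p0 : 0 < p by exact: lt_trans p1.
pose q := p / (p - 1); have p10 : 0 < p - 1 by rewrite subr_gt0.
have q1 : 1 <= q by rewrite ler_pdivlMr// mul1r gerBl.
have L1 : Lball q%:E (cst 1 : 'rV[R]_n -> R).
  by apply: (Lball_bounded (C := 1)) => //= x _; rewrite normr1.
have pq : q^-1 + p^-1 = 1 by rewrite /q invf_div; field; rewrite gt_eqF.
have := ball_holder_cvg0 (lt_le_trans ltr01 q1) p0 pq L1 mF F0.
by under eq_fun do under eq_Rintegral do rewrite mul1r.
Qed.

Lemma ae_le_Rintegral F G : mu.-integrable B (EFin \o F) ->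
  mu.-integrable B (EFin \o G) ->
  {ae mu, forall x, B x -> F x <= G x} ->
  \int[mu]_(x in B) F x <= \int[mu]_(x in B) G x.
Proof.
move=> iF iG FG; rewrite -subr_ge0 -RintegralB//.
have iGF : mu.-integrable B (EFin \o (fun x => G x - F x)) by have := integrableB mB iG iF; exact.
have /integrableP[mGF _] := iGF.
rewrite /Rintegral (@ae_eq_integral _ _ _ mu B (fun x => `|(G x - F x)%:E|%E))//.
- by apply: fine_ge0; exact: integral_ge0.
- exact: (measurableT_comp (@abse_measurable R setT) mGF).
- by apply: filterS FG => x FGx Bx; rewrite /= ger0_norm// subr_ge0 FGx.
Qed.

(** Some coordinate is at least [|v| / (n+1)]: otherwise the sum of the squares would give
    [(n+1)^2 <= n]. This crude constant suffices to put the norm of a weak gradient in [L^p]. *)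
Lemma eucl_norm_powR_le (p : R) (v : 'rV[R]_n) : 0 < p ->
  eucl_norm v `^ p <= n.+1%:R `^ p * \sum_i `|v ord0 i| `^ p.
Proof.
move=> p0.
have S0 (P : pred 'I_n) : 0 <= \sum_(i | P i) `|v ord0 i| `^ p.
  by apply: sumr_ge0 => i _; exact: powR_ge0.
have [->|v0] := eqVneq (eucl_norm v) 0.
  by rewrite powR0 ?gt_eqF// mulr_ge0// powR_ge0.
have vp : 0 < eucl_norm v by rewrite lt_neqAle eq_sym v0 eucl_norm_ge0.
have [i hi] : exists i, eucl_norm v <= n.+1%:R * `|v ord0 i|.
  apply: contrapT => /forallNP small.
  have : n.+1%:R ^+ 2 * dot v v <= n%:R * dot v v.
    rewrite -[X in X%:R * _](card_ord n) mulr_natl -sumr_const {1}/dot mulr_sumr.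
    apply: ler_sum => i _.
    have /ltW small_i : n.+1%:R * `|v ord0 i| < eucl_norm v by rewrite ltNge; exact/negP.
    rewrite -eucl_norm_sqr -expr2 -exprMn -real_normK ?num_real//.
    by rewrite lerXn2r ?nnegrE// ?(ltW vp)// normrM ger0_norm.
  apply/negP; rewrite -ltNge ltr_pM2r; last by rewrite -eucl_norm_sqr exprn_gt0.
  by rewrite -natrX ltr_nat expnS expn1 mulSn ltn_addr.
rewrite (bigD1 i)//= mulrDr -powRM// ler_wpDr ?mulr_ge0 ?powR_ge0//.
by apply: ge0_ler_powR; rewrite ?nnegrE ?(ltW p0) ?eucl_norm_ge0// mulr_ge0.
Qed.

End ball_integrals.

(** * Radial solutions *)

Section radial_fixpoint.
Context {R : realType}.
Local Notation lam := (@lebesgue_measure R).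

Definition decreasing_in (M : R) (v : R -> R) : Prop :=
  (forall s t, s <= t -> v t <= v s) /\ (forall s, 0 <= v s <= M).

(* The pointwise infimum of all supersolutions is a solution; restricting to
   monotone functions makes measurability free. *)
Lemma decreasing_fixpoint (M : R) (T : (R -> R) -> R -> R) : 0 <= M ->
  (forall v, decreasing_in M v ->
     (forall s t, s <= t -> T v t <= T v s) /\ (forall s, 0 <= T v s)) ->
  (forall v w, decreasing_in M v -> decreasing_in M w ->
     (forall s, v s <= w s) -> forall s, T v s <= T w s) ->
  (forall s, T (cst M) s <= M) ->
  exists u, decreasing_in M u /\ forall s, T u s = u s.
Proof.
move=> M0 Tdec Tmon TM.
have DM : decreasing_in M (cst M) by split => [//|s]; rewrite /= M0 lexx.
pose P := [set v | decreasing_in M v /\ forall s, T v s <= v s].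
have PM : P (cst M) by [].
pose u s := inf [set v s | v in P].
have hlb s : has_lbound [set v s | v in P].
  by exists 0 => _ [v [[_ vM] _] <-]; case/andP: (vM s).
have nonempty s : [set v s | v in P] !=set0 by exists (cst M s), (cst M).
have uP v s : P v -> u s <= v s by move=> Pv; apply: ge_inf => //; exists v.
have leu s x : (forall v, P v -> x <= v s) -> x <= u s.
  by move=> xP; apply: lb_le_inf => // _ [v Pv <-]; exact: xP.
have Du : decreasing_in M u.
  split => [s t st|s].
    by apply: leu => v Pv; apply: le_trans (uP _ _ Pv) _; case: Pv => -[+ _] _; exact.
  apply/andP; split; last exact: uP PM.
  by apply: leu => v [[_ vM] _]; case/andP: (vM s).
have Tu s : T u s <= u s.
  apply: leu => v Pv; have [Dv Tv] := Pv.
  by apply: le_trans (Tv s); apply: Tmon => // t; exact: uP.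
have DTu : decreasing_in M (T u).
  have [Td T0] := Tdec _ Du; split => // s.
  by rewrite T0/= (le_trans (Tu s))//; case: Du => _ /(_ s) /andP[].
exists u; split => // s; apply/eqP; rewrite eq_le Tu/=.
(* By monotonicity [T u] is again a supersolution, so the infimum lies below it. *)
by apply: uP; split => // t; apply: Tmon.
Qed.

Context (N : nat) (l alpha M : R) (F : R -> R).
Context (N0 : (0 < N)%N) (l0 : 0 <= l) (alpha1 : 1 < alpha) (M0 : 0 <= M).
Context (F0 : forall s, 0 <= F s) (Fnd : forall s t, s <= t -> F s <= F t).

(* Functions of [s = |x|^2]: [radial_op v] is the radial solution of
   -Delta_p u = l F(v) vanishing on the sphere, with [alpha = 1 / (p - 1)]. *)
Definition flux_density (v : R -> R) (t : R) : R := t ^+ N.-1 * (l * F (v (t ^+ 2))).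

Definition flux (v : R -> R) (r : R) : R := \int[lam]_(t in `[0, r]) flux_density v t.

(** With [r = sqrt s], the radial equation integrates to [r^(N-1) (-u'(r))^(p-1) = flux v r], that
    is, [-u'(r) = (r * flux v r / r^N)^alpha]. The chain rule for [s = r^2] divides by [2 r], hence
    the power [alpha - 1] and the factor 1/2. *)
Definition slope (v : R -> R) (s : R) : R :=
  (flux v (Num.sqrt s) / Num.sqrt s ^+ N) `^ alpha * Num.sqrt s `^ (alpha - 1) / 2.

(** The maximum makes the function constant for [s <= 0]; for [s > 1] the interval is empty and the
    value is 0. The result is thus monotone on the whole line, as [decreasing_in] requires. *)
Definition radial_op (v : R -> R) (s : R) : R :=
  \int[lam]_(t in `[Num.max 0 s, 1]) slope v t.

Lemma integral_pow (r : R) : 0 <= r ->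
  \int[lam]_(t in `[0, r]) t ^+ N.-1 = r ^+ N / N%:R.
Proof.
rewrite le_eqVlt => /predU1P[<-|r0].
  by rewrite set_itv1 Rintegral_set1 expr0n gtn_eqF// mul0r.
have dG x : is_derive x (1 : R) (fun t : R => N%:R^-1 *: t ^+ N) (x ^+ N.-1).
  apply: (is_derive_eq (is_deriveZ N%:R^-1 (is_derive_pow N x))).
  by rewrite [_ *: _]mulrA mulVf ?mul1r// pnatr_eq0 -lt0n.
have cG : continuous (fun t : R => N%:R^-1 *: t ^+ N).
  by apply: derivable_continuous => x; have [] := dG x.
rewrite /Rintegral (@continuous_FTC2 _ _ (fun t : R => N%:R^-1 *: t ^+ N))//.
- by rewrite expr0n gtn_eqF// scaler0 sube0/= mulrC.
- by apply: continuous_subspaceT; exact: exprn_continuous.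
- split.
  + by move=> x _; have [] := dG x.
  + by apply: cvg_at_right_filter; exact: cG.
  + by apply: cvg_at_left_filter; exact: cG.
- by move=> x _; rewrite derive1E; have [_ ->] := dG x.
Qed.

Lemma measurable_pow (D : set R) (k : nat) : measurable_fun D (fun t : R => t ^+ k).
Proof. by apply: measurable_funTS; apply: continuous_measurable_fun; exact: exprn_continuous. Qed.

Lemma measurable_flux_density v (D : set R) : decreasing_in M v ->
  measurable_fun D (flux_density v).
Proof.
move=> [vd _]; apply: measurable_funTS; apply: measurable_funM; first exact: measurable_pow.
apply: (@measurableT_comp _ _ _ _ _ _ (fun s => l * F (v s)) _ (fun t : R => t ^+ 2)).
  by apply: nonincreasing_measurable => // s t st; rewrite ler_wpM2l// Fnd// vd.
exact: measurable_pow.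
Qed.

Lemma flux_density_itv v (r t : R) : decreasing_in M v -> 0 <= t ->
  0 <= flux_density v t <= l * F M * t ^+ N.-1.
Proof.
move=> [_ vM] t0; rewrite /flux_density !mulr_ge0 ?exprn_ge0//=.
rewrite mulrC ler_wpM2r ?exprn_ge0// ler_wpM2l// Fnd//.
by case/andP: (vM (t ^+ 2)).
Qed.

Lemma pow_integrable (c r : R) : lam.-integrable `[0, r] (EFin \o (fun t => c * t ^+ N.-1)).
Proof.
apply: continuous_segment_integrable => t.
by have := cvgM (cvg_cst c) (@exprn_continuous R N.-1 t); exact.
Qed.

Lemma flux_density_integrable v (r : R) : decreasing_in M v ->
  lam.-integrable `[0, r] (EFin \o flux_density v).
Proof.
move=> Dv; apply: le_integrable (pow_integrable (l * F M) r) => //.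
- by apply/measurable_EFinP; exact: measurable_flux_density.
move=> t; rewrite /= in_itv/= => /andP[t0 _].
have /andP[d0 dM] := flux_density_itv r Dv t0.
by rewrite lee_fin !ger0_norm// (le_trans d0).
Qed.

Lemma flux_ge0 v (r : R) : decreasing_in M v -> 0 <= flux v r.
Proof.
move=> Dv; apply: Rintegral_ge0 => t; rewrite /= in_itv/= => /andP[t0 _].
by case/andP: (flux_density_itv r Dv t0).
Qed.

Lemma flux_le v (r : R) : decreasing_in M v -> 0 <= r ->
  flux v r <= l * F M / N%:R * r ^+ N.
Proof.
move=> Dv r0; rewrite mulrAC -mulrA -integral_pow//.
rewrite -RintegralZl//; last first.
  rewrite (_ : (fun x : R => x ^+ N.-1) = fun t => 1 * t ^+ N.-1).
    exact: pow_integrable.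
  by apply/funext => t; rewrite mul1r.
apply: le_Rintegral => //.
- exact: flux_density_integrable.
- exact: pow_integrable.
move=> t; rewrite /= in_itv/= => /andP[t0 _].
by case/andP: (flux_density_itv r Dv t0).
Qed.

Lemma flux_nondecreasing v : decreasing_in M v -> {homo flux v : r s / r <= s}.
Proof.
move=> Dv r s rs; rewrite /flux.
have sub : `[0, r] `<=` `[0, s].
  by move=> t /=; rewrite !in_itv/= => /andP[-> tr]; exact: le_trans rs.
rewrite fine_le//.
- by apply: integrable_fin_num => //; exact: flux_density_integrable.
- by apply: integrable_fin_num => //; exact: flux_density_integrable.
apply: ge0_subset_integral => //.
- by apply/measurable_EFinP; exact: measurable_flux_density.
move=> t; rewrite /= in_itv/= => /andP[t0 _]; rewrite lee_fin.
by case/andP: (flux_density_itv r Dv t0).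
Qed.

Lemma flux_mono v w (r : R) : decreasing_in M v -> decreasing_in M w ->
  (forall s, v s <= w s) -> flux v r <= flux w r.
Proof.
move=> Dv Dw vw; apply: le_Rintegral => //; try exact: flux_density_integrable.
move=> t; rewrite /= in_itv/= => /andP[t0 _].
by rewrite ler_wpM2l ?exprn_ge0// ler_wpM2l// Fnd.
Qed.

Lemma measurable_slope v (D : set R) : decreasing_in M v -> measurable_fun D (slope v).
Proof.
move=> Dv; apply: measurable_funTS.
have ms : measurable_fun [set: R] (@Num.sqrt R).
  by apply: continuous_measurable_fun; exact: sqrt_continuous.
have mV : measurable_fun [set: R] (fun s : R => (Num.sqrt s ^+ N) `^ (-1)).
  apply: (measurableT_comp (measurable_powR (-1))).
  exact: (measurableT_comp (@measurable_pow setT N) ms).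
apply: measurable_funM; last exact: measurable_cst.
apply: measurable_funM.
  apply: (measurableT_comp (measurable_powR alpha)).
  rewrite (_ : (fun s => _) = fun s => flux v (Num.sqrt s) * (Num.sqrt s ^+ N) `^ (-1)).
    apply: measurable_funM => //; apply: (measurableT_comp _ ms).
    by apply: nondecreasing_measurable => //; exact: flux_nondecreasing.
  by apply/funext => s; rewrite powR_inv1// exprn_ge0// sqrtr_ge0.
exact: (measurableT_comp (measurable_powR _) ms).
Qed.

Lemma slope_base_itv v (s : R) : decreasing_in M v ->
  0 <= flux v (Num.sqrt s) / Num.sqrt s ^+ N <= l * F M / N%:R.
Proof.
move=> Dv; rewrite divr_ge0 ?flux_ge0 ?exprn_ge0 ?sqrtr_ge0//=.
have [s0|s0] := leP s 0.
  (* Here the quotient is a division by 0, whose value 0 satisfies the bounds. *)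
  by rewrite ler0_sqrtr// expr0n gtn_eqF// invr0 mulr0 divr_ge0// mulr_ge0.
by rewrite ler_pdivrMr ?exprn_gt0 ?sqrtr_gt0// flux_le// sqrtr_ge0.
Qed.

Lemma slope_itv v (s : R) : decreasing_in M v -> s <= 1 ->
  0 <= slope v s <= (l * F M / N%:R) `^ alpha / 2.
Proof.
move=> Dv s1; rewrite /slope !mulr_ge0 ?powR_ge0//= ler_wpM2r//.
have /andP[b0 b1] := slope_base_itv s Dv.
rewrite -[leRHS]mulr1 ler_pM ?powR_ge0//.
  apply: ge0_ler_powR; rewrite ?nnegrE//; last exact: le_trans b1.
  by rewrite ltW// (lt_trans ltr01).
rewrite [leRHS](_ : 1 = 1 `^ (alpha - 1)); last by rewrite powR1.
rewrite ge0_ler_powR ?nnegrE ?sqrtr_ge0//.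
  by rewrite subr_ge0 ltW.
by rewrite -sqrtr1 ler_wsqrtr.
Qed.

Lemma slope_integrable v (a : R) : decreasing_in M v ->
  lam.-integrable `[a, 1] (EFin \o slope v).
Proof.
move=> Dv; apply: measurable_bounded_integrable => //.
- by rewrite /= lebesgue_measure_itv/=; case: ifPn => //= _; rewrite -EFinB ltry.
- exact: measurable_slope.
exists ((l * F M / N%:R) `^ alpha / 2); split; rewrite ?num_real// => y Cy x /=.
rewrite in_itv/= => /andP[_ x1]; have /andP[x0 xC] := slope_itv Dv x1.
by rewrite ger0_norm// (le_trans xC)// ltW.
Qed.

Lemma radial_op_ge0 v (s : R) : decreasing_in M v -> 0 <= radial_op v s.
Proof.
move=> Dv; apply: Rintegral_ge0 => t; rewrite /= in_itv/= => /andP[_ t1].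
by case/andP: (slope_itv Dv t1).
Qed.

Lemma radial_op_nonincreasing v (s t : R) : decreasing_in M v -> s <= t ->
  radial_op v t <= radial_op v s.
Proof.
move=> Dv st; rewrite /radial_op fine_le//.
- by apply: integrable_fin_num => //; exact: slope_integrable.
- by apply: integrable_fin_num => //; exact: slope_integrable.
apply: ge0_subset_integral => //.
- by apply/measurable_EFinP; exact: measurable_slope.
- by move=> x; rewrite /= in_itv/= => /andP[_ x1]; rewrite lee_fin; case/andP: (slope_itv Dv x1).
- move=> x /=; rewrite !in_itv/= => /andP[tx ->]; rewrite andbT; apply: le_trans tx.
  by rewrite ge_max !le_max lexx st orbT.
Qed.

Lemma slope_mono v w (t : R) : decreasing_in M v -> decreasing_in M w ->
  (forall s, v s <= w s) -> slope v t <= slope w t.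
Proof.
move=> Dv Dw vw.
have /andP[v0 _] := slope_base_itv t Dv; have /andP[w0 _] := slope_base_itv t Dw.
have a0 : 0 <= alpha by exact: ltW (lt_trans ltr01 alpha1).
have half : 0 <= 2^-1 :> R by rewrite invr_ge0.
apply: (ler_wpM2r half); apply: (ler_wpM2r (powR_ge0 _ _)).
apply: (ge0_ler_powR a0 v0 w0).
have s0 : 0 <= (Num.sqrt t ^+ N)^-1 by rewrite invr_ge0 exprn_ge0// sqrtr_ge0.
exact: (ler_wpM2r s0 (flux_mono _ Dv Dw vw)).
Qed.

Lemma radial_op_mono v w (s : R) : decreasing_in M v -> decreasing_in M w ->
  (forall t, v t <= w t) -> radial_op v s <= radial_op w s.
Proof.
move=> Dv Dw vw; apply: le_Rintegral.
- exact: measurable_itv.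
- exact: slope_integrable Dv.
- exact: slope_integrable Dw.
by move=> t _; exact: slope_mono.
Qed.

Lemma slope_integral_le v (a b : R) : decreasing_in M v -> a <= b -> b <= 1 ->
  \int[lam]_(t in `[a, b]) slope v t <= (l * F M / N%:R) `^ alpha / 2 * (b - a).
Proof.
move=> Dv ab b1; set C := _ / 2.
have -> : C * (b - a) = \int[lam]_(t in `[a, b]) C.
  rewrite Rintegral_cst// /= lebesgue_measure_itv/= lte_fin.
  by case: ltP => [_|ba] //=; rewrite (@le_anti _ R a b) ?subrr// ab.
apply: le_Rintegral => //.
- apply: integrableS (slope_integrable a Dv) => //.
  by apply: subset_itvl; rewrite bnd_simp.
- by apply: continuous_segment_integrable => x; exact: cvg_cst.
move=> x; rewrite /= in_itv/= => /andP[_ xb].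
by case/andP: (slope_itv Dv (le_trans xb b1)).
Qed.

Lemma radial_fixpoint : (l * F M / N%:R) `^ alpha <= M ->
  exists u, decreasing_in M u /\ forall s, radial_op u s = u s.
Proof.
move=> KM; apply: (decreasing_fixpoint M0).
- move=> v Dv; split; first by move=> s t; exact: radial_op_nonincreasing Dv.
  by move=> s; exact: radial_op_ge0 Dv.
- by move=> v w Dv Dw vw s; exact: radial_op_mono Dv Dw vw.
have DM : decreasing_in M (cst M) by split => [//|s]; rewrite /= M0 lexx.
move=> s; have [s1|s1] := leP (Num.max 0 s) 1; last first.
  by rewrite /radial_op set_itv_ge ?bnd_simp -?ltNge// Rintegral_set0.
apply: le_trans (slope_integral_le DM s1 (lexx 1)) _.
apply: le_trans KM; rewrite -mulrA ler_piMr ?powR_ge0//.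
have : 0 <= Num.max 0 s by rewrite le_max lexx.
lra.
Qed.

(** The infimum of supersolutions is only monotone a priori, but a fixed point is the integral of a
    slope bounded by [C], hence Lipschitz. *)
Lemma fixpoint_continuous u : decreasing_in M u -> (forall s, radial_op u s = u s) ->
  continuous u.
Proof.
move=> Du uE; set C := (l * F M / N%:R) `^ alpha / 2.
have C0 : 0 <= C by rewrite divr_ge0// powR_ge0.
have lip s t : s <= t -> u s - u t <= C * (t - s).
  move=> st; rewrite -!uE /radial_op.
  set a := Num.max 0 s; set b := Num.max 0 t.
  have ab : a <= b by rewrite /a /b ge_max !le_max lexx st orbT.
  have a0 : 0 <= a by rewrite le_max lexx.
  have sa : s <= a by rewrite le_max lexx orbT.
  have ba : b - a <= t - s by rewrite lerBlDr ge_max; apply/andP; split; lra.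
  have [b1|b1] := leP b 1.
    have := @Rintegral_itvB R (slope u) (BLeft a) (BRight 1) b.
    rewrite !bnd_simp => /(_ (slope_integrable a Du) ab b1).
    rewrite Rintegral_itv_obnd_cbnd; last first.
      apply: integrableS (slope_integrable b Du) => //.
      by apply: subset_itvr; rewrite bnd_simp.
    move=> <-; rewrite opprB addrCA subrr addr0.
    by rewrite (le_trans (slope_integral_le Du ab b1))// ler_wpM2l.
  have out c : 1 < c -> \int[lam]_(t in `[c, 1]) slope u t = 0.
    by move=> c1; rewrite set_itv_ge ?bnd_simp -?ltNge// Rintegral_set0.
  rewrite (out b b1) subr0.
  have [a1|a1] := leP a 1; last first.
    by rewrite (out a a1) mulr_ge0// subr_ge0.
  rewrite (le_trans (slope_integral_le Du a1 (lexx 1)))// ler_wpM2l//.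
  by rewrite (le_trans _ ba)// lerB// ltW.
move=> x; apply/cvgrPdist_le => e e0; near=> y.
have xy : `|x - y| <= e / (C + 1).
  near: y; apply: cvgr_dist_le; first exact: cvg_id.
  by rewrite divr_gt0// ltr_wpDl.
have -> : e = (C + 1) * (e / (C + 1)) by rewrite mulrC divfK// gt_eqF// ltr_wpDl.
have [ud _] := Du.
apply: (@le_trans _ _ (C * `|x - y|)).
  have [/ltW yx|xy'] := ltP y x.
    by rewrite distrC !ger0_norm ?subr_ge0 ?ud// lip.
  by rewrite [X in _ * X]distrC !ger0_norm ?subr_ge0 ?ud// lip.
by rewrite ler_pM// lerDl.
Unshelve. all: by end_near. Qed.

End radial_fixpoint.

(** * Regularity of the radial fixed point *)

Section radial_regularity.
Context {R : realType}.
Local Notation lam := (@lebesgue_measure R).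

Lemma continuous_normr_powR (a : R) : 0 < a -> continuous (fun y : R => `|y| `^ a).
Proof.
move=> a0 x; have [->|x0] := eqVneq x 0.
  apply/cvgrPdist_le => e e0; rewrite normr0 powR0 ?gt_eqF//.
  have ea : 0 < e `^ a^-1 by exact: powR_gt0.
  near=> y; rewrite sub0r normrN ger0_norm ?powR_ge0//.
  have -> : e = (e `^ a^-1) `^ a by rewrite -powRrM mulVf ?gt_eqF// powRr1// ltW.
 
  have ye : `|y| < e `^ a^-1.
    by near: y; exists (e `^ a^-1) => //= y /=; rewrite sub0r normrN.
  by apply: ge0_ler_powR; rewrite ?nnegrE ?(ltW a0) ?(ltW ea) ?(ltW ye).
apply: (@continuous_comp _ _ _ (fun y : R => `|y|) (fun z => z `^ a)).
  exact: norm_continuous.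
apply: differentiable_continuous; apply/derivable1_diffP.
by apply: derivable_powR; rewrite in_itv/= normr_gt0 x0.
Unshelve. all: by end_near. Qed.

Lemma continuous_powR (a : R) (g : R -> R) : 0 < a -> (forall x, 0 <= g x) ->
  continuous g -> continuous (fun x => g x `^ a).
Proof.
move=> a0 g0 cg; rewrite (_ : (fun x => _) = fun x => `|g x| `^ a); last first.
  by apply/funext => x; rewrite ger0_norm.
move=> x; apply: (@continuous_comp _ _ _ g (fun z => `|z| `^ a)); first exact: cg.
exact: continuous_normr_powR.
Qed.

Context (N : nat) (l alpha M : R) (F u : R -> R).
Context (N0 : (0 < N)%N) (l0 : 0 <= l) (alpha1 : 1 < alpha) (M0 : 0 <= M).
Context (F0 : forall s, 0 <= F s) (Fnd : forall s t, s <= t -> F s <= F t).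
Context (cF : continuous F).
Context (Du : decreasing_in M u) (uE : forall s, radial_op N l alpha F u s = u s).

Definition source (t : R) : R := l * F (u (t ^+ 2)).

(* With [s = |x|^2], the field [mean_source (|x|^2) x] has divergence
   [source |x|]; the value at 0 is its limit. *)
Definition mean_source (s : R) : R :=
  if 0 < s then flux N l F u (Num.sqrt s) / Num.sqrt s ^+ N else source 0 / N%:R.

Lemma continuous_source : continuous source.
Proof.
have cu : continuous u := fixpoint_continuous N0 l0 alpha1 F0 Fnd Du uE.
have cc : continuous (fun t : R => F (u (t ^+ 2))).
  move=> t; apply: (@continuous_comp _ _ _ (fun t : R => u (t ^+ 2)) F); last exact: cF.
  by apply: (@continuous_comp _ _ _ (fun t : R => t ^+ 2) u); [exact: exprn_continuous|exact: cu].
by move=> t; have := cvgM (cvg_cst l) (cc t); exact.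
Qed.

Lemma continuous_flux_density : continuous (flux_density N l F u).
Proof.
move=> t; have := cvgM (@exprn_continuous R N.-1 t) (@continuous_source t); exact.
Qed.

(** Replaces an integral from 0 by a primitive on the whole line, to which the rules of
    differentiation apply. *)
Lemma flux_primitive : exists P : R -> R,
  (forall r, is_derive r (1 : R) P (flux_density N l F u r)) /\
  forall r, 0 <= r -> flux N l F u r = P r - P 0.
Proof.
have [P dP] := primitive_exists continuous_flux_density.
exists P; split => // r; rewrite le_eqVlt => /predU1P[<-|r0].
  by rewrite /flux set_itv1 Rintegral_set1 subrr.
have cP : continuous P by apply: derivable_continuous => x; have [] := dP x.
rewrite /flux /Rintegral (@continuous_FTC2 _ _ P)//.
- exact: (continuous_subspaceT continuous_flux_density).
- split.
  + by move=> x _; have [] := dP x.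
  + by apply: cvg_at_right_filter; exact: cP.
  + by apply: cvg_at_left_filter; exact: cP.
- by move=> x _; rewrite derive1E; have [_ ->] := dP x.
Qed.

(** The formula is the divergence identity [2 s H'(s) + N H(s) = source (sqrt s)], for
    [H = mean_source], solved for [H'(s)]. *)
Lemma is_derive_mean_source (s : R) : 0 < s ->
  is_derive s (1 : R) mean_source
    ((source (Num.sqrt s) - N%:R * mean_source s) / (2 * s)).
Proof.
move=> s0; have [P [dP fluxE]] := flux_primitive.
set r := Num.sqrt s; have r0 : 0 < r by rewrite sqrtr_gt0.
have rn0 : r != 0 by rewrite gt_eqF.
have rN0 : r ^+ N != 0 by rewrite expf_neq0.
have d1 : is_derive r (1 : R) (fun y => P y - P 0) (flux_density N l F u r).
  by apply: (is_derive_eq (is_deriveB (dP r) (is_derive_cst (P 0) r 1))); rewrite subr0.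
have d2 : is_derive r (1 : R) (fun y : R => (y ^+ N)^-1)
    (- (r ^+ N) ^- 2 * (N%:R * r ^+ N.-1)).
  have [dd dE] := is_derive_pow N r.
  by apply: DeriveDef; [exact: derivableV|rewrite deriveV// dE].
have d3 := is_deriveM d1 d2.
have d4 := is_derive1_comp d3 (is_derive1_sqrt s0).
apply: (near_eq_is_derive (f := fun y : R => ((P (Num.sqrt y) - P 0) * (Num.sqrt y ^+ N)^-1 : R))).
  near=> y; have y0 : 0 < y by near: y; exact: open_nbhs_nbhs (conj (@open_gt R 0) s0).
  by rewrite /mean_source y0 fluxE ?sqrtr_ge0.
apply: (is_derive_eq d4).
rewrite /mean_source s0 -/r fluxE ?(ltW r0)//.
have sE : s = r ^+ 2 by rewrite sqr_sqrtr// ltW.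
rewrite -[X in X * _ = _]/((P r - P 0) * (- (r ^+ N) ^- 2 * (N%:R * r ^+ N.-1)) +
   (r ^+ N)^-1 * (flux_density N l F u r)).
rewrite /flux_density -/(source r) {1}sE.
case: N N0 rN0 => // m _ rN0 /=.
rewrite !exprS; rewrite exprS in rN0.
have rm0 : r ^+ m != 0 by move: rN0; rewrite mulf_eq0 (negbTE rn0).
by rewrite expr0; field; rewrite rn0 rm0.
Unshelve. all: by end_near. Qed.

Lemma mean_source_ge0 s : 0 <= mean_source s.
Proof.
rewrite /mean_source; case: ifPn => _.
  by case/andP: (slope_base_itv N0 l0 F0 Fnd s Du).
by rewrite divr_ge0// mulr_ge0.
Qed.

Lemma continuous_mean_source : continuous mean_source.
Proof.
move=> s; have [s0|s0|->] := ltgtP s 0.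
- apply/cvgrPdist_le => e e0; near=> t.
  have t0 : t < 0 by near: t; exact: lt_nbhsl.
  by rewrite /mean_source ltNge (ltW s0) ltNge (ltW t0)/= subrr normr0 ltW.
- have [dd _] := is_derive_mean_source s0.
  by apply: differentiable_continuous; exact/derivable1_diffP.
- apply/cvgrPdist_le => e e0.
  have N1 : 0 < N%:R :> R by rewrite ltr0n.
  have [P [dP fluxE]] := flux_primitive.
  have /cvgrPdist_le/(_ e e0)/nbhs_ballP[d /= d0 dS] := @continuous_source 0.
  near=> t; rewrite {1}/mean_source ltxx /mean_source.
  case: ifPn => [t0|_]; last by rewrite subrr normr0 ltW.
  set r := Num.sqrt t; have r0 : 0 < r by rewrite sqrtr_gt0.
  have rd : r < d.
    rewrite -(@ltr_pXn2r _ 2)// ?nnegrE ?(ltW r0) ?(ltW d0)// sqr_sqrtr ?(ltW t0)//.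
    by near: t; apply: lt_nbhsl; rewrite exprn_gt0.
  (* Compare [P] with the flux of the constant source [source 0]. The difference has derivative
     [(source y - source 0) y^(N-1)], at most [e r^(N-1)] on [[0, r]], so the mean value theorem
     bounds it by [e r^N]. *)
  pose g0N := source 0 / N%:R.
  have dD y : is_derive y (1 : R) (fun y : R => P y - g0N * y ^+ N)
      (flux_density N l F u y - source 0 * y ^+ N.-1).
    apply: (is_derive_eq (is_deriveB (dP y) (is_deriveZ g0N (is_derive_pow N y)))).
    by rewrite -[_ *: _]/(g0N * _) mulrA divfK// gt_eqF.
  have DC : (forall y, 0 <= y <= r ->
      `|flux_density N l F u y - source 0 * y ^+ N.-1| <= e * r ^+ N.-1) ->
      `|P r - g0N * r ^+ N - P 0| <= e * r ^+ N.
    move=> h; have := derive_bounded_le (ltW r0) dD h.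
    rewrite expr0n gtn_eqF// mulr0 !subr0 => /le_trans; apply.
    by rewrite -mulrA -exprSr prednK.
  rewrite fluxE ?(ltW r0)//.
  have -> : source 0 / N%:R - (P r - P 0) / r ^+ N =
      - ((P r - g0N * r ^+ N - P 0) / r ^+ N).
    by rewrite /g0N; field; rewrite !gt_eqF// exprn_gt0.
  rewrite normrN normrM normfV (ger0_norm (exprn_ge0 _ (ltW r0))).
  rewrite ler_pdivrMr ?exprn_gt0//; apply: DC => y /andP[y0 yr].
  have -> : flux_density N l F u y - source 0 * y ^+ N.-1 =
      (source y - source 0) * y ^+ N.-1 by rewrite /flux_density -/(source y); ring.
  rewrite normrM; apply: ler_pM => //.
    rewrite distrC; apply: dS; rewrite /ball/= sub0r normrN ger0_norm//.
    exact: le_lt_trans rd.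
  by rewrite normrX (ger0_norm y0) lerXn2r// nnegrE ltW.
Unshelve. all: by end_near. Qed.

End radial_regularity.

(** * The fixed point as a weak solution *)

Section radial_weak_solution.
Context {R : realType}.
Local Notation lam := (@lebesgue_measure R).

Context (N : nat) (l p M : R) (f u : R -> R).
Context (N0 : (0 < N)%N) (l0 : 0 <= l) (p1 : 1 < p) (p2 : p < 2) (M0 : 0 <= M).
Local Notation alpha := ((p - 1)^-1).
Local Notation F := (fun s : R => f (Num.max 0 s)).
Context (F0 : forall s, 0 <= F s) (Fnd : forall s t, s <= t -> F s <= F t).
Context (cF : continuous F).
Context (Du : decreasing_in M u) (uE : forall s, radial_op N l alpha F u s = u s).

Local Notation mu := (@lebesgue_rV R N).
Local Notation B := (@unit_ball R N).
Local Notation H := (mean_source N l F u).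
Local Notation g := (source l F u).

Let alpha1 : 1 < alpha.
Proof. by rewrite invf_gt1 ?subr_gt0// ltrBlDr. Qed.

Let alpha0 : 0 < alpha.
Proof. exact: lt_trans alpha1. Qed.

Let cH : continuous H.
Proof. exact: (continuous_mean_source N0 l0 alpha1 F0 Fnd cF Du uE). Qed.

Let H0 s : 0 <= H s.
Proof. exact: (mean_source_ge0 N0 l0 F0 Fnd Du). Qed.

Let cg : continuous g.
Proof. exact: (continuous_source N0 l0 alpha1 F0 Fnd cF Du uE). Qed.

(** Minus [slope], written with the continuous [mean_source] so that no quotient is left at 0. As
    [alpha > 1], the power of [Num.sqrt s] makes it vanish there. *)
Definition radial_slope (s : R) : R := - (H s `^ alpha * Num.sqrt s `^ (alpha - 1) / 2).

Lemma continuous_radial_slope : continuous radial_slope.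
Proof.
have c1 : continuous (fun s : R => H s `^ alpha) by exact: continuous_powR.
have c2 : continuous (fun s : R => Num.sqrt s `^ (alpha - 1)).
  apply: continuous_powR; first by rewrite subr_gt0.
    by move=> x; exact: sqrtr_ge0.
  exact: sqrt_continuous.
by move=> s; have := cvgN (cvgM (cvgM (c1 s) (c2 s)) (cvg_cst (2^-1 : R))); exact.
Qed.

Lemma radial_slopeE s : 0 <= s -> radial_slope s = - slope N l alpha F u s.
Proof.
rewrite le_eqVlt => /predU1P[<-|s0]; last by rewrite /radial_slope /slope /mean_source s0.
have a1 : alpha - 1 != 0 by rewrite gt_eqF// subr_gt0.
by rewrite /radial_slope /slope sqrtr0 powR0// !mulr0.
Qed.

(** The fixed point [u] is 0 for [s >= 1], so its derivative may jump at 1. [U] has the same values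
    on [[0, 1]] and is C^1 on the whole line. *)
Lemma radial_profile : exists U : R -> R,
  (forall s, is_derive s (1 : R) U (radial_slope s)) /\
  (forall s, 0 <= s <= 1 -> U s = u s) /\ U 1 = 0.
Proof.
have cq := continuous_radial_slope.
have [Q dQ] := primitive_exists cq.
pose U s := Q s - Q 1.
have dU s : is_derive s (1 : R) U (radial_slope s).
  by apply: (is_derive_eq (is_deriveB (dQ s) (is_derive_cst (Q 1) s 1))); rewrite subr0.
have cU : continuous U by apply: derivable_continuous => x; have [] := dU x.
have U1 : U 1 = 0 by rewrite /U subrr.
exists U; split => //; split => // s /andP[s0].
rewrite -uE /radial_op (max_idPr s0) le_eqVlt => /predU1P[->|s1].
  by rewrite set_itv1 Rintegral_set1.
have E : \int[lam]_(t in `[s, 1]) radial_slope t = - U s.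
  rewrite /Rintegral (@continuous_FTC2 _ _ U)//.
  - by rewrite U1 sub0e.
  - exact: continuous_subspaceT.
  - split.
    + by move=> x _; have [] := dU x.
    + by apply: cvg_at_right_filter; exact: cU.
    + by apply: cvg_at_left_filter; exact: cU.
  - by move=> x _; rewrite derive1E; have [_ ->] := dU x.
rewrite -[LHS]opprK -E -[LHS]mulN1r -RintegralZl//; last first.
  exact: continuous_segment_integrable.
apply: eq_Rintegral => t; rewrite inE/= in_itv/= => /andP[st _].
by rewrite radial_slopeE ?(le_trans s0)// mulrN mulN1r opprK.
Qed.

(** The derivative [H + 2 x_i^2 H'] of [H (dot x x) * x_i], with [H'] taken from
    [is_derive_mean_source]. At the origin the division by 0 removes the second term and leaves the
    correct value [H 0]. *)
Definition flux_div (i : 'I_N) (x : 'rV[R]_N) : R :=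
  H (dot x x) + x ord0 i ^+ 2 / dot x x * (g (Num.sqrt (dot x x)) - N%:R * H (dot x x)).

Lemma is_derive_flux_field (i : 'I_N) (x : 'rV[R]_N) :
  is_derive x (delta_mx ord0 i) (fun y : 'rV[R]_N => H (dot y y) * y ord0 i) (flux_div i x).
Proof.
have [x0|x0] := eqVneq (dot x x) 0.
  rewrite /flux_div x0 invr0 mulr0 mul0r addr0; apply: is_derive_line.
  rewrite (dot_eq0 x0).
  (* Along the axis through the origin the field is [H (t ^+ 2) * t], whose difference quotient at 0
     is [H (h ^+ 2)]. *)
  have E (t : R) : H (dot (t *: delta_mx ord0 i + 0) (t *: delta_mx ord0 i + 0 : 'rV[R]_N)) *
      (t *: delta_mx ord0 i + 0 : 'rV[R]_N) ord0 i = H (t ^+ 2) * t.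
    have -> : dot (t *: delta_mx ord0 i + 0) (t *: delta_mx ord0 i + 0 : 'rV[R]_N) = t ^+ 2.
      rewrite /dot (bigD1 i)//= big1 => [|j ji].
        by rewrite !mxE !eqxx/= mulr1 !addr0.
      by rewrite !mxE eqxx/= (negbTE ji) mulr0 !addr0 mul0r.
    by rewrite !mxE !eqxx mulr1 addr0.
  under eq_fun do rewrite E.
  have cv : (fun h : R => h^-1 *: (((fun t : R => H (t ^+ 2) * t) \o shift 0) (h *: 1) -
      H (0 ^+ 2) * 0)) @ 0^' --> H 0.
    apply: (@cvg_trans _ ((fun h : R => H (h ^+ 2)) @ 0^')).
      apply: near_eq_cvg; near=> h.
      have h0 : h != 0 by near: h; exact: nbhs_dnbhs_neq.
      rewrite /= addr0 mulr0 subr0 [_%:A]mulr1 -[_ *: _]/(h^-1 * _).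
      by rewrite mulrCA mulVf// mulr1.
    apply: cvg_trans (_ : (fun h : R => H (h ^+ 2)) @ 0 --> H 0).
      by apply: cvg_app; exact: nbhs_dnbhs.
    have -> : H 0 = H ((0 : R) ^+ 2) by rewrite expr0n.
    by apply: (@continuous_comp _ _ _ (fun t : R => t ^+ 2) H); [exact: exprn_continuous|exact: cH].
  by apply: DeriveDef; [apply/cvg_ex; exists (H 0)|exact: cvg_lim].
have xp : 0 < dot x x by rewrite lt_neqAle eq_sym x0 dot_ge0.
have d1 := partial_radial i (is_derive_mean_source N0 l0 alpha1 F0 Fnd cF Du uE xp).
apply: (is_derive_eq (is_deriveM d1 (is_derive_coord i i x))).
rewrite eqxx /flux_div.
rewrite -[X in X + _ = _]/(H (dot x x) * 1).
rewrite -[X in _ + X = _]/(x ord0 i * ((g (Num.sqrt (dot x x)) - N%:R * H (dot x x)) /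
  (2 * dot x x) * (2 * x ord0 i))).
by field.
Unshelve. all: by end_near. Qed.

(** At the origin the factor [x_i^2 / |x|^2] has no limit but is at most 1, while the other factor
    tends to [source 0 - N * H 0 = 0]. *)
Lemma continuous_flux_div (i : 'I_N) : continuous (flux_div i).
Proof.
pose E (x : 'rV[R]_N) := g (Num.sqrt (dot x x)) - N%:R * H (dot x x).
have cHd : continuous (fun x : 'rV[R]_N => H (dot x x)).
  by move=> x; apply: (@continuous_comp _ _ _ (fun y : 'rV[R]_N => dot y y) H);
    [exact: continuous_dot|exact: cH].
have cE : continuous E.
  have cgd : continuous (fun x : 'rV[R]_N => g (Num.sqrt (dot x x))).
    move=> x; apply: (@continuous_comp _ _ _ (@eucl_norm R N) g); last exact: cg.
    exact: continuous_eucl_norm.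
  by move=> x; have := cvgB (cgd x) (cvgM (cvg_cst (N%:R : R)) (cHd x)); exact.
have N1 : N%:R != 0 :> R by rewrite pnatr_eq0 -lt0n.
move=> x; have [x0|x0] := eqVneq (dot x x) 0; last first.
  have cx := @coord_continuous R 1 N ord0 i x.
  have := cvgD (cHd x) (cvgM (cvgM (cvgM cx cx) (cvgV x0 (@continuous_dot R N x))) (cE x)).
  exact.
have Wcv : (fun y : 'rV[R]_N => y ord0 i ^+ 2 / dot y y * E y) @ x --> (0 : R).
  have Ex : E x = 0.
    by rewrite /E x0 sqrtr0 /mean_source ltxx mulrC divfK// subrr.
  have FF := nbhs_filter x.
  apply/cvgrPdist_le => e e0.
  have /cvgrPdist_le/(_ e e0) := cE x; rewrite Ex; apply: filterS => y.
  rewrite !sub0r !normrN => Ey; rewrite normrM (le_trans _ Ey)//.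
  rewrite ler_piMl// ger0_norm ?divr_ge0 ?sqr_ge0 ?dot_ge0//.
  have [->|y0] := eqVneq (dot y y) 0; first by rewrite invr0 mulr0.
  rewrite ler_pdivrMr ?mul1r ?lt_neqAle ?(eq_sym 0) ?y0 ?dot_ge0//.
  rewrite /dot (bigD1 i)//= expr2 lerDl.
  by apply: sumr_ge0 => j _; rewrite -expr2 sqr_ge0.
have := cvgD (cHd x) Wcv; rewrite /continuous_at /flux_div x0 invr0 mulr0 mul0r; exact.
Qed.

Lemma sum_flux_div (x : 'rV[R]_N) : \sum_i flux_div i x = g (Num.sqrt (dot x x)).
Proof.
have N1 : N%:R != 0 :> R by rewrite pnatr_eq0 -lt0n.
rewrite big_split/= sumr_const card_ord -(mulr_natl (H _)) -!mulr_suml.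
have -> : \sum_(i < N) x ord0 i ^+ 2 = dot x x by apply: eq_bigr => i _; rewrite expr2.
have [x0|x0] := eqVneq (dot x x) 0; last by rewrite divff// mul1r [LHS]addrC subrK.
by rewrite x0 invr0 mulr0 mul0r addr0 sqrtr0 /mean_source ltxx mulrC divfK.
Qed.

(** Write [G = - c x] with [c = H^alpha r^(alpha-1)], so that [|G| = (H r)^alpha]. As
    [alpha (p - 1) = 1], the factor [|G|^(p-2) c] collapses to [H]. The cases [s = 0] and [H s = 0]
    are separate because [p - 2] is negative and powers of 0 do not obey the addition of
    exponents. *)
Lemma plaplace_flux (x : 'rV[R]_N) (y : 'rV[R]_N) :
  let G := (2 * radial_slope (dot x x)) *: x in
  eucl_norm G `^ (p - 2) * dot G y = - (H (dot x x) * dot x y).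
Proof.
move=> G; set s := dot x x; set r := Num.sqrt s.
have r0 : 0 <= r by exact: sqrtr_ge0.
pose c := H s `^ alpha * r `^ (alpha - 1).
have c0 : 0 <= c by rewrite mulr_ge0 ?powR_ge0.
have GE : G = - c *: x.
  by rewrite /G /radial_slope -/s -/r -/c; congr (_ *: _); field.
have dotZl (a : R) (v w : 'rV[R]_N) : dot (a *: v) w = a * dot v w.
  by rewrite dotC dotZr dotC.
have nG : eucl_norm G = c * r.
  rewrite /eucl_norm GE dotZl dotZr mulrA mulrNN sqrtrM; last exact: (mulr_ge0 c0 c0).
  by rewrite -expr2 sqrtr_sqr ger0_norm.
have [s0|s0] := eqVneq s 0.
  have d0 : dot x y = 0.
    by rewrite (dot_eq0 s0) /dot big1// => i _; rewrite mxE mul0r.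
  by rewrite GE dotZl d0 !mulr0 oppr0.
have rp : 0 < r by rewrite sqrtr_gt0 lt_neqAle eq_sym s0 dot_ge0.
rewrite nG GE dotZl mulrA mulrN mulNr; congr (- (_ * _)).
have [h0|h0] := eqVneq (H s) 0.
  by rewrite /c h0 powR0 ?gt_eqF// !mul0r mulr0.
have pa : alpha * (p - 2) + alpha = 1.
  by field; rewrite subr_eq0 gt_eqF.
have -> : c * r = H s `^ alpha * r `^ alpha.
  have rE : r `^ (alpha - 1) * r = r `^ alpha.
    by rewrite mulrC; exact: (mulr_powRB1 r0 alpha0).
  by rewrite -rE mulrA.
rewrite powRM ?powR_ge0// -!powRrM /c mulrACA -!powRD; last 2 first.
- by rewrite (gt_eqF rp) implybT.
- by rewrite h0 implybT.
by rewrite addrA pa subrr powRr0 powRr1// mulr1.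
Qed.

Lemma regular_solution_of_fixpoint : exists v : 'rV[R]_N -> R,
  regular_solution f p l v /\ forall x, B x -> 0 <= v x <= M.
Proof.
have [U [dU [UE U1]]] := radial_profile.
have cU : continuous U by apply: derivable_continuous => x; have [] := dU x.
have [_ uM] := Du.
have Bdot (x : 'rV[R]_N) : B x -> 0 <= dot x x <= 1.
  by move=> /unit_ballE /ltW ->; rewrite dot_ge0.
pose v (x : 'rV[R]_N) := U (dot x x).
have vM x : B x -> 0 <= v x <= M by move=> /Bdot/UE; rewrite /v => ->.
have fv x : B x -> f (v x) = F (v x) by move=> /vM/andP[v0 _]; rewrite (max_idPr v0).
have cv : continuous v.
  move=> x; apply: (@continuous_comp _ _ _ (fun y : 'rV[R]_N => dot y y) U).
    exact: continuous_dot.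
  exact: cU.
have cFv : continuous (fun x => F (v x)).
  by move=> x; apply: (@continuous_comp _ _ _ v F); [exact: cv|exact: cF].
have cM (E1 E2 : 'rV[R]_N -> R) : continuous E1 -> continuous E2 ->
    continuous (fun x => E1 x * E2 x).
  by move=> c1 c2 x; have := cvgM (c1 x) (c2 x); exact.
have mB := @measurable_unit_ball R N.
have gv x : B x -> g (Num.sqrt (dot x x)) = l * f (v x).
  move=> Bx; rewrite /source sqr_sqrtr ?dot_ge0// fv// /v UE//.
  exact: Bdot.
exists v; split => //; split; first last.
  split.
    apply: (eq_measurable_fun (fun x => F (v x))).
      by move=> x; rewrite inE => /fv /= ->.
    by apply: measurable_funTS; exact: continuous_measurable_rV.
  rewrite /ball_norm unlock; case: ifPn => // mu0.
  apply: (@le_lt_trans _ _ (F M)%:E); last exact: ltry.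
  apply/ess_supP; apply: aeW => x /=; rewrite patchE lee_fin.
  case: ifPn => [|_]; last by rewrite normr0.
  rewrite inE => Bx; have /andP[_ vxM] := vM x Bx.
  by rewrite /= fv// ger0_norm ?F0// Fnd.
split; first by apply: aeW => x /vM/andP[].
exists (fun x => (2 * radial_slope (dot x x)) *: x).
  by apply: W01p_radial => //; [exact: ltW|exact: continuous_radial_slope].
move=> phi tphi; have cphi := test_function_continuous tphi.
have cphi' i := test_function_partial_continuous (i := i) tphi.
pose V (i : 'I_N) (x : 'rV[R]_N) := H (dot x x) * x ord0 i.
have cV i : continuous (V i).
  apply: cM; last exact: coord_continuous.
  move=> x; apply: (@continuous_comp _ _ _ (fun y : 'rV[R]_N => dot y y) H).
    exact: continuous_dot.
  exact: cH.
have cD := continuous_flux_div.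
split.
  have ci : continuous (fun x => l * F (v x) * phi x).
    exact: (cM _ _ (cM (fun=> l) _ (@cst_continuous _ _ l) cFv) cphi).
  apply: eq_integrable (continuous_ball_integrable ci) => // x.
  by rewrite inE => /fv /= ->.
(* The flux is now the explicit field [- V]. Each component is integrated by parts, and the
   resulting divergence sums to the source by [sum_flux_div]. *)
transitivity (- \int[mu]_(x in B) (\sum_i (V i x * partial i phi x))).
  rewrite -[RHS]mulN1r -RintegralZl//; last first.
    apply: (continuous_ball_integrable (F := fun x => \sum_i (V i x * partial i phi x))).
    elim: (index_enum _) => [|i s IH]; first by under eq_fun do rewrite big_nil; exact: cst_continuous.
    under eq_fun do rewrite big_cons.
    by move=> x; have := cvgD (cM _ _ (cV i) (cphi' i) x) (IH x); exact.
  apply: eq_Rintegral => x _; rewrite plaplace_flux mulN1r /dot mulr_sumr.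
  by congr (- _); apply: eq_bigr => i _; rewrite mxE mulrA.
rewrite Rintegral_sum_ball; last by move=> i; exact: (continuous_ball_integrable (cM _ _ (cV i) (cphi' i))).
rewrite -sumrN.
rewrite (eq_bigr (fun i => \int[mu]_(x in B) (flux_div i x * phi x))); last first.
  move=> i _; rewrite (Rintegral_by_parts (cV i) (cD i) (is_derive_flux_field i) tphi).
  by rewrite opprK.
rewrite -Rintegral_sum_ball; last by move=> i; exact: (continuous_ball_integrable (cM _ _ (cD i) cphi)).
apply: eq_Rintegral => x; rewrite inE => Bx.
by rewrite -mulr_suml sum_flux_div gv.
Qed.

End radial_weak_solution.

Lemma max0_lipschitz (R : realType) (x y : R) :
  `|Num.max 0 x - Num.max 0 y| <= `|x - y|.
Proof.
wlog xy : x y / x <= y.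
  by have [/ltW xy|yx] := ltP x y; [exact|rewrite distrC (distrC x); exact].
rewrite distrC (distrC x) [leRHS]ger0_norm ?subr_ge0//.
have [x0|x0] := leP 0 x.
  have y0 : 0 <= y by exact: le_trans xy.
  by rewrite (max_idPr y0) ger0_norm ?subr_ge0.
rewrite subr0; have [y0|y0] := leP 0 y; last by rewrite normr0 subr_ge0.
by rewrite ger0_norm// lerDl oppr_ge0 ltW.
Qed.

(** Near [a] the difference quotients of [f] are within 1 of [f' a], which gives a Lipschitz bound
    at [a]; [max 0] does not increase distances. *)
Lemma continuous_extension (R : realType) (f : R -> R) : C1_halfline f ->
  continuous (fun s : R => f (Num.max 0 s)).
Proof.
move=> [f' [_ df]] x; set a := Num.max 0 x.
have a0 : 0 <= a by rewrite le_max lexx.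
have /cvgrPdist_lt/(_ 1 ltr01)/nbhs_ballP[d /= d0 dP] := df a a0.
apply/cvgrPdist_le => e e0.
pose C := `|f' a| + 1; have C0 : 0 < C by rewrite ltr_wpDl.
near=> y; set z := Num.max 0 y; rewrite -/a.
have xy : `|x - y| < Num.min d (e / C).
  near: y; apply: cvgr_dist_lt; first exact: cvg_id.
  by rewrite lt_min d0 divr_gt0.
have az : `|a - z| < Num.min d (e / C) by exact: le_lt_trans (max0_lipschitz x y) xy.
move: az; rewrite lt_min => /andP[azd aze].
have [za|za] := eqVneq z a; first by rewrite za subrr normr0 ltW.
have z0 : z \in `[0, +oo[ by rewrite in_itv/= andbT le_max lexx.
have := dP z azd za z0 => /= quot.
have za0 : z - a != 0 by rewrite subr_eq0.
have -> : f a - f z = - ((f z - f a) / (z - a) * (z - a)) by rewrite divfK// opprB.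
rewrite normrN normrM.
have qC : `|(f z - f a) / (z - a)| <= C.
  rewrite -[X in `|X|](subrK (f' a)) (le_trans (ler_normD _ _))// addrC lerD2l.
  by rewrite distrC ltW.
rewrite (le_trans (ler_wpM2r (normr_ge0 _) qC))// mulrC -ler_pdivlMr//.
by rewrite distrC ltW.
Unshelve. all: by end_near. Qed.

Lemma radial_regular_solution (R : realType) (N : nat) (l p M : R) (f : R -> R) :
  (0 < N)%N -> 0 <= l -> 1 < p < 2 -> 0 <= M ->
  (forall s, 0 <= s -> 0 <= f s) ->
  (forall s t, 0 <= s -> s <= t -> f s <= f t) ->
  C1_halfline f -> (l * f M / N%:R) `^ (p - 1)^-1 <= M ->
  exists v : 'rV[R]_N -> R,
    regular_solution f p l v /\ forall x, unit_ball x -> 0 <= v x <= M.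
Proof.
move=> N0 l0 /andP[p1 p2] M0 f0 fnd fC1 KM.
have F0 (s : R) : 0 <= f (Num.max 0 s) by apply: f0; rewrite le_max lexx.
have Fnd (s t : R) : s <= t -> f (Num.max 0 s) <= f (Num.max 0 t).
  move=> st; apply: fnd; first by rewrite le_max lexx.
  by rewrite ge_max !le_max lexx st orbT.
have alpha1 : 1 < (p - 1)^-1 by rewrite invf_gt1 ?subr_gt0// ltrBlDr.
have KM' : (l * f (Num.max 0 M) / N%:R) `^ (p - 1)^-1 <= M by rewrite (max_idPr M0).
have [u [Du uE]] := @radial_fixpoint R N l (p - 1)^-1 M _ N0 l0 alpha1 M0 F0 Fnd KM'.
apply: (regular_solution_of_fixpoint N0 l0 p1 p2 F0 Fnd _ Du uE).
exact: continuous_extension.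
Qed.

(** * Picone's inequality *)

Section picone_profile.
Context {R : realType} (p : R) (p1 : 1 < p) (p32 : p * 2 <= 3).
Implicit Types (s w : R).

(* A smooth substitute on the whole line for [s |-> (1 + s) ^ (1 - p)]: the
   approximations of a nonnegative solution may take negative values. *)
Definition hyp s : R := (1 + s ^+ 2) `^ 2^-1.
Definition pic s : R := (s + hyp s) `^ (1 - p).

Lemma hyp_gt0 s : 0 < hyp s.
Proof. by rewrite powR_gt0// ltr_wpDr// sqr_ge0. Qed.

Lemma hyp_sqr s : hyp s ^+ 2 = 1 + s ^+ 2.
Proof.
have h0 : 0 <= 1 + s ^+ 2 by rewrite addr_ge0 ?sqr_ge0.
by rewrite /hyp powR12_sqrt// sqr_sqrtr.
Qed.

Lemma normr_lt_hyp s : `|s| < hyp s.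
Proof.
rewrite -(@ltr_pXn2r _ 2)// ?nnegrE ?(ltW (hyp_gt0 _))// hyp_sqr.
by rewrite real_normK ?num_real// ltrDr.
Qed.

Lemma hyp_ge1 s : 1 <= hyp s.
Proof.
rewrite -(@ler_pXn2r _ 2)// ?nnegrE ?(ltW (hyp_gt0 _))// hyp_sqr expr1n.
by rewrite lerDl sqr_ge0.
Qed.

Lemma hyp_le s : hyp s <= 1 + `|s|.
Proof.
rewrite -(@ler_pXn2r _ 2)// ?nnegrE ?(ltW (hyp_gt0 _))// hyp_sqr sqrrD.
rewrite expr1n real_normK ?num_real// mul1r.
by rewrite -addrA lerD2l lerDr mulrn_wge0.
Qed.

Lemma pic_base_gt0 s : 0 < s + hyp s.
Proof.
have := normr_lt_hyp s; rewrite ltr_norml => /andP[+ _].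
by rewrite ltrNl -subr_gt0 opprK addrC.
Qed.

Lemma pic_gt0 s : 0 < pic s.
Proof. by rewrite powR_gt0// pic_base_gt0. Qed.

Lemma pic_baseV s : (s + hyp s)^-1 = hyp s - s.
Proof.
apply: (mulfI (lt0r_neq0 (pic_base_gt0 s))).
rewrite divff ?gt_eqF ?pic_base_gt0//.
have -> : (s + hyp s) * (hyp s - s) = hyp s ^+ 2 - s ^+ 2 by ring.
by rewrite hyp_sqr addrK.
Qed.

Lemma Ck_hyp k : Ck k hyp.
Proof.
apply: Ck_powR; first by move=> s; rewrite ltr_wpDr// sqr_ge0.
apply: CkD; first exact: Ck_cst.
by apply: CkM; exact: Ck_id.
Qed.

Lemma Ck_pic k : Ck k pic.
Proof.
apply: Ck_powR; first exact: pic_base_gt0.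
by apply: CkD; [exact: Ck_id|exact: Ck_hyp].
Qed.

(** The base [s + hyp s] is [exp(arsinh s)], with logarithmic derivative [1 / hyp s]; this keeps the
    derivative as simple as that of a power of [1 + s]. *)
Definition dpic s : R := - ((p - 1) * pic s / hyp s).

Lemma is_derive_hyp s : is_derive s (1 : R) hyp (s / hyp s).
Proof.
have q0 : 0 < 1 + s ^+ 2 by rewrite ltr_wpDr// sqr_ge0.
have d1 : is_derive s (1 : R) (fun s : R => 1 + s ^+ 2) (2 * s).
  apply: (is_derive_eq (is_deriveD (is_derive_cst (1 : R) s 1) (is_derive_pow 2 s))).
  by rewrite add0r expr1.
have d3 : is_derive s (1 : R) hyp (2^-1 * (1 + s ^+ 2) `^ (2^-1 - 1) * (2 * s)).
  have dq := is_derive1_powR 2^-1 q0.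
  exact: (@is_derive1_comp _ (fun y : R => y `^ 2^-1) (fun s : R => 1 + s ^+ 2)).
apply: (is_derive_eq d3).
have -> : (1 + s ^+ 2) `^ (2^-1 - 1) = (hyp s)^-1.
  by rewrite /hyp -powRN; congr (_ `^ _); field.
by field; rewrite gt_eqF// hyp_gt0.
Qed.

Lemma is_derive_pic s : is_derive s (1 : R) pic (dpic s).
Proof.
have b0 := pic_base_gt0 s.
have d1 := is_deriveD (is_derive_id s (1 : R)) (is_derive_hyp s).
have d2 : is_derive s (1 : R) pic ((1 - p) * (s + hyp s) `^ (1 - p - 1) * (1 + s / hyp s)).
  have dq := is_derive1_powR (1 - p) b0.
  exact: (@is_derive1_comp _ (fun y : R => y `^ (1 - p)) (fun s : R => s + hyp s)).
apply: (is_derive_eq d2).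
have -> : (s + hyp s) `^ (1 - p - 1) = pic s / (s + hyp s).
  have bn0 : s + hyp s != 0 by rewrite gt_eqF.
  rewrite (@powRB _ _ (1 - p) 1) ?bn0 ?implybT// [_ `^ 1]powRr1//; exact: ltW.
rewrite /dpic; field; rewrite !gt_eqF ?hyp_gt0//.
Qed.

(** Since [pic s = (hyp s - s)^(p-1)] and [hyp s - s <= 2 * hyp s], one gets [pic s <= 2 * hyp s],
    and [p <= 3/2] gives [2 (p - 1) <= 1]. The resulting Lipschitz constant is uniform in [p]. *)
Lemma dpic_le1 s : `|dpic s| <= 1.
Proof.
have R1 := hyp_ge1 s; have R0 := hyp_gt0 s.
have t0 : 0 <= p - 1 by rewrite subr_ge0 ltW.
rewrite /dpic normrN ger0_norm ?divr_ge0 ?mulr_ge0 ?(ltW (pic_gt0 s)) ?(ltW R0)//.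
rewrite ler_pdivrMr// mul1r.
suff h : pic s <= 2 * hyp s.
  have h1 := ler_wpM2l t0 h.
  have p12 : (p - 1) * 2 <= 1 by move: p32; lra.
  have h2 := ler_wpM2r (ltW R0) p12.
  by rewrite (le_trans h1)// mulrA (le_trans h2)// mul1r.
have -> : pic s = (hyp s - s) `^ (p - 1).
  by rewrite -pic_baseV -powR_inv1 ?(ltW (pic_base_gt0 s))// -powRrM mulN1r opprB.
have hs0 : 0 <= hyp s - s by rewrite -pic_baseV invr_ge0 ltW// pic_base_gt0.
have hs2 : hyp s - s <= 2 * hyp s.
  have := normr_lt_hyp s; rewrite ltr_norml => /andP[]; lra.
apply: (@le_trans _ _ ((2 * hyp s) `^ (p - 1))).
  by apply: ge0_ler_powR; rewrite ?nnegrE// (le_trans hs0).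
by rewrite ler1_powR//; move: p1 p32 R1; lra.
Qed.

Lemma pic_lipschitz s w : `|pic s - pic w| <= `|s - w|.
Proof.
wlog ws : s w / w <= s.
  move=> h; have [ws|/ltW ws] := leP w s; first exact: h ws.
  rewrite [leLHS]distrC [leRHS]distrC; exact: h ws.
have := derive_bounded_le ws is_derive_pic (fun x _ => dpic_le1 x).
by rewrite mul1r [X in _ -> _ <= X]ger0_norm// subr_ge0.
Qed.

(** Origin of the weight [(1 + 2 s)^(1-p)] in the superlinear bound: [hyp w <= 1 + w], and the
    exponent is negative. *)
Lemma pic_ge w : 0 <= w -> (1 + 2 * w) `^ (1 - p) <= pic w.
Proof.
move=> w0; have le : w + hyp w <= 1 + 2 * w.
  by have := hyp_le w; rewrite ger0_norm//; lra.
have e x : x `^ (1 - p) = (x `^ (p - 1))^-1 by rewrite -powRN opprB.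
rewrite /pic !e lef_pV2 ?posrE ?powR_gt0 ?pic_base_gt0//; last first.
  by rewrite ltr_wpDr// mulr_ge0.
apply: ge0_ler_powR; rewrite ?nnegrE ?subr_ge0 ?(ltW p1)// ?(ltW (pic_base_gt0 w))//.
by rewrite addr_ge0// mulr_ge0.
Qed.

(** The product equals [(hyp s * (hyp s - s))^(p-1)], at most 1 for [s >= 0]. For [s < 0] one has
    [|s| <= |s - w|], so the excess is charged to the distance between approximation and solution;
    [2 (p - 1) <= 1] makes it linear in that distance. *)
Lemma pic_hyp_le s w : 0 <= w -> pic s * hyp s `^ (p - 1) <= 1 + 2 * `|s - w|.
Proof.
move=> w0.
have t0 : 0 <= p - 1 by rewrite subr_ge0 ltW.
have e : pic s * hyp s `^ (p - 1) = (hyp s * (hyp s - s)) `^ (p - 1).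
  rewrite powRM ?(ltW (hyp_gt0 s))//; last by rewrite -pic_baseV invr_ge0 ltW// pic_base_gt0.
  rewrite mulrC; congr (_ * _).
  by rewrite -pic_baseV -powR_inv1 ?(ltW (pic_base_gt0 s))// -powRrM mulN1r opprB.
rewrite e; have hs0 : 0 <= hyp s * (hyp s - s).
  by rewrite mulr_ge0 ?(ltW (hyp_gt0 s))// -pic_baseV invr_ge0 ltW// pic_base_gt0.
have [s0|s0] := leP 0 s.
  apply: (@le_trans _ _ 1); last by rewrite lerDl mulr_ge0.
  rewrite -[leRHS](_ : 1 `^ (p - 1) = 1); last by rewrite powR1.
  apply: ge0_ler_powR; rewrite ?nnegrE//.
  have -> : hyp s * (hyp s - s) = hyp s ^+ 2 - s * hyp s by ring.
  rewrite hyp_sqr -addrA gerDl subr_le0 expr2 ler_wpM2l//.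
  by apply: ltW; rewrite -[X in X < _](ger0_norm s0) normr_lt_hyp.
have sw : `|s| <= `|s - w| by rewrite (ltr0_norm s0) ltr0_norm ?subr_lt0 ?(lt_le_trans s0)//; lra.
apply: (@le_trans _ _ (1 + 2 * `|s|)); last by rewrite lerD2l ler_wpM2l.
have s1 : 1 <= 1 + 2 * `|s| by rewrite lerDl mulr_ge0.
apply: (@le_trans _ _ (((1 + 2 * `|s|) ^+ 2) `^ (p - 1))).
  apply: ge0_ler_powR; rewrite ?nnegrE ?sqr_ge0//.
  have hs := hyp_le s; rewrite expr2 ler_pM ?(ltW (hyp_gt0 s))//.
  - by rewrite -pic_baseV invr_ge0 ltW// pic_base_gt0.
  - by rewrite (le_trans hs)// lerD2l ler_peMl// ler1n.
  - by move: hs; rewrite (ltr0_norm s0); lra.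
rewrite -powR_mulrn ?(le_trans ler01)// -powRrM.
by rewrite ler1_powR//; move: p1 p32; lra.
Qed.

(** Young's inequality in the variable [u = Y / (2 L)]. This scaling makes the coefficient of [Y^p]
    exactly [p - 1], the one supplied by [dpic], and leaves a remainder whose factor [(2 L)^(p-1)]
    tends to 1 as [p] tends to 1. *)
Lemma young_powR (Y D L : R) : 0 <= Y -> 0 <= D <= L -> 0 < L ->
  2 * D * Y `^ (p - 1) <= (p - 1) * Y `^ p + 2 * D * (2 * L) `^ (p - 1).
Proof.
move=> Y0 /andP[D0 DL] L0; have t0 : 0 < p - 1 by rewrite subr_gt0.
have p0 : 0 < p by exact: lt_trans p1.
have L20 : 0 < 2 * L by rewrite mulr_gt0.
pose u := Y / (2 * L); have u0 : 0 <= u by rewrite divr_ge0// ltW.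
have YE : Y = u * (2 * L) by rewrite /u divfK// gt_eqF.
have yu : u `^ (p - 1) <= (p - 1) * u `^ p + 1.
  have := @conjugate_powR R (u `^ (p - 1)) 1 (p / (p - 1)) p (powR_ge0 _ _) ler01.
  rewrite divr_gt0// p0 => /(_ isT isT).
  have -> : (p / (p - 1))^-1 + p^-1 = 1 by field; rewrite !gt_eqF.
  move=> /(_ erefl); rewrite mulr1 -powRrM mulrCA divff ?gt_eqF// mulr1 powR1 mul1r.
  move=> /le_trans; apply.
  rewrite invf_div lerD//; last by rewrite invf_le1// ltW.
  rewrite mulrC ler_wpM2r ?powR_ge0// ler_pdivrMr// ler_peMr// ltW//.
have -> : Y `^ (p - 1) = u `^ (p - 1) * (2 * L) `^ (p - 1).
  by rewrite YE powRM// ltW.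
have -> : Y `^ p = u `^ p * ((2 * L) * (2 * L) `^ (p - 1)).
  by rewrite (mulr_powRB1 (ltW L20) p0) YE powRM// ltW.
set K := (2 * L) `^ (p - 1); have K0 : 0 <= K by exact: powR_ge0.
have up := powR_ge0 u p.
have h1 : 2 * D * (u `^ (p - 1) * K) <= 2 * D * (((p - 1) * u `^ p + 1) * K).
  by rewrite ler_wpM2l ?mulr_ge0// ler_wpM2r.
apply: (le_trans h1).
have h2 : D * ((p - 1) * u `^ p * K) <= L * ((p - 1) * u `^ p * K).
  by rewrite ler_wpM2r// mulr_ge0// mulr_ge0// ltW.
lra.
Qed.

(** The concave power lies below its tangent [(2 - p) z + (p - 1)] at [z = 1]; Young's inequality
    yields this form directly. *)
Lemma powR_tangent (z : R) : 0 <= z <= 1 -> z `^ (2 - p) <= z + (p - 1).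
Proof.
move=> /andP[z0 z1]; have t0 : 0 < p - 1 by rewrite subr_gt0.
have t1 : 0 < 2 - p by move: p32; lra.
have := @conjugate_powR R (z `^ (2 - p)) 1 (2 - p)^-1 (p - 1)^-1 (powR_ge0 _ _) ler01.
rewrite !invr_gt0 => /(_ t1 t0); rewrite !invrK.
have -> : 2 - p + (p - 1) = 1 by ring.
move=> /(_ erefl); rewrite mulr1 -powRrM divff ?gt_eqF// powRr1// powR1 mul1r.
move=> /le_trans; apply; rewrite lerD2r ler_piMr//; move: p1; lra.
Qed.

(* [y], [z], [D], [s], [w] stand for |grad w|, the cut-off, the norm of its
   gradient, an approximation of the solution, and the solution. *)
Lemma picone_pointwise (z D L y s w : R) : 0 <= z <= 1 -> 0 <= D <= L -> 0 < L ->
  0 <= y -> 0 <= w ->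
  2 * z * D * pic s * y `^ (p - 1) + z ^+ 2 * dpic s * y `^ p <=
  (1 + 2 * `|s - w|) * (2 * D * (z + (p - 1)) * (2 * L) `^ (p - 1)).
Proof.
move=> z01 DL L0 y0 w0; have /andP[z0 z1] := z01; have /andP[D0 _] := DL.
have t0 : 0 < p - 1 by rewrite subr_gt0.
have p0 : 0 < p by exact: lt_trans p1.
set K := (2 * L) `^ (p - 1); have K0 : 0 <= K by exact: powR_ge0.
have R0 := hyp_gt0 s.
pose x := y / hyp s; have x0 : 0 <= x by rewrite divr_ge0// ltW.
have yE : y = x * hyp s by rewrite /x divfK// gt_eqF.
pose A := x `^ (p - 1).
have y1 : y `^ (p - 1) = A * hyp s `^ (p - 1) by rewrite yE powRM// ltW.
have y2 : y `^ p = y * y `^ (p - 1) by rewrite mulr_powRB1.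
have -> : 2 * z * D * pic s * y `^ (p - 1) + z ^+ 2 * dpic s * y `^ p =
    pic s * hyp s `^ (p - 1) * (z * (2 * D * A - (p - 1) * z * x * A)).
  rewrite y2 y1 {1}yE /dpic; field; rewrite gt_eqF//.
have E0 : 0 <= 2 * D * (z + (p - 1)) * K.
  by rewrite !mulr_ge0// addr_ge0// ltW.
have m0 : 0 <= pic s * hyp s `^ (p - 1) by rewrite mulr_ge0 ?powR_ge0// ltW// pic_gt0.
suff main : z * (2 * D * A - (p - 1) * z * x * A) <= 2 * D * (z + (p - 1)) * K.
  apply: (le_trans (ler_wpM2l m0 main)); apply: ler_wpM2r => //.
  exact: pic_hyp_le.
have [->|zn0] := eqVneq z 0; first by rewrite mul0r !mulr_ge0// add0r ltW.
have zp : 0 < z by rewrite lt_neqAle eq_sym zn0.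
have Y0 : 0 <= z * x by rewrite mulr_ge0.
have Y1 : (z * x) `^ (p - 1) = z `^ (p - 1) * A by rewrite powRM.
have Y2 : (z * x) `^ p = z * x * (z `^ (p - 1) * A) by rewrite -Y1 mulr_powRB1.
have zz : z `^ (2 - p) * z `^ (p - 1) = z.
  rewrite -powRD ?zn0 ?implybT//.
  by have -> : 2 - p + (p - 1) = 1 by [ring|]; rewrite powRr1.
have := young_powR Y0 DL L0; rewrite Y1 Y2 -/K => yg.
have zt := powR_tangent z01; have zt0 := powR_ge0 z (2 - p).
(* Splitting [z = z^(2-p) z^(p-1)] leaves an expression in [Y = z * x] alone, to which [young_powR]
   applies; the outer factor [z^(2-p)] is handled by [powR_tangent]. *)
have -> : z * (2 * D * A - (p - 1) * z * x * A) =
    z `^ (2 - p) * (2 * D * (z `^ (p - 1) * A) - (p - 1) * (z * x * (z `^ (p - 1) * A))).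
  rewrite -{1}zz; ring.
apply: (@le_trans _ _ (z `^ (2 - p) * (2 * D * K))).
  by apply: ler_wpM2l => //; rewrite lerBlDl.
have -> : 2 * D * (z + (p - 1)) * K = (z + (p - 1)) * (2 * D * K) by ring.
by apply: ler_wpM2r => //; rewrite !mulr_ge0.
Qed.

End picone_profile.

(** * The integrated Picone inequality *)

Section picone_inequality.
Context {R : realType} {n : nat}.
Local Notation mu := (@lebesgue_rV R n).
Local Notation B := (@unit_ball R n).
Let mB := @measurable_unit_ball R n.

Lemma continuous_gradient_norm (phi : 'rV[R]_n -> R) : test_function phi ->
  continuous (fun x => eucl_norm (gradient phi x)).
Proof.
move=> tphi; have cd i := test_function_partial_continuous (i := i) tphi.
have cs : continuous (fun x => dot (gradient phi x) (gradient phi x)).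
  rewrite /dot; elim: (index_enum _) => [|i r IH].
    by under eq_fun do rewrite big_nil; exact: cst_continuous.
  under eq_fun do rewrite big_cons mxE.
  by move=> x; have := cvgD (cvgM (cd i x) (cd i x)) (IH x); exact.
move=> x; apply: (@continuous_comp _ _ _
  (fun x => dot (gradient phi x) (gradient phi x)) (@Num.sqrt R)); first exact: cs.
exact: sqrt_continuous.
Qed.

Context (p l K C L : R) (f : R -> R) (w zeta : 'rV[R]_n -> R).
Context (p1 : 1 < p) (p32 : p * 2 <= 3) (l0 : 0 <= l) (C0 : 0 <= C) (L0 : 0 < L).
Context (f0 : forall s, 0 <= s -> 0 <= f s).
Context (fK : forall s, 0 <= s -> K <= l * f s * (1 + 2 * s) `^ (1 - p)).
Context (w_sol : weak_solution f p l w).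
Context (fC : {ae mu, forall x, B x -> f (w x) <= C}).
Context (tz : test_function zeta) (z01 : forall x, 0 <= zeta x <= 1).
Context (zL : forall x, B x -> eucl_norm (gradient zeta x) <= L).

Let p0 : 0 < p. Proof. exact: lt_trans p1. Qed.
Let t0 : 0 < p - 1. Proof. by rewrite subr_gt0. Qed.

Let test phi (x : 'rV[R]_n) : R := zeta x * zeta x * pic p (phi x).

Lemma test_function_test phi : test_function phi -> test_function (test phi).
Proof.
move=> tphi; have [Cz _ zB] := tz.
apply: (test_function_closed (K := closure [set x | zeta x != 0])) => //.
- move=> k; apply: CnM; first by apply: CnM; exact: Cz.
  by apply: Cn_comp; [exact: Ck_pic|exact: test_function_Cn].
- exact: closed_closure.
- move=> x tx; apply: subset_closure => /=; apply: contraNN tx => /eqP zx.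
  by rewrite /test zx !mul0r.
Qed.

Lemma partial_test phi (i : 'I_n) x : test_function phi -> partial i (test phi) x =
  2 * zeta x * pic p (phi x) * partial i zeta x +
  zeta x ^+ 2 * dpic p (phi x) * partial i phi x.
Proof.
move=> tphi.
have dz := test_function_is_derive i x tz.
have dp := is_derive_comp_line (is_derive_pic p (phi x)) (test_function_is_derive i x tphi).
have d2 := is_deriveM (is_deriveM dz dz) dp.
rewrite (partialE d2).
rewrite -[LHS]/(zeta x * zeta x * (dpic p (phi x) * partial i phi x) +
  pic p (phi x) * (zeta x * partial i zeta x + zeta x * partial i zeta x)).
by ring.
Qed.

(** The right-hand side of [picone_pointwise] without its error factor. As [p] tends to 1 it tends
    to [2 * zeta * |grad zeta|], the norm of the gradient of [zeta^2]. *)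
Definition picone_density (x : 'rV[R]_n) : R :=
  2 * eucl_norm (gradient zeta x) * (zeta x + (p - 1)) * (2 * L) `^ (p - 1).

Lemma continuous_picone_density : continuous picone_density.
Proof.
have c1 := continuous_gradient_norm tz; have c2 := test_function_continuous tz.
move=> x; have := cvgM (cvgM (cvgM (cvg_cst (2 : R)) (c1 x))
  (cvgD (c2 x) (cvg_cst (p - 1)))) (cvg_cst ((2 * L) `^ (p - 1))); exact.
Qed.

(** In the gradient of the test function, replace [grad phi] by [G + (grad phi - G)]. The part with
    [G] obeys Picone's inequality; the other is an error weighted by [|G|^(p-1)], since [zeta] and
    [dpic] are bounded by 1. *)
Lemma flux_le_picone (CE : R) phi (G : 'rV[R]_n) x : test_function phi -> B x ->
  0 <= w x -> picone_density x <= CE ->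
  eucl_norm G `^ (p - 2) * dot G (gradient (test phi) x) <=
  picone_density x + 2 * CE * `|phi x - w x| +
  \sum_i `|eucl_norm G `^ (p - 1) * (partial i phi x - G ord0 i)|.
Proof.
move=> tphi Bx wx ECE; set y := eucl_norm G.
have y0 : 0 <= y by exact: eucl_norm_ge0.
have /andP[z0 z1] := z01 x.
have yp1 : y `^ (p - 2) * y = y `^ (p - 1).
  have -> : p - 2 = p - 1 - 1 by ring.
  by rewrite mulrC mulr_powRB1.
have yp : y `^ (p - 1) * y = y `^ p by rewrite mulrC mulr_powRB1.
have gE : gradient (test phi) x =
    (2 * zeta x * pic p (phi x)) *: gradient zeta x +
    (zeta x ^+ 2 * dpic p (phi x)) *: (G + (gradient phi x - G)).
  have -> : G + (gradient phi x - G) = gradient phi x by rewrite addrC subrK.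
  by apply/rowP => i; rewrite !mxE partial_test.
rewrite gE dotDr !dotZr dotDr -eucl_norm_sqr -/y.
have h1 : y `^ (p - 2) * (2 * zeta x * pic p (phi x) * dot G (gradient zeta x)) <=
    2 * zeta x * eucl_norm (gradient zeta x) * pic p (phi x) * y `^ (p - 1).
  rewrite -yp1.
  have := le_trans (ler_norm _) (dot_cauchy_schwarz G (gradient zeta x)); rewrite -/y => cs.
  have c0 : 0 <= y `^ (p - 2) * (2 * zeta x * pic p (phi x)).
    by rewrite !mulr_ge0 ?powR_ge0// ltW// pic_gt0.
  rewrite mulrA (le_trans (ler_wpM2l c0 cs))//.
  by rewrite le_eqVlt; apply/orP; left; apply/eqP; ring.
have h2 : y `^ (p - 2) * (zeta x ^+ 2 * dpic p (phi x) * y ^+ 2) =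
    zeta x ^+ 2 * dpic p (phi x) * y `^ p by rewrite -yp -yp1; ring.
have h3 : y `^ (p - 2) * (zeta x ^+ 2 * dpic p (phi x) * dot G (gradient phi x - G)) <=
    \sum_i `|y `^ (p - 1) * (partial i phi x - G ord0 i)|.
  rewrite /dot !mulr_sumr; apply: ler_sum => i _; rewrite !mxE.
  set c := zeta x ^+ 2 * _; set d := partial i phi x - _.
  have c1 : `|c| <= 1.
    rewrite normrM mulr_ile1//; last exact: dpic_le1.
    by rewrite ger0_norm ?sqr_ge0// expr_le1.
  have Gy : `|G ord0 i| <= y by exact: coord_le_eucl_norm.
  have cgd : `|c * (G ord0 i * d)| <= y * `|d|.
    rewrite (normrM c) (normrM (G ord0 i)) -[leRHS]mul1r; apply: ler_pM => //.
    exact: ler_wpM2r.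
  rewrite -yp1 normrM ger0_norm ?mulr_ge0 ?powR_ge0// -[leRHS]mulrA.
  apply: ler_wpM2l; first exact: powR_ge0.
  exact: le_trans (ler_norm _) cgd.
have D01 : 0 <= eucl_norm (gradient zeta x) <= L by rewrite eucl_norm_ge0 zL.
have h4 : 2 * zeta x * eucl_norm (gradient zeta x) * pic p (phi x) * y `^ (p - 1) +
    zeta x ^+ 2 * dpic p (phi x) * y `^ p <=
    picone_density x + 2 * `|phi x - w x| * picone_density x.
  apply: (le_trans (picone_pointwise p1 p32 (phi x) (z01 x) D01 L0 y0 wx)).
  by rewrite -/(picone_density x) mulrDl mul1r.
have h5 : 2 * `|phi x - w x| * picone_density x <= 2 * CE * `|phi x - w x|.
  by rewrite mulrAC ler_wpM2r// ler_wpM2l.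
rewrite [leLHS](_ : _ = y `^ (p - 2) * (2 * zeta x * pic p (phi x) * dot G (gradient zeta x)) +
  y `^ (p - 2) * (zeta x ^+ 2 * dpic p (phi x) * y ^+ 2) +
  y `^ (p - 2) * (zeta x ^+ 2 * dpic p (phi x) * dot G (gradient phi x - G))); last by ring.
rewrite h2; apply: (lerD _ h3).
apply: (le_trans (lerD h1 (lexx _))); apply: (le_trans h4).
by rewrite lerD2l.
Qed.

(** The superlinear bound [fK] applies to [pic (w x)]. Passing to [pic (phi x)] costs at most
    [|phi - w|] because [pic] is 1-Lipschitz, and [f (w x) <= C] turns this into an error that is
    small in [L^1]. *)
Lemma source_ge_picone phi x : B x -> 0 <= w x -> f (w x) <= C ->
  K * (zeta x * zeta x) - l * C * `|phi x - w x| <= l * f (w x) * test phi x.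
Proof.
move=> Bx wx fwC; have /andP[z0 z1] := z01 x.
have fw0 := f0 wx; have lf0 : 0 <= l * f (w x) by rewrite mulr_ge0.
have z20 : 0 <= zeta x * zeta x by rewrite mulr_ge0.
have z21 : zeta x * zeta x <= 1 by rewrite mulr_ile1.
have pl := pic_lipschitz p1 p32 (w x) (phi x).
have h1 : pic p (w x) - `|phi x - w x| <= pic p (phi x).
  by rewrite distrC lerBlDl -lerBlDr (le_trans (ler_norm _)).
have h2 : K <= l * f (w x) * pic p (w x).
  exact: (le_trans (fK wx) (ler_wpM2l lf0 (pic_ge p1 wx))).
have h3 : l * f (w x) * `|phi x - w x| <= l * C * `|phi x - w x|.
  by rewrite ler_wpM2r// ler_wpM2l.
have h4 := ler_wpM2l lf0 h1; rewrite mulrBr in h4.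
have h5 : K - l * C * `|phi x - w x| <= l * f (w x) * pic p (phi x).
  exact: (le_trans (lerB h2 h3) h4).
have h6 := ler_wpM2r z20 h5; rewrite mulrBl in h6.
have -> : l * f (w x) * test phi x = l * f (w x) * pic p (phi x) * (zeta x * zeta x).
  by rewrite /test; ring.
apply: (le_trans _ h6); apply: (lerB (lexx _)).
exact: (ler_piMr (mulr_ge0 (mulr_ge0 l0 C0) (normr_ge0 _)) z21).
Qed.

(* Test the equation with [zeta ^ 2 * pic (phi_k)], where [phi_k] tends to [w]:
   Picone's inequality holds pointwise for each [k], so that only L^1 error
   terms have to pass to the limit. *)
Lemma picone_integral : K * \int[mu]_(x in B) (zeta x * zeta x) <=
  \int[mu]_(x in B) picone_density x.
Proof.
have [w_ge0 [G [[Lw LG _] [phi [tphi phiw phiG]]] eqn]] := w_sol.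
have mw : measurable_fun B w by case: Lw.
have mG i : measurable_fun B (fun x => G x ord0 i) by case: (LG i).
have mcont (F : 'rV[R]_n -> R) : continuous F -> measurable_fun B F.
  by move=> cF; apply: measurable_funTS; exact: continuous_measurable_rV.
have cphi k := test_function_continuous (tphi k).
have cdphi k i := test_function_partial_continuous (i := i) (tphi k).
have cz := test_function_continuous tz.
have cz2 : continuous (fun x => zeta x * zeta x).
  by move=> x; have := cvgM (cz x) (cz x); exact.
pose y x := eucl_norm (G x).
have mdotG (F : 'I_n -> 'rV[R]_n -> R) : (forall i, measurable_fun B (F i)) ->
    measurable_fun B (fun x => \sum_i G x ord0 i * F i x).
  by move=> mF; apply: measurable_sum => i; exact: measurable_funM.
have my : measurable_fun B y.
  apply: (@measurableT_comp _ _ _ _ _ _ (@Num.sqrt R)); last exact: mdotG.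
  by apply: continuous_measurable_fun; exact: sqrt_continuous.
have myp a : measurable_fun B (fun x => y x `^ a).
  exact: (measurableT_comp (measurable_powR a)).
have iyp : mu.-integrable B (EFin \o (fun x => y x `^ p)).
  apply: (ball_dominated_integrable (G := fun x => n.+1%:R `^ p * \sum_i `|G x ord0 i| `^ p)) => //.
    apply: integrableZl_ball; apply: integrable_sum_ball => i.
    exact: Lball_powR_integrable.
  by move=> x _; rewrite ger0_norm ?powR_ge0// eucl_norm_powR_le.
have iyp1 : mu.-integrable B (EFin \o (fun x => y x `^ (p - 1))).
  apply: (ball_dominated_integrable (G := fun x => 1 + y x `^ p)) => //.
    apply: integrableD_ball => //.
    exact: (continuous_ball_integrable (@cst_continuous _ _ (1 : R))).
  move=> x _; rewrite ger0_norm ?powR_ge0//.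
  have [y1|y1] := leP (y x) 1.
    rewrite (@le_trans _ _ 1)//; last by rewrite lerDl powR_ge0.
    rewrite -[leRHS](_ : 1 `^ (p - 1) = 1); last by rewrite powR1.
    by apply: ge0_ler_powR; rewrite ?nnegrE ?eucl_norm_ge0 ?(ltW t0).
  rewrite (@le_trans _ _ (y x `^ p))//; last by rewrite lerDr.
  by apply: ler_powR; [exact: ltW|rewrite gerBl].
(* [|G|^(p-1)] lies in the dual exponent, so by Hoelder its product with [partial i (phi k) - G]
   tends to 0 in [L^1]. *)
have Ly : Lball (p / (p - 1))%:E (fun x => y x `^ (p - 1)).
  split; first exact: myp.
  rewrite ball_normE ?gt_eqF ?divr_gt0//; apply: poweR_lty.
  have := integrable_fin_num mB iyp.
  rewrite ge0_fin_numE; last by apply: integral_ge0 => x _; rewrite lee_fin powR_ge0.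
  apply: le_lt_trans; rewrite le_eqVlt; apply/orP; left; apply/eqP.
  apply: eq_integral => x _.
  rewrite /= (ger0_norm (powR_ge0 _ _)) -powRrM mulrCA divff ?gt_eqF// mulr1//.
have iw : mu.-integrable B (EFin \o w) by exact: Lball_integrable (ltW p1) Lw.
pose I k := \int[mu]_(x in B) `|phi k x - w x|.
pose J i k := \int[mu]_(x in B) `|y x `^ (p - 1) * (partial i (phi k) x - G x ord0 i)|.
have mphiw k : measurable_fun B (fun x => phi k x - w x).
  by apply: measurable_funB => //; exact: mcont.
have mphiG i k : measurable_fun B (fun x => partial i (phi k) x - G x ord0 i).
  by apply: measurable_funB => //; exact: mcont.
have I0 : I k @[k --> \oo] --> (0 : R) by exact: ball_norm_cvg0_L1 phiw.
have J0 i : J i k @[k --> \oo] --> (0 : R).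
  apply: (@ball_holder_cvg0 _ _ (p / (p - 1)) p) => //; first exact: divr_gt0.
  by field; rewrite !gt_eqF.
have iphiw k : mu.-integrable B (EFin \o (fun x => `|phi k x - w x|)).
  apply: integrable_normr_ball; apply: integrableB_ball => //.
  exact: continuous_ball_integrable.
have iJ i k : mu.-integrable B
    (EFin \o (fun x => `|y x `^ (p - 1) * (partial i (phi k) x - G x ord0 i)|)).
  apply: integrable_normr_ball.
  have [Ck [Ck0 CkP]] := continuous_ball_bounded (cdphi k i).
  apply: (ball_dominated_integrable (G := fun x => Ck * y x `^ (p - 1) + y x `^ p)).
  - by apply: measurable_funM => //; exact: mphiG.
  - by apply: integrableD_ball => //; exact: integrableZl_ball.
  move=> x Bx; rewrite normrM (ger0_norm (powR_ge0 _ _)).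
  have y0 : 0 <= y x by exact: eucl_norm_ge0.
  rewrite -(mulr_powRB1 y0 p0) -mulrDl mulrC ler_wpM2r ?powR_ge0//.
  by rewrite (le_trans (ler_normB _ _))// lerD ?CkP// coord_le_eucl_norm.
have cE := continuous_picone_density.
have [CE [CE0 CEP]] := continuous_ball_bounded cE.
have EP x : B x -> picone_density x <= CE.
  by move=> /CEP; apply: le_trans; exact: ler_norm.
have iE := continuous_ball_integrable cE.
have main k : K * \int[mu]_(x in B) (zeta x * zeta x) - l * C * I k <=
    \int[mu]_(x in B) picone_density x + 2 * CE * I k + \sum_i J i k.
  have tt := test_function_test (tphi k).
  have [isrc eqk] := eqn _ tt.
  have low : K * \int[mu]_(x in B) (zeta x * zeta x) - l * C * I k <=
      \int[mu]_(x in B) (l * f (w x) * test (phi k) x).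
    rewrite /I -!RintegralZl//; last exact: continuous_ball_integrable.
    rewrite -RintegralB//; last 2 first.
    - by apply: integrableZl_ball; exact: continuous_ball_integrable.
    - exact: integrableZl_ball.
    apply: ae_le_Rintegral => //.
      apply: integrableB_ball; last exact: integrableZl_ball.
      by apply: integrableZl_ball; exact: continuous_ball_integrable.
    apply: filterS2 w_ge0 fC => x wx fx Bx.
    by apply: source_ge_picone => //; [exact: wx|exact: fx].
  apply: (le_trans low); rewrite -eqk /I /J -RintegralZl//.
  rewrite -Rintegral_sum_ball// -RintegralD//; last exact: integrableZl_ball.
  have iEI : mu.-integrable B (EFin \o
      (fun x => picone_density x + 2 * CE * `|phi k x - w x|)).
    by apply: integrableD_ball => //; exact: integrableZl_ball.
  rewrite -RintegralD//; last exact: integrable_sum_ball.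
  (* A weak solution comes with integrability of the source side. For the flux side, bounded
     derivatives of the test function give domination by a multiple of [|G|^(p-1)]. *)
  have iS : continuous (fun x => \sum_i `|partial i (test (phi k)) x|).
    elim: (index_enum _) => [|i r IH].
      by under eq_fun do rewrite big_nil; exact: cst_continuous.
    under eq_fun do rewrite big_cons.
    have ci := test_function_partial_continuous (i := i) tt.
    by move=> x; have := cvgD (cvg_norm (ci x)) (IH x); exact.
  have [CS [CS0 CSP]] := continuous_ball_bounded iS.
  apply: ae_le_Rintegral.
  - apply: (ball_dominated_integrable (G := fun x => CS * y x `^ (p - 1))).
    + apply: measurable_funM; first exact: myp.
      rewrite /dot; under eq_fun do under eq_bigr do rewrite mxE.
      apply: mdotG => i; apply: mcont.
      exact: (test_function_partial_continuous (i := i) tt).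
    + exact: integrableZl_ball.
    move=> x Bx; rewrite normrM (ger0_norm (powR_ge0 _ _)) -/(y x).
    have y0 : 0 <= y x by exact: eucl_norm_ge0.
    have yp1 : y x `^ (p - 2) * y x = y x `^ (p - 1).
      have -> : p - 2 = p - 1 - 1 by ring.
      by rewrite mulrC mulr_powRB1.
    rewrite -yp1 mulrCA ler_wpM2l ?powR_ge0//.
    have cs := le_trans (ler_norm _) (CSP x Bx).
    rewrite /dot; apply: (le_trans (ler_norm_sum _ _ _)).
    apply: (@le_trans _ _ ((\sum_i `|partial i (test (phi k)) x|) * y x)); last exact: ler_wpM2r.
    rewrite mulr_suml; apply: ler_sum => i _; rewrite mxE normrM mulrC ler_wpM2l//.
    exact: coord_le_eucl_norm.
  - by apply: integrableD_ball => //; exact: integrable_sum_ball.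
  apply: filterS w_ge0 => x wx Bx.
  by apply: flux_le_picone => //; [exact: wx|exact: EP].
have SJ0 : \sum_i J i k @[k --> \oo] --> (0 : R).
  elim: (index_enum _) => [|i r IH].
    by under eq_fun do rewrite big_nil; exact: cvg_cst.
  under eq_fun do rewrite big_cons.
  by have := cvgD (J0 i) IH; rewrite addr0; exact.
have err0 : 2 * CE * I k + l * C * I k + \sum_i J i k @[k --> \oo] --> (0 : R).
  have := cvgD (cvgD (cvgM (cvg_cst (2 * CE)) I0) (cvgM (cvg_cst (l * C)) I0)) SJ0.
  by rewrite !mulr0 !addr0; exact.
apply/ler_addgt0Pr => e e0.
have /cvgrPdist_le/(_ e e0)[k _ /(_ k (leqnn k))] := err0.
rewrite /= sub0r normrN => /(le_trans (ler_norm _)) ke.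
have := main k; lra.
Qed.

End picone_inequality.

(** * The limit p -> 1 *)

(** Subtracting [e * x] makes [g] strictly decreasing, as [decr_derive1_le0] requires; then [e]
    tends to 0. *)
Lemma nonincreasing_derive_le0 (R : realType) (g : R -> R) (s dg : R) :
  (forall x, derivable g x 1) -> (forall x y, x <= y -> g y <= g x) ->
  is_derive s (1 : R) g dg -> dg <= 0.
Proof.
move=> dgx gni gs; apply/ler_addgt0Pr => e e0; rewrite add0r.
pose h (x : R) : R := g x - e * x.
have de x d : is_derive x (1 : R) g d -> is_derive x (1 : R) h (d - e).
  move=> dd; have d2 := is_deriveB dd (is_deriveZ e (is_derive_id x (1 : R))).
  by apply: (is_derive_eq d2); rewrite [_ *: _]mulr1.
have := @decr_derive1_le0 _ h setT s; rewrite derive1E.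
have [_ ->] := de s dg gs; rewrite interiorT subr_le0; apply => //.
- by move=> x _; have [] := de x _ (derivableP (dgx x)).
- move=> x y _ _ xy; rewrite /h; apply: ler_ltB; first exact: gni (ltW xy).
  by rewrite ltr_pM2l.
Qed.

(** * A radial cut-off *)

Section cutoff.
Context {R : realType} {n : nat} (rho : R) (rho0 : 0 < rho) (rho1 : rho < 1).
Local Notation mu := (@lebesgue_rV R n).
Local Notation B := (@unit_ball R n).
Let mB := @measurable_unit_ball R n.
Let eta : R := (1 - rho) / 2.

(** As [1 - 2 * eta = rho], this descends from 1 to 0 between [rho] and [1 - eta]; the remaining
    margin [eta] keeps the support compact in the open ball. *)
Definition cut (s : R) : R := step ((1 - eta - s) / eta).

Let eta0 : 0 < eta.
Proof. by rewrite divr_gt0// subr_gt0. Qed.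

Lemma Ck_cut k : Ck k cut.
Proof.
apply: (@Ck_comp _ _ (@step R) (fun s => (1 - eta - s) / eta)); first exact: Ck_step.
apply: CkM; last exact: Ck_cst.
apply: CkD; first exact: Ck_cst.
by apply: CkN; exact: Ck_id.
Qed.

Lemma cut_itv s : 0 <= cut s <= 1.
Proof. exact: step_itv. Qed.

Lemma cut_right s : 1 - eta <= s -> cut s = 0.
Proof. by move=> h; rewrite /cut step0// pmulr_lle0 ?invr_gt0// subr_le0. Qed.

Lemma cut_left s : s <= rho -> cut s = 1.
Proof.
move=> h; rewrite /cut step1// ler_pdivlMr// mul1r lerBrDr.
have : rho = 1 - 2 * eta by rewrite /eta; field.
move: h; set e := eta; lra.
Qed.

Let dcut (s : R) : R := 'D_1 cut s.

Let dcutP s : is_derive s (1 : R) cut (dcut s).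
Proof. by apply/derivableP; have [+ _] := Ck_cut 1; exact. Qed.

Lemma dcut_le0 s : dcut s <= 0.
Proof.
apply: (nonincreasing_derive_le0 _ _ (dcutP s)).
- by move=> x; have [+ _] := Ck_cut 1; exact.
- move=> x y xy; apply: step_nondecreasing.
  by rewrite ler_pM2r ?invr_gt0// lerD2l lerN2.
Qed.

Lemma dcut_left s : s < rho -> dcut s = 0.
Proof.
move=> sr; rewrite /dcut -(@derive_cst _ _ _ (1 : R) s 1).
apply: near_eq_derive; near=> y; rewrite cut_left//.
by near: y; exact: lt_le_nbhsl.
Unshelve. all: by end_near. Qed.

Definition zcut (x : 'rV[R]_n) : R := cut (dot x x).

Lemma test_function_zcut : test_function zcut.
Proof.
apply: (test_function_radial (psi := cut) (d := eta)) => //; first exact: Ck_cut.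
exact: cut_right.
Qed.

Lemma partial_zcut (i : 'I_n) x : partial i zcut x = dcut (dot x x) * (2 * x ord0 i).
Proof. exact: (partialE (partial_radial i (dcutP (dot x x)))). Qed.

Lemma gradient_zcut_norm x :
  eucl_norm (gradient zcut x) = - (2 * dcut (dot x x) * eucl_norm x).
Proof.
have -> : gradient zcut x = (2 * dcut (dot x x)) *: x.
  by apply/rowP => i; rewrite !mxE partial_zcut mulrCA mulrA.
rewrite /eucl_norm dotZr dotC dotZr mulrA -expr2 sqrtrM ?sqr_ge0// sqrtr_sqr.
by rewrite ler0_norm ?mulNr// pmulr_rle0// dcut_le0.
Qed.

(** For a radially decreasing [zeta], [- x . grad (zeta^2) = |x| |grad (zeta^2)|], and the left side
    integrates to [n] times the integral of [zeta^2]. The gradient lives where [|x|^2 >= rho]; there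
    [|x| >= rho] because [rho < 1], which explains the constant [n / rho]. *)
Lemma zcut_total_variation :
  \int[mu]_(x in B) (2 * zcut x * eucl_norm (gradient zcut x)) <=
  n%:R / rho * \int[mu]_(x in B) (zcut x * zcut x).
Proof.
have tz := test_function_zcut.
have cz := test_function_continuous tz.
have cdz i := test_function_partial_continuous (i := i) tz.
have cM (E1 E2 : 'rV[R]_n -> R) : continuous E1 -> continuous E2 ->
    continuous (fun x => E1 x * E2 x).
  by move=> c1 c2 x; have := cvgM (c1 x) (c2 x); exact.
pose zz (x : 'rV[R]_n) := zcut x * zcut x.
have tzz : test_function zz.
  apply: (test_function_radial (psi := fun s => cut s * cut s) (d := eta)) => //.
    by move=> k; apply: CkM; exact: Ck_cut.
  by move=> s /cut_right ->; rewrite mul0r.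
have dzz i x : partial i zz x = 2 * zcut x * partial i zcut x.
  have dz := test_function_is_derive i x tz.
  rewrite (partialE (is_deriveM dz dz)).
  by rewrite -[LHS]/(zcut x * partial i zcut x + zcut x * partial i zcut x); ring.
have cc (j : 'I_n) : continuous (fun x : 'rV[R]_n => x ord0 j) by exact: coord_continuous.
have divE : n%:R * \int[mu]_(x in B) zz x =
    - \int[mu]_(x in B) (\sum_i (x ord0 i * partial i zz x)).
  rewrite Rintegral_sum_ball; last first.
    move=> i; apply: continuous_ball_integrable; apply: (cM _ _ (cc i)).
    exact: (test_function_partial_continuous (i := i) tzz).
  rewrite -sumrN (eq_bigr (fun=> \int[mu]_(x in B) zz x)).
    by rewrite sumr_const card_ord mulr_natl.
  move=> i _.
  have d1 x : is_derive x (delta_mx ord0 i) (fun y : 'rV[R]_n => y ord0 i) ((cst 1 : 'rV[R]_n -> R) x).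
    by have := is_derive_coord i i x; rewrite eqxx; exact.
  rewrite (Rintegral_by_parts (cc i) (@cst_continuous _ _ (1 : R)) d1 tzz) opprK.
  by apply: eq_Rintegral => x _; rewrite mul1r.
have czz : continuous zz by exact: test_function_continuous tzz.
rewrite mulrAC divE -mulN1r mulrC mulrA -RintegralZl//; last first.
  apply: (continuous_ball_integrable (F := fun x : 'rV[R]_n => \sum_i (x ord0 i * partial i zz x))).
  elim: (index_enum _) => [|i s IH]; first by under eq_fun do rewrite big_nil; exact: cst_continuous.
  under eq_fun do rewrite big_cons.
  have c1 := cM _ _ (cc i) (test_function_partial_continuous (i := i) tzz).
  by move=> x; have := cvgD (c1 x) (IH x); exact.
have cg := continuous_gradient_norm tz.
apply: le_Rintegral => //.
- apply: continuous_ball_integrable; apply: (cM _ _ _ cg).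
  exact: (cM _ _ (@cst_continuous _ _ (2 : R)) cz).
- apply: integrableZl_ball; apply: integrable_sum_ball => i.
  apply: continuous_ball_integrable; apply: (cM _ _ (cc i)).
  exact: (test_function_partial_continuous (i := i) tzz).
move=> x Bx; set s := dot x x; set r := eucl_norm x.
have sE : s = r ^+ 2 by rewrite /r eucl_norm_sqr.
have r0 : 0 <= r by exact: eucl_norm_ge0.
have /andP[z0 _] : 0 <= zcut x <= 1 by exact: cut_itv.
have -> : \sum_i x ord0 i * partial i zz x = 4 * zcut x * dcut s * s.
  rewrite /s {2}/dot mulr_sumr; apply: eq_bigr => i _.
  by rewrite dzz partial_zcut; ring.
rewrite gradient_zcut_norm -/s -/r.
have [sr|rs] := ltP s rho; first by rewrite (dcut_left sr) !(mulr0, mul0r, oppr0).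
have r1 : rho <= r.
  rewrite -(@ler_pXn2r _ 2)// ?nnegrE ?(ltW rho0)// -sE (le_trans _ rs)//.
  by rewrite expr2 ler_piMl ?(ltW rho0)// ltW.
pose k := zcut x * (- dcut s); have k0 : 0 <= k by rewrite mulr_ge0// oppr_ge0 dcut_le0.
have -> : 2 * zcut x * - (2 * dcut s * r) = 4 * k * r by rewrite /k; ring.
have -> : rho^-1 * -1 * (4 * zcut x * dcut s * s) = 4 * k * (r / rho * r).
  by rewrite /k; move: (dcut s) => d; rewrite sE; field; rewrite gt_eqF.
apply: ler_wpM2l; first by rewrite mulr_ge0.
by rewrite -[leLHS]mul1r; apply: ler_wpM2r => //; rewrite ler_pdivlMr// mul1r.
Qed.

Lemma zcut_mass_gt0 : (0 < n)%N -> 0 < \int[mu]_(x in B) (zcut x * zcut x).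
Proof.
move=> n0; have n1 : 1 <= n%:R :> R by rewrite ler1n.
have n1' : 0 < n%:R :> R by exact: lt_le_trans n1.
(* Half-side of a cube on which [zcut] is 1: there [dot x x <= n * a^2 = rho^2 / n <= rho]. *)
pose a : R := rho / n%:R; have a0 : 0 < a by rewrite divr_gt0.
have cz := test_function_continuous test_function_zcut.
have czz : continuous (fun x => zcut x * zcut x).
  by move=> x; have := cvgM (cz x) (cz x); exact.
pose Q := [set x : 'rV[R]_n | forall i, `|x ord0 i| <= a].
have [mQ _] := @cube_finite R n a.
have Qdot x : Q x -> dot x x <= rho.
  move=> Qx; apply: (@le_trans _ _ (\sum_(i < n) a ^+ 2)).
    apply: ler_sum => i _; rewrite -expr2 -real_normK ?num_real//.
    by rewrite lerXn2r ?nnegrE ?(ltW a0).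
  rewrite sumr_const card_ord -mulr_natl /a expr2 mulrA.
  have -> : n%:R * (rho / n%:R) = rho by rewrite mulrC divfK// gt_eqF.
  rewrite ler_piMr ?(ltW rho0)// ler_pdivrMr// mul1r.
  exact: (le_trans (ltW rho1) n1).
have QB : Q `<=` B by move=> x /Qdot h; apply/unit_ballE; exact: le_lt_trans rho1.
have Qpos : (0 < mu Q)%E.
  rewrite /Q (_ : [set x | _] = [set x : 'rV[R]_n | forall i, `[- a, a]%classic (x ord0 i)]); last first.
    by apply/seteqP; split => x xM i; have := xM i; rewrite /= in_itv/= ler_norml.
  rewrite (@lebesgue_rV_box R n (fun=> `[- a, a]%classic))//.
  apply: (big_ind (fun x : \bar R => (0 < x)%E)); [by []|by move=> x y; exact: mule_gt0|move=> i _ /=].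
  rewrite lebesgue_measure_itv/= lte_fin ifT; last by lra.
  by rewrite -EFinB lte_fin; lra.
have izz := continuous_ball_integrable czz.
have fin := integrable_fin_num mB izz.
rewrite -lte_fin /Rintegral fineK//.
apply: (lt_le_trans Qpos).
have -> : mu Q = (\int[mu]_(x in Q) (zcut x * zcut x)%:E)%E.
  rewrite (eq_integral (cst 1%E)); first by rewrite integral_cst// mul1e.
  by move=> x; rewrite inE => /Qdot h; rewrite /zcut cut_left// mulr1.
apply: ge0_subset_integral => //.
- by apply/measurable_EFinP; apply: measurable_funTS; exact: continuous_measurable_rV.
- by move=> x _; rewrite lee_fin -expr2 sqr_ge0.
Qed.

End cutoff.

(** * Existence and nonexistence for p close to 1 *)

Section limit_p_to_1.
Context {R : realType}.

Lemma powR_exponent_cvg (a : R) : 0 < a -> a `^ (p - 1) @[p --> 1^'+] --> (1 : R).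
Proof.
move=> a0; apply: cvg_at_right_filter.
rewrite (_ : (fun p => _) = fun p : R => expR ((p - 1) * ln a)); last first.
  by apply/funext => p; rewrite /powR gt_eqF.
have c1 : continuous (fun p : R => (p - 1) * ln a).
  move=> p; have := cvgM (cvgB (@cvg_id _ (nbhs p)) (cvg_cst (1 : R))) (cvg_cst (ln a)).
  exact.
have c2 : (fun p : R => expR ((p - 1) * ln a)) @ (1 : R) --> expR ((1 - 1) * ln a).
  apply: (@continuous_comp _ _ _ (fun p : R => (p - 1) * ln a) (@expR R)); first exact: c1.
  exact: continuous_expR.
by move: c2; rewrite subrr mul0r expR0; exact.
Qed.

(** The bound must be uniform in [s] for each [p]. Superlinearity is used at a single exponent [q],
    which fixes a threshold [s0]; for [p <= q] the weight with exponent [p - 1] is below the one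
    with [q - 1]. On [[0, s0]] the weight is at most [(1 + 2 s0)^(p-1)], which tends to 1, and
    [K < l f(0)] leaves room. *)
Lemma superlinear_bound (f : R -> R) (l K : R) : 0 < l -> 0 < K -> K < l * f 0 ->
  (forall s t, 0 <= s -> s <= t -> f s <= f t) ->
  (\forall p \near 1^'+, f s / s `^ (p - 1) @[s --> +oo] --> +oo) ->
  \forall p \near 1^'+, forall s, 0 <= s -> K <= l * f s * (1 + 2 * s) `^ (1 - p).
Proof.
move=> l0 K0 Kf fnd fsup.
have /filter_ex[q [q1 /cvgryPge fq]] : \forall q \near (1 : R)^'+,
    1 < q /\ (f s / s `^ (q - 1) @[s --> +oo] --> +oo).
  by near=> q; split; [near: q; exact: nbhs_right_gt|near: q; exact: fsup].
(* This threshold yields [l f(s) >= K (3 s)^(q-1)] for large [s], and [1 + 2 s <= 3 s] for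
   [s >= 1]. *)
have [S [_ SP]] := fq (K / l * 3 `^ (q - 1)).
pose s0 := Num.max (S + 1) 1.
have s01 : 1 <= s0 by rewrite le_max lexx orbT.
have s0S : S < s0 by rewrite lt_max ltrDl ltr01.
have b0 : 0 < 1 + 2 * s0 by rewrite ltr_wpDr// mulr_ge0// (le_trans ler01).
near=> p; have p1 : 1 < p by near: p; exact: nbhs_right_gt.
have t0 : 0 <= p - 1 by rewrite subr_ge0 ltW.
have pq : p <= q by near: p; exact: nbhs_right_ltW.
have lim1 : (1 + 2 * s0) `^ (p - 1) < l * f 0 / K.
  near: p; apply: (cvgr_lt _ (powR_exponent_cvg b0)).
  by rewrite ltr_pdivlMr// mul1r.
move=> s sge0; have b1 : 0 < 1 + 2 * s by rewrite ltr_wpDr// mulr_ge0.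
have -> : (1 + 2 * s) `^ (1 - p) = ((1 + 2 * s) `^ (p - 1))^-1 by rewrite -powRN opprB.
rewrite ler_pdivlMr ?powR_gt0//.
have [ss0|/ltW ss0] := leP s s0.
  have h1 : (1 + 2 * s) `^ (p - 1) <= (1 + 2 * s0) `^ (p - 1).
    by apply: ge0_ler_powR; rewrite ?nnegrE ?(ltW b0) ?(ltW b1)// lerD2l ler_wpM2l.
  have h2 : l * f 0 <= l * f s by rewrite ler_wpM2l ?(ltW l0)// fnd.
  apply: le_trans h2; rewrite mulrC -ler_pdivlMr//.
  exact: le_trans h1 (ltW lim1).
have sp : 0 < s by rewrite (lt_le_trans ltr01)// (le_trans s01).
have hs : K / l * 3 `^ (q - 1) <= f s / s `^ (q - 1) by exact: SP (lt_le_trans s0S ss0).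
have h3 : (3 * s) `^ (q - 1) = 3 `^ (q - 1) * s `^ (q - 1) by rewrite powRM// ltW.
have hs2 : K * (3 * s) `^ (q - 1) <= l * f s.
  rewrite -ler_pdivrMl// mulrA [l^-1 * K]mulrC h3 mulrA.
  by rewrite -ler_pdivlMr// powR_gt0.
apply: le_trans hs2; apply: (ler_wpM2l (ltW K0)).
have b13 : 1 + 2 * s <= 3 * s.
  by have := le_trans s01 ss0; lra.
apply: (@le_trans _ _ ((1 + 2 * s) `^ (q - 1))).
  by apply: ler_powR; rewrite ?lerD2r// lerDl mulr_ge0.
apply: ge0_ler_powR => //; rewrite ?nnegrE ?(ltW b1)//.
- by rewrite subr_ge0 ltW.
- by rewrite mulr_ge0.
Unshelve. all: by end_near. Qed.

Lemma essentially_bounded (n : nat) (F : 'rV[R]_n -> R) : Lball +oo F ->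
  exists C, 0 <= C /\ {ae lebesgue_rV n, forall x, unit_ball x -> F x <= C}.
Proof.
move=> [_]; rewrite /ball_norm unlock; case: ifPn => [_|mu0 _].
  set g := (abse \o _); move=> goo; exists `|fine (ess_sup (lebesgue_rV n) g)|.
  split => //; apply: filterS (ess_sup_ge (lebesgue_rV n) g) => x gx Bx.
  apply: le_trans (ler_norm _) _; rewrite -lee_fin.
  have gE : g x = `|F x|%:E by rewrite /g /= patchE mem_set.
  move: goo gx; rewrite gE; case: (ess_sup _ _) => [r| |] //= _.
  by rewrite !lee_fin => /le_trans; apply; exact: ler_norm.
(* If the whole space had measure 0, the norm would be 0 by convention; any property then holds
   almost everywhere. *)
exists 0; split => //; exists setT; split => //.
by apply/eqP; rewrite eq_le measure_ge0 andbT leNgt.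
Qed.

(** The means [K] and [K'] satisfy [N < K' < K < l f(0)]. The cut-off with [rho = N / K'], its mass
    [I] and its gradient bound [L1] are fixed before [p]. Picone's inequality then bounds [K * I] by
    a quantity that tends to at most [K' * I], a contradiction because [I > 0]. *)
Lemma nonexistence_near (N : nat) (f : R -> R) (l : R) : (0 < N)%N -> 0 < l ->
  (forall s, 0 <= s -> 0 <= f s) ->
  (forall s t, 0 <= s -> s <= t -> f s <= f t) ->
  (\forall p \near 1^'+, f s / s `^ (p - 1) @[s --> +oo] --> +oo) ->
  N%:R < l * f 0 ->
  \forall p \near 1^'+, forall w : 'rV[R]_N -> R, ~ regular_solution f p l w.
Proof.
move=> N0 l0 f0 fnd fsup Nl.
have N1 : 0 < N%:R :> R by rewrite ltr0n.
pose K := (N%:R + l * f 0) / 2; pose K' := (N%:R + K) / 2.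
have NK' : N%:R < K' by rewrite /K' /K; move: (l * f 0) Nl => c; lra.
have K'K : K' < K by rewrite /K' /K; move: (l * f 0) Nl => c; lra.
have Kl : K < l * f 0 by rewrite /K; move: (l * f 0) Nl => c; lra.
have K'0 : 0 < K' by exact: lt_trans NK'.
have K0 : 0 < K by exact: lt_trans K'K.
pose rho := N%:R / K'; have rho0 : 0 < rho by rewrite divr_gt0.
have rho1 : rho < 1 by rewrite ltr_pdivrMr// mul1r.
pose zeta := @zcut R N rho.
have tz : test_function zeta by exact: test_function_zcut.
pose D x := eucl_norm (gradient zeta x).
have cD : continuous D by exact: continuous_gradient_norm.
have [L [L0' DL]] := continuous_ball_bounded cD.
have L0 : 0 < L + 1 by rewrite ltr_wpDl.
have DL1 x : unit_ball x -> D x <= L + 1.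
  by move=> /DL h; rewrite (le_trans (ler_norm _))// (le_trans h)// lerDl.
set L1 := L + 1 in L0 DL1.
pose I := \int[lebesgue_rV N]_(x in unit_ball) (zeta x * zeta x).
have I0 : 0 < I by exact: zcut_mass_gt0.
pose m := \int[lebesgue_rV N]_(x in unit_ball) D x.
have TV : \int[lebesgue_rV N]_(x in unit_ball) (2 * zeta x * D x) <= K' * I.
  have := @zcut_total_variation R N rho rho0 rho1.
  have -> : N%:R / rho = K' by rewrite /rho; field; rewrite !gt_eqF.
  exact.
have lim : (2 * L1) `^ (p - 1) * (K' * I + 2 * (p - 1) * m) @[p --> 1^'+] --> K' * I.
  have L2 : 0 < 2 * L1 by rewrite mulr_gt0.
  have c2 : 2 * (p - 1) * m @[p --> 1^'+] --> (0 : R).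
    apply: cvg_at_right_filter.
    have := cvgM (cvgM (cvg_cst (2 : R)) (cvgB (@cvg_id _ (nbhs (1 : R))) (cvg_cst (1 : R)))) (cvg_cst m).
    by rewrite subrr mulr0 mul0r; exact.
  have := cvgM (powR_exponent_cvg L2) (cvgD (cvg_cst (K' * I)) c2).
  by rewrite mul1r addr0; exact.
near=> p; have p1 : 1 < p by near: p; exact: nbhs_right_gt.
have p32 : p * 2 <= 3.
  have : p <= 3 / 2 by near: p; apply: nbhs_right_ltW; lra.
  lra.
have fK : forall s, 0 <= s -> K <= l * f s * (1 + 2 * s) `^ (1 - p).
  by near: p; exact: superlinear_bound.
have small : (2 * L1) `^ (p - 1) * (K' * I + 2 * (p - 1) * m) < K * I.
  by near: p; apply: (cvgr_lt _ lim); rewrite ltr_pM2r.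
move=> w [wsol wreg].
have [C [C0 fC]] := essentially_bounded wreg.
have z01 x : 0 <= zeta x <= 1 by exact: cut_itv.
have := picone_integral p1 p32 (ltW l0) C0 L0 f0 fK wsol fC tz z01 DL1.
apply/negP; rewrite -ltNge -/I; apply: le_lt_trans small.
have cz := test_function_continuous tz.
have czD : continuous (fun x => 2 * zeta x * D x).
  by move=> x; have := cvgM (cvgM (cvg_cst (2 : R)) (cz x)) (cD x); exact.
set k := (2 * L1) `^ (p - 1); have k0 : 0 <= k by exact: powR_ge0.
have -> : \int[lebesgue_rV N]_(x in unit_ball) picone_density p L1 zeta x =
    k * (\int[lebesgue_rV N]_(x in unit_ball) (2 * zeta x * D x) + 2 * (p - 1) * m).
  rewrite /m -RintegralZl//; last 2 first.
  - exact: measurable_unit_ball.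
  - exact: continuous_ball_integrable.
  rewrite -RintegralD//; last 3 first.
  - exact: measurable_unit_ball.
  - exact: continuous_ball_integrable.
  - by apply: integrableZl_ball; exact: continuous_ball_integrable.
  rewrite -RintegralZl//; last 2 first.
  - exact: measurable_unit_ball.
  - apply: integrableD_ball; first exact: continuous_ball_integrable.
    by apply: integrableZl_ball; exact: continuous_ball_integrable.
  by apply: eq_Rintegral => x _; rewrite /picone_density -/(D x) -/k; ring.
by apply: (ler_wpM2l k0); rewrite lerD2r.
Unshelve. all: by end_near. Qed.

Lemma existence_near (N : nat) (f : R -> R) (l e : R) : (0 < N)%N -> 0 <= l ->
  (forall s, 0 <= s -> 0 <= f s) ->
  (forall s t, 0 <= s -> s <= t -> f s <= f t) ->
  C1_halfline f -> l * f 0 < N%:R -> 0 < e ->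
  \forall p \near 1^'+, exists v : 'rV[R]_N -> R,
    regular_solution f p l v /\ forall x, unit_ball x -> 0 <= v x <= e.
Proof.
move=> N0 l0 f0 fnd fC1 lN e0.
have N1 : 0 < N%:R :> R by rewrite ltr0n.
have cF := continuous_extension fC1.
have [M [M0 Me lM]] : exists M, [/\ 0 < M, M <= e & l * f M < N%:R].
  have cl : continuous (fun s : R => l * f (Num.max 0 s)).
    by move=> s; have := cvgM (cvg_cst l) (cF s); exact.
  have h0 : l * f (Num.max 0 0) < N%:R by rewrite maxxx.
  have [d /= d0 dP] := cvgr_lt _ (cl 0) _ h0.
  (* Half of [d] puts [M] strictly inside the neighbourhood of 0 on which [l f < N]. *)
  pose M := Num.min (d / 2) e; have M0 : 0 < M by rewrite lt_min divr_gt0.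
  exists M; split => //; first by rewrite ge_min lexx orbT.
  have := dP M; rewrite /= sub0r normrN gtr0_norm// (max_idPr (ltW M0)); apply.
  by rewrite gt_min ltr_pdivrMr// ltr_pMr// ltr1n.
pose t := l * f M / N%:R.
have t0 : 0 <= t by rewrite divr_ge0 ?(ltW N1)// mulr_ge0// f0// ltW.
have t1 : t < 1 by rewrite ltr_pdivrMr// mul1r.
(* As [t < 1], some fixed power [t^(k+1)] is below [M]; then [1 / (p - 1) >= k + 1] for [p] close to
   1 gives [t^(1/(p-1)) <= M]. *)
have [k tk] : exists k : nat, t ^+ k.+1 <= M.
  have /cvgrPdist_le/(_ M M0)[k _ kP] := @cvg_expr _ t (ltac:(by rewrite ger0_norm)).
  exists k; have := kP k.+1 (leqnSn k); rewrite /= sub0r normrN.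
  exact: le_trans (ler_norm _).
near=> p; have p1 : 1 < p by near: p; exact: nbhs_right_gt.
have p2 : p < 2 by near: p; apply: nbhs_right_lt; rewrite ltr1n.
have pk : p - 1 <= k.+1%:R^-1.
  rewrite lerBlDr; near: p; apply: nbhs_right_ltW.
  by rewrite ltrDr invr_gt0.
have p10 : 0 < p - 1 by rewrite subr_gt0.
have KM : t `^ (p - 1)^-1 <= M.
  have [tz|tn0] := eqVneq t 0; first by rewrite tz powR0 ?(ltW M0)// invr_eq0 gt_eqF.
  apply: le_trans tk; rewrite -powR_mulrn//.
  apply: ger_powR; first by rewrite lt_neqAle eq_sym tn0 t0 ltW.
  by rewrite -[leLHS]invrK lef_pV2 ?posrE// invr_gt0.
have p12 : 1 < p < 2 by rewrite p1.
have [v [vreg vM]] := radial_regular_solution N0 l0 p12 (ltW M0) f0 fnd fC1 KM.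
exists v; split => // x /vM/andP[-> vx]; exact: le_trans Me.
Unshelve. all: by end_near. Qed.

End limit_p_to_1.

Theorem theorem6p5 (R : realType) (N : nat) (N_ge1 : (1 <= N)%N)
    (f : R -> R)
    (f_ge0 : forall s, 0 <= s -> 0 <= f s)
    (f_incr : forall s t, 0 <= s -> s <= t -> f s <= f t)
    (f_C1 : C1_halfline f)
    (f0_gt0 : 0 < f 0)
    (f_superlinear :
      \forall p \near 1^'+, f s / s `^ (p - 1) @[s --> +oo] --> +oo)
    (lstar : R -> R) (w : R -> R -> 'rV[R]_N -> R)
    (w_branch : \forall p \near 1^'+, minimal_branch f p (lstar p) (w p)) :
  lstar p @[p --> 1^'+] --> N%:R / f 0 /\
  (forall l, 0 <= l < N%:R / f 0 ->
    ball_norm +oo (w p l) @[p --> 1^'+] --> 0%E).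
Proof.
have N0 : 0 < N%:R :> R by rewrite ltr0n.
have c0 : 0 < N%:R / f 0 by rewrite divr_gt0.
have lf (l : R) : (l * f 0 < N%:R) = (l < N%:R / f 0) by rewrite ltr_pdivlMr.
have lower (l e : R) : 0 <= l -> l < N%:R / f 0 -> 0 < e ->
    \forall p \near 1^'+, exists v : 'rV[R]_N -> R,
      regular_solution f p l v /\ forall x, unit_ball x -> 0 <= v x <= e.
  by move=> l0 ll e0; apply: existence_near; rewrite ?lf.
have lstar_ge (l : R) : 0 <= l -> l < N%:R / f 0 -> \forall p \near 1^'+, l <= lstar p.
  move=> l0 ll; near=> p.
  have wb : minimal_branch f p (lstar p) (w p) by near: p.
  have [v [vreg _]] : exists v : 'rV[R]_N -> R,
      regular_solution f p l v /\ forall x, unit_ball x -> 0 <= v x <= 1.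
    by near: p; exact: lower.
  by rewrite leNgt; apply/negP => /(branch_nonexistence wb)/(_ v vreg).
split.
  apply/cvgrPdist_le => e e0; have l0 : 0 < N%:R / f 0 + e by rewrite addr_gt0.
  near=> p; have wb : minimal_branch f p (lstar p) (w p) by near: p.
  (* [lstar_ge] asks for a nonnegative parameter, while the difference may be negative. *)
  have ge : Num.max 0 (N%:R / f 0 - e) <= lstar p.
    near: p; apply: lstar_ge; first by rewrite le_max lexx.
    by rewrite gt_max c0 gtrBl.
  have le : lstar p <= N%:R / f 0 + e.
    have none : forall u : 'rV[R]_N -> R, ~ regular_solution f p (N%:R / f 0 + e) u.
      near: p; apply: nonexistence_near => //.
      by rewrite mulrDl divfK ?gt_eqF// ltrDl mulr_gt0.
    (* Below the critical value the branch itself provides a regular solution, which [none]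
       excludes. *)
    rewrite leNgt; apply/negP => lt; have l0lt : 0 <= N%:R / f 0 + e < lstar p by rewrite lt ltW.
    by have [/none] := branch_minimal wb l0lt.
  move: ge; rewrite ge_max => /andP[_ ge].
  by rewrite ler_distlC ge le.
(* Minimality is available only strictly below [lstar p], whereas [lstar_ge] gives a weak
   inequality; the midpoint [m] makes it strict for [l]. *)
move=> l /andP[l0 ll]; pose m := (l + N%:R / f 0) / 2.
have [lm mm] : l < m /\ m < N%:R / f 0 by rewrite /m; split; lra.
have bound e : 0 < e -> \forall p \near 1^'+, (ball_norm +oo (w p l) <= e%:E)%E.
  move=> e0; near=> p.
  have wb : minimal_branch f p (lstar p) (w p) by near: p.
  have ml : m <= lstar p by near: p; apply: lstar_ge => //; exact: le_trans (ltW lm).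
  have [v [[vsol _] ve]] : exists v : 'rV[R]_N -> R,
      regular_solution f p l v /\ forall x, unit_ball x -> 0 <= v x <= e.
    by near: p; exact: lower.
  have lls : 0 <= l < lstar p by rewrite l0 (lt_le_trans lm).
  have [[[w0 _] _] wmin] := branch_minimal wb lls.
  rewrite /ball_norm unlock; case: ifPn => _; last by rewrite lee_fin ltW.
  apply/ess_supP; apply: filterS2 w0 (wmin v vsol) => x wx wv.
  rewrite /= patchE; case: ifPn => [|_]; last by rewrite normr0 lee_fin ltW.
  rewrite inE => Bx; have /andP[_ vx] := ve x Bx.
  by rewrite lee_fin ger0_norm ?wx// (le_trans (wv Bx)).
apply/fine_cvgP; split.
  have := bound 1 ltr01; apply: filterS => p h.
  by rewrite ge0_fin_numE ?Lnorm_ge0// (le_lt_trans h)// ltry.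
apply/cvgrPdist_le => e e0; have := bound e e0; apply: filterS => p h.
have n0 : (0 <= ball_norm +oo (w p l))%E by exact: Lnorm_ge0.
rewrite /= sub0r normrN ger0_norm ?fine_ge0// -lee_fin fineK//.
by rewrite ge0_fin_numE// (le_lt_trans h)// ltry.
Unshelve. all: by end_near. Qed.
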